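(* Let $F_e$ be the cellular automaton on $X=\{E_0,E_1,E_2,E_3,0,R,L\}^{\mathbb{Z}}\times\{0,1\}^{\mathbb{Z}}$ and $\mu_c$ the $F_e$-invariant and shift-invariant probability measure on $X$ defined in the context. Then the cellular automaton $(S(\mu_c),F_e)$, i.e. the restriction of $F_e$ to the topological support $S(\mu_c)$ of $\mu_c$, is sensitive, in the sense that it has no equicontinuous points: there is no $x\in S(\mu_c)$ such that for every positive integer $n$ there exists a positive integer $m$ with $C_m(x)\cap S(\mu_c)\subset B_n(x)$.
   Context: **General notions.** For a finite alphabet $A$, a cellular automaton on $A^{\mathbb{Z}}$ is a continuous self-map commuting with the shift $\sigma(x)=(x_{i+1})_{i\in\mathbb{Z}}$. The product $X=X^1\times X^2$ below is identified with $A^{\mathbb{Z}}$ for the product alphabet $A$. The topological support of a measure is the smallest closed set of full measure. For $n\in\mathbb{N}$ and a point $x\in X$, put $C_n(x)=\{y: y_j=x_j,\ -n\le j\le n\}$ and $B_n(x)=\{y: F_e^i(y)_j=F_e^i(x)_j \text{ for all } i\in\mathbb{N},\ -n\le j\le n\}$. **The automaton $F_e$.** Let $\hat E=\{E_0,E_1,E_2,E_3\}$, $\overline E=\{0,L,R\}$, $X^1=(\hat E\cup\overline E)^{\mathbb{Z}}$, $X^2=\{0,1\}^{\mathbb{Z}}$, $X=X^1\times X^2$, and write $x=(x^1,x^2)$. Then $F_e=F_3\circ F_2\circ F_1$, where: $F_1$: $F_1(x)^1=x^1$, and $F_1(x)^2_i=1$ if $x^2_{i-3}=x^2_{i-2}=x^2_{i-1}=1$,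 otherwise $F_1(x)^2_i=0$. $F_2$: $F_2(x)^1=x^1$, and $F_2(x)^2_i=1$ if $x^2_i=1$ or at least one of $x^1_i,x^1_{i-1},x^1_{i-2}$ equals $E_0$; otherwise $F_2(x)^2_i=0$. $F_3$: $F_3(x)^2=x^2$, and $F_3(x)^1_i$ depends on $x^1$ only, as follows (superscripts $1$ dropped, and $x_{[a,b]}=x_a\cdots x_b$). If $x_i\in\overline E$: (a) $F_3(x)_i=R$ if $x_{[i-10,i+m]}=R\,0^{10+m}$, where $m=\min\{10,\min\{k-1: k\ge1,\ x_{i+k}\in\hat E\}\}$ (with $\min\emptyset=\infty$). (b) $F_3(x)_i=L$ if $x_{[i-m,i+10]}=0^{10+m}L$, where $m=\min\{10,\min\{k-1: k\ge1,\ x_{i-k}\in\hat E\}\}$. (c) $F_3(x)_i=R$ if for some $0\le k\le 9$, with $j=9-2k$, one has $x_{[i-j-k-1,\,i+10]}=E^*0^kL0^{j+10}$ for some $E^*\in\hat E$. (d) $F_3(x)_i=L$ if for some $0\le k\le 9$, with $j=9-2k$, one has $x_{[i-10,\,i+j+k+1]}=0^{10+j}R0^kE^*$ for some $E^*\in\hat E$. (e) $F_3(x)_i=0$ in all other cases with $x_i\in\overline E$. If $x_i=E_s\in\hat E$: $F_3(x)_i=E_{s+1 \bmod 4}$ if $x_{[i-k,i]}=R0^{k-1}E_s$ for some $1\le k\le 10$; otherwise $F_3(x)_i=E_s$. **The measure $\mu_c$.** Let $S^1\subset X^1$ be the (mixing) subshift of finite type of all sequences over $\{E_0,E_1,E_2,E_3,0,L\}$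 such that: every letter of $\hat E$ is immediately followed by $170$ letters $0$; every $L$ is immediately followed by a letter of $\hat E$; every $E_0$ is immediately preceded by $L$; every $E_1,E_2,E_3$ is immediately preceded by $L$ or by $0$. (Equivalently, letters of $\hat E$ occur only in words $LE_s0^{170}$, $0\le s\le3$, or $0E_s0^{170}$, $1\le s\le 3$.) Let $\mu_1$ be the Parry measure (measure of maximal entropy) of $S^1$, let $\delta$ be the Dirac measure at the point $\ldots000\ldots\in X^2$, and put $\mu_I=\mu_1\times\delta$, which is shift-ergodic on $X$. Then $\mu_c$ is the Cesàro weak-$*$ limit $\mu_c=\lim_{n\to\infty}\frac1n\sum_{i=0}^{n-1}\mu_I\circ F_e^{-i}$, which exists and is invariant under $F_e$ and the shift. *)

(* Defs.v *)
(* MathComp-Analysis *)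
From HB Require Import structures.
From mathcomp Require Import all_boot all_order all_algebra.
From mathcomp Require Import all_classical all_reals all_analysis.

Set Implicit Arguments.
Unset Strict Implicit.
Unset Printing Implicit Defensive.

Import Order.TTheory GRing.Theory Num.Theory.
Import numFieldNormedType.Exports.

Local Open Scope classical_set_scope.
Local Open Scope ring_scope.

(* [config A] is A^Z with the product of the discrete topologies and its Borel
   sigma-algebra; [A] is pointed only because measurable types must be. *)
Definition config (A : Type) := int -> A.

HB.instance Definition _ (A : pointedType) :=
  Topological.copy (config A) (prod_topology (fun _ : int => discrete_topology A)).
HB.instance Definition _ (A : pointedType) :=
  isPointed.Build (config A) (fun=> point).
HB.instance Definition _ (A : pointedType) :=
  Measurable.copy (config A) (g_sigma_algebraType (@open (config A))).

Definition shift_map (A : Type) (x : config A) : config A := fun i => x (i + 1).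

Inductive letter := lE of 'I_4 | l0 | lL | lR.

Definition letter_code (a : letter) : 'I_4 + 'I_3 :=
  match a with
  | lE s => inl s | l0 => inr (inord 0) | lL => inr (inord 1) | lR => inr (inord 2)
  end.
Definition letter_decode (c : 'I_4 + 'I_3) : letter :=
  match c with
  | inl s => lE s
  | inr u => if val u is k.+1 then (if k is 0%N then lL else lR) else l0
  end.
Lemma letter_codeK : cancel letter_code letter_decode.
Proof. by case=> [s|||] //=; rewrite inordK. Qed.

HB.instance Definition _ := Finite.copy letter (can_type letter_codeK).
HB.instance Definition _ := isPointed.Build letter l0.

Definition is_hat (a : letter) : bool := if a is lE _ then true else false.

(* The word [w] is read in [x] from position [a] on, i.e.
   x_[a, a + size w - 1] = w. *)
Definition occurs (x : config letter) (a : int) (w : seq letter) : bool :=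
  [seq x (a + l%:Z) | l <- iota 0 (size w)] == w.

Definition zeros (k : nat) : seq letter := nseq k l0.

Notation phase := (config letter * config bool)%type.

Definition F1 (x : phase) : phase :=
  (x.1, fun i => [&& x.2 (i - 3), x.2 (i - 2) & x.2 (i - 1)]).

Definition F2 (x : phase) : phase :=
  (x.1, fun i => x.2 i ||
    [|| x.1 i == lE ord0, x.1 (i - 1) == lE ord0 | x.1 (i - 2) == lE ord0]).

(* min {10, min {k - 1 : k >= 1, x_(i+k) is some E_s}}; [find] searches
   k - 1 = 0, ..., 9 and returns 10 when it finds nothing. *)
Definition free_right (x : config letter) (i : int) : nat :=
  find (fun k => is_hat (x (i + k.+1%:Z))) (iota 0 10).
Definition free_left (x : config letter) (i : int) : nat :=
  find (fun k => is_hat (x (i - k.+1%:Z))) (iota 0 10).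

Definition move_right (x : config letter) (i : int) : bool :=
  occurs x (i - 10) (lR :: zeros (10 + free_right x i)).

Definition move_left (x : config letter) (i : int) : bool :=
  let m := free_left x i in
  occurs x (i - m%:Z) (zeros (10 + m) ++ [:: lL]).

(* In the next two definitions j = 9 - 2k may be negative, but j + 10 > 0. *)
Definition bounce_right (x : config letter) (i : int) : bool :=
  [exists k : 'I_10, [exists s : 'I_4,
    let j : int := 9 - 2 * k%:Z in
    occurs x (i - j - k%:Z - 1)
      (lE s :: zeros k ++ lL :: zeros (absz (j + 10)))]].

Definition bounce_left (x : config letter) (i : int) : bool :=
  [exists k : 'I_10, [exists s : 'I_4,
    let j : int := 9 - 2 * k%:Z in
    occurs x (i - 10) (zeros (absz (10 + j)) ++ lR :: zeros k ++ [:: lE s])]].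

(* The signal lR reaches [i] from distance k.+1, 1 <= k.+1 <= 10. *)
Definition hit (x : config letter) (i : int) : bool :=
  [exists k : 'I_10, occurs x (i - k.+1%:Z) (lR :: zeros k ++ [:: x i])].

(* The four moving rules are mutually exclusive, so the order in which they are
   tested is immaterial; [ordS] is the successor modulo 4. *)
Definition F3_fst (x : config letter) : config letter := fun i =>
  if x i is lE s then (if hit x i then lE (ordS s) else lE s)
  else if move_right x i || bounce_right x i then lR
  else if move_left x i || bounce_left x i then lL
  else l0.

Definition F3 (x : phase) : phase := (F3_fst x.1, x.2).

Definition F_e (x : phase) : phase := F3 (F2 (F1 x)).

Definition S1 : set (config letter) := [set x | forall i : int,
  [/\ x i != lR,
      is_hat (x i) -> occurs x (i + 1) (zeros 170),
      x i = lL -> is_hat (x (i + 1)),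
      x i = lE ord0 -> x (i - 1) = lL &
      is_hat (x i) -> x i != lE ord0 -> x (i - 1) = lL \/ x (i - 1) = l0]].

Section measures.
Variable R : realType.

Definition shift_invariant (A : pointedType) (mu : probability (config A) R) :=
  forall B : set (config A), measurable B -> mu (@shift_map A @^-1` B) = mu B.

Definition cylinder (A : Type) (n : nat) (w : n.-tuple A) : set (config A) :=
  [set x | forall i : 'I_n, x i%:Z = tnth w i].

Definition block_entropy (mu : probability (config letter) R) (n : nat) : R :=
  - \sum_(w : n.-tuple letter)
      fine (mu (cylinder w)) * ln (fine (mu (cylinder w))).

Definition entropy (mu : probability (config letter) R) : R :=
  limn (fun n => block_entropy mu n / n%:R).

(* The Parry measure of the subshift [S], as its measure of maximal entropy. *)
Definition parry_measure (S : set (config letter))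
    (mu : probability (config letter) R) : Prop :=
  [/\ shift_invariant mu, mu S = 1%E &
      forall nu : probability (config letter) R,
        shift_invariant nu -> nu S = 1%E -> entropy nu <= entropy mu].

Definition mu_I (mu1 : probability (config letter) R) : set phase -> \bar R :=
  (mu1 \x dirac ((fun=> false) : config bool))%E.

Definition cesaro_mean (mu : set phase -> \bar R) (F : phase -> phase) (n : nat) :
    set phase -> \bar R :=
  fun B => ((n%:R^-1)%:E * \sum_(i < n) mu (iter i F @^-1` B))%E.

Definition weak_star_limit (nu : nat -> set phase -> \bar R) (mu : set phase -> \bar R) :=
  forall f : phase -> R, continuous f ->
    (\int[nu n]_x (f x)%:E)%E @[n --> \oo] --> (\int[mu]_x (f x)%:E)%E.

(* The smallest closed set of full measure. *)
Definition topological_support (mu : probability phase R) : set phase :=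
  \bigcap_(C in [set C : set phase | closed C /\ mu C = 1%E]) C.

End measures.

Definition agree (n : nat) (x y : phase) : Prop :=
  forall j : int, - n%:Z <= j <= n%:Z -> y.1 j = x.1 j /\ y.2 j = x.2 j.

Definition C_ (n : nat) (x : phase) : set phase := [set y | agree n x y].

Definition B_ (F : phase -> phase) (n : nat) (x : phase) : set phase :=
  [set y | forall i : nat, agree n (iter i F x) (iter i F y)].

Definition equicontinuous_point (F : phase -> phase) (S : set phase) (x : phase) : Prop :=
  S x /\ forall n : nat, (0 < n)%N ->
    exists m : nat, (0 < m)%N /\ C_ m x `&` S `<=` B_ F n x.

Definition sensitive (F : phase -> phase) (S : set phase) : Prop :=
  ~ exists x : phase, equicontinuous_point F S x.

(* Main.v *)
Require Import Defs.
From HB Require Import structures.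
From mathcomp Require Import all_boot all_order all_algebra.
From mathcomp Require Import all_classical all_reals all_analysis.
From mathcomp Require Import zify ring lra.

(* In x^1, the gap of length g to the left of a letter E carries one signal,
   which bounces at speed 10; so an E that ever becomes E_0 is E_0, or hot, for
   about g/5 steps, then not for about 3g/5 steps, periodically. In x^2 a hot E
   emits ones, which travel right at speeds 1 to 3, and a one at a column with no
   hot letter nearby needs ones at the three columns to its left. Tracing ones
   backwards, a run of ones in time that is longer than g/5 can be continued
   across the E at the right end of a gap g. Almost surely every gap far away is
   much shorter than its distance, and then there is an E whose left neighbour
   column is 0 forever: ones there would go back to negative times. Hence long
   runs do not occur near 0, and x^2 near 0 is as periodic in time as x^1.
   On the other hand mu_1 has an explicit Markov form, obtained from the equality
   case of Gibbs' inequality, so it gives the same mass to two words of equal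
   length with the same long margins. Thus a far gap can be replaced by a giant
   one on a set of positive measure; this changes nothing near 0 while its E is
   not hot, but later lights all columns near 0 for a very long time. Both kinds
   of points are visited with positive frequency within any cylinder of positive
   mu_c-measure. *)

Set Implicit Arguments.
Unset Strict Implicit.
Unset Printing Implicit Defensive.

Import Order.TTheory GRing.Theory Num.Theory.
Import numFieldNormedType.Exports.

Local Open Scope classical_set_scope.
Local Open Scope ring_scope.

(** * Cylinders and local sets *)

(** Equicontinuity is refuted at scale 3: in any cylinder [C_ m x] of positive mass the support
    contains two points, one alight on all columns from -3 to 3 throughout a certain time window,
    the other dark at one of these places. Both properties depend on finitely many columns, so
    weak-* convergence turns their mass into a limit of visit frequencies. The Parry measure is
    given only as a maximiser of entropy. To exploit this, a competitor of entropy at least -ln t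
    must exist; its word masses come from Perron eigenvectors, and Lebesgue measure is transported
    to a measure with these masses. Maximality then leaves no slack in Gibbs' inequality. The main
    obstacle is that ones may a priori arrive from arbitrarily far left. A barrier column that is
    never alight removes it: between the barrier and 0 only finitely many gaps matter, and they have
    a common period; a giant gap planted further left is felt only while its hat is hot and for a
    bounded time afterwards. *)

Section config_topology.
Variable A : pointedType.

Definition window (n : nat) (x : config A) : set (config A) :=
  [set y | forall j : int, - n%:Z <= j <= n%:Z -> y j = x j].

Lemma coordinate_nbhs (x : config A) (i : int) :
  nbhs x [set y : config A | y i = x i].
Proof.
have := @proj_continuous int (fun _ => discrete_topology A) i x.
move=> /(_ [set x i]); apply.
by rewrite /nbhs /=.
Qed.

Lemma window_nbhs (x : config A) (n : nat) : nbhs x (window n x).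
Proof.
elim: n => [|n IHn].
  apply: filterS (coordinate_nbhs x 0) => y /= yx j jn.
  by have -> : j = 0 by lia.
have H1 := coordinate_nbhs x n.+1%:Z.
have H2 := coordinate_nbhs x (- n.+1%:Z).
apply: filterS (filterI IHn (filterI H1 H2)) => y /= [yn [yp ym]] j jn.
have [->//|jp] := eqVneq j n.+1%:Z.
have [->//|jm] := eqVneq j (- n.+1%:Z).
by apply: yn; lia.
Qed.

(** The filter generated by the windows around [x] converges to [x] in every coordinate, hence in
    the product topology. *)
Lemma nbhs_window (x : config A) (U : set (config A)) :
  nbhs x U -> exists n, window n x `<=` U.
Proof.
pose F := filter_from [set: nat] (fun n => window n x).
have FF : Filter F.
  apply: filter_from_filter; first by exists 0%N.
  move=> i j _ _; exists (maxn i j) => // y yx; split => k kij; apply: yx; lia.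
have : F --> (x : prod_topology (fun _ : int => discrete_topology A)).
  apply/cvg_sup => i; apply/cvg_image.
    by rewrite eqEsubset; split => // a _; exists (fun=> a).
  move=> V /= V_xi; exists [set y : config A | V (y i)].
    exists `|i|%N => //= y yx; have yxi : y i = x i by apply: yx; lia.
    rewrite /mkset yxi.
    by have := @nbhs_singleton (discrete_topology A) (x i) V V_xi.
  by rewrite eqEsubset; split => [_ [y Vy <-] //|a Va]; exists (fun=> a).
by move=> FU /FU [n _ nU]; exists n.
Qed.
End config_topology.

Section finite_code.
Context d (T : measurableType d) (K : finType) (code : T -> K).
Hypothesis mcode : forall k, measurable (code @^-1` [set k]).

Lemma measurable_code (S : set K) : measurable (code @^-1` S).
Proof.
have -> : code @^-1` S = \bigcup_(k in S) code @^-1` [set k].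
  by rewrite eqEsubset; split => [x Sx|x [k Sk /= ->]//]; exists (code x).
by apply: fin_bigcup_measurable => //; exact: finite_finset.
Qed.

Lemma measure_code (R : realType) (mu : {measure set T -> \bar R}) (B : set T) :
  measurable B -> mu B = (\sum_(k : K) mu (B `&` code @^-1` [set k]))%E.
Proof.
move=> mB.
have {1}-> : B = \bigcup_(k in [set` index_enum K]) (B `&` code @^-1` [set k]).
  rewrite eqEsubset; split => [x Bx|x [k _ []]//].
  by exists (code x) => //=; rewrite mem_index_enum.
rewrite measure_fin_bigcup//; last by move=> *; exact: measurableI.
  by rewrite -fsbig_seq// index_enum_uniq.
by move=> i j _ _ [x [[_ /= ->] [_ ->]]].
Qed.

Lemma measure_code0 (R : realType) (mu : {measure set T -> \bar R}) (B : set T) :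
  measurable B -> (forall x, B x -> mu (code @^-1` [set code x]) = 0%E) ->
  mu B = 0%E.
Proof.
move=> mB B0; rewrite measure_code// big1// => k _.
have [->|/set0P[x [Bx /= <-]]] := eqVneq (B `&` code @^-1` [set k]) set0.
  by rewrite measure0.
by apply: (subset_measure0 _ _ _ (B0 x Bx)) => //; exact: measurableI.
Qed.
End finite_code.

Definition wcode (A : finType) (n : nat) (x : int -> A) : {ffun 'I_(n.*2.+1) -> A} :=
  [ffun i : 'I_(n.*2.+1) => x (i%:Z - n%:Z)].

Lemma wcodeP (A : finType) n (x y : int -> A) :
  wcode n x = wcode n y <-> forall j : int, - n%:Z <= j <= n%:Z -> y j = x j.
Proof.
split=> [/ffunP xy j jn|xy]; last by apply/ffunP => i; rewrite !ffunE xy//; have := ltn_ord i; lia.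
have jlt : (absz (j + n%:Z)%R < n.*2.+1)%N by lia.
have := xy (Ordinal jlt); rewrite !ffunE /=.
by rewrite gez0_abs ?addrK//; lia.
Qed.

Lemma open_config_measurable (A : pointedType) (O : set (config A)) :
  open O -> measurable O.
Proof. by move=> oO; exact: sub_sigma_algebra. Qed.

Lemma window_open (A : pointedType) n (x : config A) : open (window n x).
Proof.
rewrite openE => y yx; apply: filterS (window_nbhs y n) => z zy j jn.
by rewrite zy// yx.
Qed.

Definition lcode n (x : config letter) := wcode n x.
Definition pcode n (x : phase) := (wcode n x.1, wcode n x.2).

Lemma pcodeP n (x y : phase) : pcode n x = pcode n y <-> agree n x y.
Proof.
split=> [[/wcodeP x1 /wcodeP x2] j jn|xy]; first by rewrite x1// x2.
by congr pair; apply/wcodeP => j jn; have [] := xy j jn.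
Qed.

Lemma measurable_lcode n k : measurable (@lcode n @^-1` [set k]).
Proof.
have [->//|/set0P[x /= xk]] := eqVneq (@lcode n @^-1` [set k]) set0.
have -> : @lcode n @^-1` [set k] = window n x.
  rewrite -xk eqEsubset; split => y /= xy; first exact/wcodeP/esym.
  exact/esym/wcodeP.
by apply: open_config_measurable; exact: window_open.
Qed.

Lemma C_E n (x : phase) : C_ n x = window n x.1 `*` window n x.2.
Proof.
rewrite eqEsubset; split => y; first by move=> xy; split=> j /xy[].
by move=> [y1 y2] j jn; rewrite y1// y2.
Qed.

Lemma pcode_C n (x : phase) : @pcode n @^-1` [set pcode n x] = C_ n x.
Proof.
rewrite eqEsubset; split => y /= xy; first exact/pcodeP/esym.
exact/esym/pcodeP.
Qed.

Lemma C_measurable n x : measurable (C_ n x).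
Proof.
rewrite C_E; apply: measurableX; apply: open_config_measurable;
exact: window_open.
Qed.

Lemma measurable_pcode n k : measurable (@pcode n @^-1` [set k]).
Proof.
have [->//|/set0P[x /= <-]] := eqVneq (@pcode n @^-1` [set k]) set0.
by rewrite pcode_C; exact: C_measurable.
Qed.

Lemma C_nbhs n (x : phase) : nbhs x (C_ n x).
Proof.
rewrite C_E; exists (window n x.1, window n x.2) => //.
by split; exact: window_nbhs.
Qed.

Lemma nbhs_C (x : phase) U : nbhs x U -> exists n, C_ n x `<=` U.
Proof.
move=> [[V W] /= [/nbhs_window[n nV] /nbhs_window[m mW]] VWU].
exists (maxn n m) => y xy; apply: VWU; split => /=.
  by apply: nV => j jn; have [|] := xy j => //; lia.
by apply: mW => j jn; have [|] := xy j => //; lia.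
Qed.

Definition local_set (n : nat) (V : set phase) :=
  forall x y, agree n x y -> V x -> V y.

Lemma agree_sym n x y : agree n x y -> agree n y x.
Proof. by move=> xy j /xy[-> ->]. Qed.

Lemma agree_le n m x y : (n <= m)%N -> agree m x y -> agree n x y.
Proof. by move=> nm xy j jn; apply: xy; lia. Qed.

Lemma local_setE n V : local_set n V -> V = @pcode n @^-1` (@pcode n @` V).
Proof.
move=> lV; rewrite eqEsubset; split=> [x Vx|y [x Vx /pcodeP xy]]; first by exists x.
exact: lV Vx.
Qed.

Lemma local_measurable n V : local_set n V -> measurable V.
Proof.
by move=> /local_setE ->; apply: measurable_code; exact: measurable_pcode.
Qed.

Lemma local_setC n V : local_set n V -> local_set n (~` V).
Proof. by move=> lV x y /agree_sym xy + /(lV _ _ xy). Qed.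

Lemma local_setI n m V W :
  local_set n V -> local_set m W -> local_set (maxn n m) (V `&` W).
Proof.
move=> lV lW x y xy [Vx Wx]; split.
  by apply: lV Vx; apply: agree_le xy; rewrite leq_maxl.
by apply: lW Wx; apply: agree_le xy; rewrite leq_maxr.
Qed.

Lemma local_open n V : local_set n V -> open V.
Proof.
rewrite openE => lV x Vx; apply: filterS (C_nbhs n x) => y xy.
exact: lV Vx.
Qed.

Lemma open_phase_measurable (O : set phase) : open O -> measurable O.
Proof.
move=> oO; have -> : O = \bigcup_n [set x | C_ n x `<=` O].
  rewrite eqEsubset; split => [x Ox|x [n _]]; last exact.
  by have [n nO] := nbhs_C (open_nbhs_nbhs (conj oO Ox)); exists n.
apply: bigcupT_measurable => n; apply: (@local_measurable n) => x y xy xO z yz.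
by apply: xO => j jn; have [-> ->] := yz j jn; have [-> ->] := xy j jn.
Qed.

Section support.
Variables (R : realType) (mu : probability phase R).

Lemma support_C n x : topological_support mu x -> (0 < mu (C_ n x))%E.
Proof.
move=> sx; rewrite lt0e measure_ge0 andbT; apply/negP => /eqP m0.
have lC : local_set n (C_ n x).
  by move=> y z yz xy j jn; have [-> ->] := yz j jn; exact: xy.
have : (~` C_ n x) x; last by apply.
apply: sx; split; first by apply: open_closedC; exact: local_open lC.
by rewrite probability_setC ?m0 ?sube0//; exact: C_measurable.
Qed.

(** The support is an intersection of possibly uncountably many closed sets, so its full mass is not
    immediate. A point outside it lies in a null cylinder; for each size [k] there are finitely many
    cylinders, so all such points form a null set. *)
Lemma local_support n V : local_set n V -> (0 < mu V)%E ->
  exists2 x, V x & topological_support mu x.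
Proof.
move=> lV mV; apply: contrapT => noV.
suff m0 : mu V = 0%E by rewrite m0 ltxx in mV.
pose N k := V `&` [set x | mu (C_ k x) = 0%E].
have VN : V `<=` \bigcup_k N k.
  move=> x Vx; have : ~ topological_support mu x by move=> sx; apply: noV; exists x.
  move=> /existsNP[C /not_implyP[[cC C1] nCx]].
  have oC : open (~` C) by exact: closed_openC.
  have [k kC] := nbhs_C (open_nbhs_nbhs (conj oC nCx)).
  exists k => //; split => //=; apply: (subset_measure0 _ _ kC).
  - exact: C_measurable.
  - exact: open_phase_measurable.
  - have mC : measurable C.
      by rewrite -(setCK C); apply: measurableC; exact: open_phase_measurable.
    by apply: (etrans (probability_setC mu mC)); rewrite C1 subee.
have lN k : local_set (maxn n k) (N k).
  apply: local_setI => // x y xy /=; congr (mu _ = _).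
  by rewrite -!pcode_C; move/pcodeP : xy => ->.
have mN k : measurable (N k) by exact: local_measurable (lN k).
apply: (subset_measure0 _ _ VN); first exact: local_measurable lV.
  exact: bigcupT_measurable.
apply/negligibleP; first exact: bigcupT_measurable.
apply: negligible_bigcup => k; apply/negligibleP => //.
apply: (measure_code0 (code := @pcode k)) => //; first exact: measurable_pcode.
by move=> x [_ /= ]; rewrite pcode_C.
Qed.

End support.

(** * The automaton and the orbit of mu_I *)

Lemma eq_occurs (x y : config letter) (a : int) (w : seq letter) :
  (forall k : nat, (k < size w)%N -> x (a + k%:Z) = y (a + k%:Z)) ->
  occurs x a w = occurs y a w.
Proof.
move=> xy; congr (_ == w); apply/eq_in_map => k.
by rewrite mem_iota add0n => /andP[_ /xy].
Qed.

Lemma F3_fst_local (x y : config letter) (i : int) :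
  (forall j, i - 10 <= j <= i + 10 -> x j = y j) -> F3_fst x i = F3_fst y i.
Proof.
move=> xy; have xyi : x i = y i by apply: xy; lia.
have fr : free_right x i = free_right y i.
  by apply: eq_in_find => k; rewrite mem_iota => klt; rewrite xy//; lia.
have fl : free_left x i = free_left y i.
  by apply: eq_in_find => k; rewrite mem_iota => klt; rewrite xy//; lia.
have fr10 : (free_right y i <= 10)%N by rewrite -[10%N](size_iota 0); exact: find_size.
have fl10 : (free_left y i <= 10)%N by rewrite -[10%N](size_iota 0); exact: find_size.
have hits : hit x i = hit y i.
  apply: eq_existsb => k; rewrite xyi; apply: eq_occurs => l.
  have := ltn_ord k; rewrite /= size_cat size_nseq /= => kl ll; apply: xy; lia.
have mr : move_right x i = move_right y i.
  rewrite /move_right fr; apply: eq_occurs => l.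
  by rewrite /= size_nseq => ll; apply: xy; lia.
have ml : move_left x i = move_left y i.
  rewrite /move_left fl; apply: eq_occurs => l.
  by rewrite /= size_cat size_nseq /= => ll; apply: xy; lia.
have br : bounce_right x i = bounce_right y i.
  apply: eq_existsb => k; apply: eq_existsb => s; apply: eq_occurs => l.
  have := ltn_ord k; rewrite /= size_cat /= !size_nseq /= => kl ll; apply: xy; lia.
have bl : bounce_left x i = bounce_left y i.
  apply: eq_existsb => k; apply: eq_existsb => s; apply: eq_occurs => l.
  have := ltn_ord k; rewrite /= !size_cat /= !size_cat /= !size_nseq /= => kl ll; apply: xy; lia.
by rewrite /F3_fst xyi hits mr ml br bl.
Qed.

Lemma F_e_fst x : (F_e x).1 = F3_fst x.1.
Proof. by []. Qed.

Lemma F_e_snd x j : (F_e x).2 j =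
  [&& x.2 (j - 3), x.2 (j - 2) & x.2 (j - 1)] ||
  [|| x.1 j == lE ord0, x.1 (j - 1) == lE ord0 | x.1 (j - 2) == lE ord0].
Proof. by []. Qed.

Lemma F_e_agree n x y : agree (n + 10) x y -> agree n (F_e x) (F_e y).
Proof.
move=> xy j jn; split.
  by rewrite !F_e_fst; apply: F3_fst_local => k kj; have [|] := xy k => //; lia.
rewrite !F_e_snd.
have [|-> _] := xy j; first lia.
have [|-> ->] := xy (j - 1); first lia.
have [|-> ->] := xy (j - 2); first lia.
by have [|_ ->] := xy (j - 3); first lia.
Qed.

Lemma iter_F_e_agree i n x y :
  agree (n + 10 * i) x y -> agree n (iter i F_e x) (iter i F_e y).
Proof.
elim: i n x y => [|i IHi] n x y; first by rewrite muln0 addn0.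
rewrite !iterSr => xy; apply: IHi; apply: F_e_agree; apply: agree_le xy.
by rewrite mulnS; lia.
Qed.

Lemma measurable_iter_F_e i : measurable_fun setT (iter i F_e).
Proof.
have oF O : open O -> measurable (iter i F_e @^-1` O).
  move=> oO; apply: open_phase_measurable; rewrite openE => x Ox.
  have [n nO] := nbhs_C (open_nbhs_nbhs (conj oO Ox)).
  apply: filterS (C_nbhs (n + 10 * i) x) => y xy; apply: nO.
  exact: iter_F_e_agree.
apply/measurable_fun_pairP; split.
  apply: (@measurability _ _ _ _ _ _ (@open (config letter)) erefl) => _ -[W oW <-]; rewrite setTI.
  apply: (oF (fst @^-1` W)); apply: open_comp => // x _; exact: cvg_fst.
apply: (@measurability _ _ _ _ _ _ (@open (config bool)) erefl) => _ -[W oW <-]; rewrite setTI.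
apply: (oF (snd @^-1` W)); apply: open_comp => // x _; exact: cvg_snd.
Qed.

(** The second factor of mu_I is a Dirac mass, so mu_I-typical orbits are parametrised by [z] alone
    and events along them are measured by [mu1]. *)
Definition orbit_phase (t : nat) (z : config letter) : phase :=
  iter t F_e (z, fun=> false).

Lemma orbit_phaseD s t z : orbit_phase (s + t) z = iter s F_e (orbit_phase t z).
Proof. by rewrite /orbit_phase iterD. Qed.

Lemma measurable_orbit_phase t V :
  measurable V -> measurable (orbit_phase t @^-1` V).
Proof.
move=> mV; rewrite -[X in measurable X]setTI.
suff mt : measurable_fun setT (orbit_phase t) by exact: mt.
apply: (measurableT_comp (measurable_iter_F_e t)).
by apply/measurable_fun_pairP; split; [exact: measurable_id|exact: measurable_cst].
Qed.

Section cesaro.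
Variables (R : realType) (mu1 : probability (config letter) R).
Variable mu_c : probability phase R.

Lemma mu_IE V : measurable V ->
  mu_I mu1 V = mu1 [set z | V (z, (fun=> false) : config bool)].
Proof.
move=> mV; rewrite /mu_I /product_measure1.
have mz : measurable [set z | V (z, (fun=> false) : config bool)].
  exact: (@measurable_orbit_phase 0).
transitivity (\int[mu1]_z (\1_[set z | V (z, (fun=> false) : config bool)] z)%:E)%E;
  last by rewrite integral_indic// setIT.
apply: eq_integral => z _ /=.
rewrite diracE indicE; congr ((nat_of_bool _)%:R%:E).
by rewrite mem_xsection; apply/idP/idP; rewrite !inE.
Qed.

Definition cesaro_freq V (N : nat) : R :=
  N%:R^-1 * \sum_(i < N) fine (mu1 (orbit_phase i @^-1` V)).

Lemma integral_cesaro V N : measurable V ->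
  (\int[cesaro_mean (mu_I mu1) F_e N]_x (\1_V x)%:E)%E = (cesaro_freq V N)%:E.
Proof.
move=> mV.
have Nge0 : 0 <= (N%:R^-1 : R) by rewrite invr_ge0.
pose push i : {measure set phase -> \bar R} :=
  pushforward (mu1 \x dirac ((fun=> false) : config bool))%E (iter i F_e).
pose m : {measure set phase -> \bar R} :=
  mscale (NngNum Nge0) (msum (push measurable_iter_F_e) N).
(* By conversion the Cesàro mean is a scaled finite sum of push-forwards, hence a measure. *)
have -> : cesaro_mean (mu_I mu1) F_e N = m by [].
rewrite integral_indic// setIT /m /= /mscale /= /msum /cesaro_freq EFinM.
congr (_ * _)%E; rewrite -sumEFin; apply: eq_bigr => i _.
rewrite /push /= /pushforward [LHS]mu_IE; last first.
  by rewrite -[X in measurable X]setTI; exact: measurable_iter_F_e.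
by rewrite fineK// fin_num_measure//; exact: measurable_orbit_phase.
Qed.

Hypothesis mu_lim : weak_star_limit (cesaro_mean (mu_I mu1) F_e) mu_c.

Lemma local_indic_continuous n V : local_set n V -> continuous (\1_V : phase -> R).
Proof.
move=> lV x; apply: (@cvg_trans _ ((cst (\1_V x : R)) @ nbhs x)); last exact: cvg_cst.
apply: near_eq_cvg; apply: filterS (C_nbhs n x) => y xy /=.
rewrite !indicE; congr ((nat_of_bool _)%:R).
apply/idP/idP; rewrite !inE => Vx; first exact: lV Vx.
by apply: lV Vx; exact: agree_sym.
Qed.

Lemma cesaro_freq_cvg n V : local_set n V ->
  cesaro_freq V N @[N --> \oo] --> fine (mu_c V).
Proof.
move=> lV; have mV := local_measurable lV.
have := mu_lim (local_indic_continuous lV).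
have -> : (\int[mu_c]_x (\1_V x)%:E = mu_c V)%E by rewrite integral_indic// setIT.
have -> : (fun N => \int[cesaro_mean (mu_I mu1) F_e N]_x (\1_V x)%:E)%E =
    EFin \o cesaro_freq V by apply/funext => N; rewrite integral_cesaro.
have : mu_c V \is a fin_num by exact: fin_num_measure.
by move=> /fineK <- /fine_cvgP[].
Qed.

(** Visits from all of [W] along an arithmetic progression keep the frequencies of [V] above mu1(W)
    / (tau + p) for infinitely many horizons, so their limit is not 0. *)
Lemma positive_frequency n V W tau p : local_set n V -> measurable W ->
  (0 < mu1 W)%E -> (0 < p)%N ->
  (forall k z, W z -> V (orbit_phase (tau + p * k) z)) -> (0 < mu_c V)%E.
Proof.
move=> lV mW W0 p0 WV; have mV := local_measurable lV.
rewrite lt0e measure_ge0 andbT; apply/negP => /eqP V0.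
have := cesaro_freq_cvg lV; rewrite V0 /= => /cvgrPdist_lt.
have w0 : 0 < fine (mu1 W) by rewrite fine_gt0// W0 ltey_eq fin_num_measure.
have q0 : 0 < (tau + p)%:R :> R by rewrite ltr0n; lia.
move=> /(_ (fine (mu1 W) / (tau + p)%:R)); rewrite divr_gt0// => /(_ isT)[M _].
set q := (tau + p)%N in q0 *.
(* The first [q * M.+1] times contain [tau + p * k] for all [k <= M], because [q = tau + p]. *)
move=> /(_ (q * M.+1)%N) /=; have -> : (M <= q * M.+1)%N by rewrite /q; nia.
move=> /(_ isT); rewrite sub0r normrN ger0_norm; last first.
  rewrite mulr_ge0 ?invr_ge0//; apply: sumr_ge0 => i _; exact: fine_ge0.
apply/negP; rewrite -leNgt /cesaro_freq.
have -> : fine (mu1 W) / q%:R = (q * M.+1)%:R^-1 * (M.+1%:R * fine (mu1 W)).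
  rewrite natrM; field; rewrite ?(gt_eqF q0) ?nat1r ?pnatr_eq0//.
apply: ler_wpM2l; first by rewrite invr_ge0.
pose f i := fine (mu1 (orbit_phase i @^-1` V)).
have f0 i : 0 <= f i by exact: fine_ge0.
rewrite -(big_mkord xpredT f).
have -> : M.+1%:R * fine (mu1 W) = \sum_(k < M.+1) fine (mu1 W).
  by rewrite sumr_const card_ord mulr_natl.
apply: (@le_trans _ _ (\sum_(k < M.+1) f (tau + p * k)%N)).
  apply: ler_sum => k _; apply: fine_le.
  - exact: fin_num_measure.
  - by apply: fin_num_measure => //; exact: measurable_orbit_phase.
  - apply: le_measure; rewrite ?inE//; first exact: measurable_orbit_phase.
    by move=> z Wz; exact: WV.
rewrite -(big_mkord xpredT (fun k => f (tau + p * k)%N)).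
have le_m m : \sum_(0 <= k < m) f (tau + p * k)%N <= \sum_(0 <= i < tau + p * m) f i.
  elim: m => [|m IHm]; first by rewrite big_geq// sumr_ge0.
  rewrite big_nat_recr//= [leRHS](@big_cat_nat _ _ _ (tau + p * m)%N)//=; last by nia.
  apply: lerD => //; rewrite (bigD1_seq (tau + p * m)%N) ?iota_uniq//=.
    by rewrite lerDl sumr_ge0.
  by rewrite mem_index_iota /q; apply/andP; split; nia.
apply: (le_trans (le_m _)).
rewrite [leRHS](@big_cat_nat _ _ _ (tau + p * M.+1)%N)//=; last by rewrite /q; nia.
by rewrite lerDl sumr_ge0.
Qed.

(** If all late visits to [V] came from outside [G], up to null sets, the limiting frequency of [V]
    would be at most the mass of the complement of [G]. *)
Lemma late_visit n V G T0 : local_set n V -> measurable G ->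
  (mu1 (~` G) < mu_c V)%E ->
  exists2 t, (T0 <= t)%N & (0 < mu1 (G `&` orbit_phase t @^-1` V))%E.
Proof.
move=> lV mG GV; have mV := local_measurable lV.
have mt t := measurable_orbit_phase t mV.
apply: contrapT => none; move: GV; apply/negP; rewrite -leNgt.
pose d := fine (mu1 (~` G)).
have mGC : measurable (~` G) by exact: measurableC.
have f_le t : (T0 <= t)%N -> fine (mu1 (orbit_phase t @^-1` V)) <= d.
  move=> Tt; apply: fine_le; [exact: fin_num_measure|exact: fin_num_measure|].
  have GV0 : mu1 (G `&` orbit_phase t @^-1` V) = 0%E.
    apply: contrapT => /eqP GV; apply: none; exists t => //.
    by rewrite lt0e GV measure_ge0.
  apply: (@le_trans _ _ (mu1 ((G `&` orbit_phase t @^-1` V) `|` ~` G))).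
    apply: le_measure; rewrite ?inE//.
      by apply: measurableU => //; exact: measurableI.
    by move=> z Vz; have [Gz|nGz] := pselect (G z); [left|right].
  by rewrite -[leRHS]add0e -GV0; apply: measureU2 => //; exact: measurableI.
have fV : mu_c V \is a fin_num by exact: fin_num_measure.
rewrite -(fineK fV) -[leRHS]fineK ?fin_num_measure// lee_fin -/d.
rewrite leNgt; apply/negP => dV.
have e0 : 0 < (fine (mu_c V) - d) / 2 by rewrite divr_gt0// subr_gt0.
have /cvgrPdist_lt/(_ _ e0) cV := cesaro_freq_cvg lV.
suff : (\forall N \near \oo, False) by case=> M _ /(_ M (leqnn M)).
near=> N.
have N0 : 0 < N%:R :> R by rewrite ltr0n; near: N; exact: nbhs_infty_gt.
have : `|fine (mu_c V) - cesaro_freq V N| < (fine (mu_c V) - d) / 2 by near: N.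
have : T0%:R / ((fine (mu_c V) - d) / 2) < N%:R by near: N; exact: nbhs_infty_gtr.
rewrite ltr_pdivrMr// => TN /(le_lt_trans (ler_norm _)).
apply/negP; rewrite -leNgt lerBrDr -lerBrDl.
have -> : fine (mu_c V) - (fine (mu_c V) - d) / 2 =
  N%:R^-1 * (N%:R * (fine (mu_c V) - d) / 2 + N%:R * d) by field; rewrite gt_eqF.
apply: ler_wpM2l; first by rewrite invr_ge0 ltW.
(* The first [T0] terms are at most 1 and all others at most [d]; [N] was chosen so large that [T0]
   is negligible. *)
apply: (@le_trans _ _ (\sum_(i < N) ((i < T0)%N%:R + d))); last first.
  rewrite big_split/= sumr_const card_ord -[d *+ N]mulr_natl lerD2r -mulrA.
  apply: le_trans (ltW TN) => //.
  rewrite -natr_sum ler_nat.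
  have -> : (\sum_(i < N) (i < T0) = minn N T0)%N.
    move: (N); elim=> [|k IHk]; first by rewrite big_ord0 min0n.
    by rewrite big_ord_recr /= IHk; lia.
  exact: geq_minr.
apply: ler_sum => i _; case: ltnP => Ti; last by rewrite add0r f_le.
apply: (@le_trans _ _ 1); last by rewrite lerDl fine_ge0.
rewrite -lee_fin fineK ?fin_num_measure//; exact: probability_le1.
Unshelve. all: by end_near. Qed.

End cesaro.

(** * Entropy of words *)

Section word_sums.
Context (A : finType) (V : nmodType).

Lemma sum_tuple_cons n (F : seq A -> V) :
  \sum_(w : n.+1.-tuple A) F w = \sum_a \sum_(w : n.-tuple A) F (a :: w).
Proof.
rewrite pair_big /=.
rewrite (reindex (fun u : A * n.-tuple A => [tuple of u.1 :: u.2])) //=.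
exists (fun w => (thead w, [tuple of behead w])) => [[a w] _|w _] /=.
  by congr pair; apply: val_inj.
by rewrite [RHS]tuple_eta; apply: val_inj.
Qed.

Lemma sum_tuple_rcons n (F : seq A -> V) :
  \sum_(w : n.+1.-tuple A) F w = \sum_(w : n.-tuple A) \sum_a F (rcons w a).
Proof.
rewrite pair_big /=.
rewrite (reindex (fun u : n.-tuple A * A => [tuple of rcons u.1 u.2])) //=.
have sb (w : n.+1.-tuple A) : size (belast (thead w) (behead w)) == n.
  by rewrite size_belast size_behead size_tuple.
exists (fun w => (Tuple (sb w), last (thead w) (behead w))) => [[w a] _|w _] /=.
  congr pair; last by case: w => -[|b w] ? //=; rewrite last_rcons.
  by apply: val_inj; case: w => -[|b w] ? //=; rewrite belast_rcons.
apply: val_inj => /=; rewrite -lastI.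
by rewrite [in RHS](tuple_eta w).
Qed.

Lemma sum_tuple0 (F : seq A -> V) : \sum_(w : 0.-tuple A) F w = F [::].
Proof.
rewrite (big_pred1 [tuple]) // => w; apply/esym/eqP/val_inj.
by case: w => -[].
Qed.
End word_sums.

Section gibbs.
Variable R : realType.

Lemma ln_lt_sub1 (z : R) : 0 < z -> z != 1 -> ln z < z - 1.
Proof.
move=> z0 z1; rewrite ltrBrDl -[ltRHS](lnK z0); apply: expR_gt1Dx.
by rewrite ln_eq0.
Qed.

(** The strict form is what identifies the case of equality in Gibbs' inequality. *)
Lemma xlnx_sub_gt (x y : R) : 0 < x -> 0 < y -> x != y -> x - y < x * (ln x - ln y).
Proof.
move=> x0 y0 xy; have /(ln_lt_sub1 (divr_gt0 y0 x0)) : y / x != 1.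
  by apply: contra xy => /eqP yx; rewrite -[y](divfK (lt0r_neq0 x0)) yx mul1r.
have xyE : x * (y / x - 1) = y - x by field; rewrite gt_eqF.
by rewrite ln_div// -(ltr_pM2l x0) xyE -ltrN2 -mulrN !opprB.
Qed.

Lemma xlnx_sub_ge (x y : R) : 0 <= x -> 0 <= y -> (0 < x -> 0 < y) ->
  x - y <= x * (ln x - ln y).
Proof.
move=> x0 y0 xy; move: x0; rewrite le_eqVlt => /predU1P[<-|x0].
  by rewrite mul0r sub0r oppr_le0.
have [<-|neq] := eqVneq x y; first by rewrite !subrr mulr0.
by apply: ltW; apply: xlnx_sub_gt => //; exact: xy.
Qed.
End gibbs.

Section word_entropy.
Variables (R : realType) (A : finType) (p : seq A -> R).
Hypothesis p0 : forall w, 0 <= p w.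
Hypothesis pnil : p [::] = 1.
Hypothesis p_rcons : forall w, p w = \sum_a p (rcons w a).
Hypothesis p_cons : forall w, p w = \sum_a p (a :: w).

Definition word_entropy n : R := - \sum_(w : n.-tuple A) p w * ln (p w).
Definition entropy_rate n : R := word_entropy n.+1 - word_entropy n.

Lemma p_rcons_gt0 w a : 0 < p (rcons w a) -> 0 < p w.
Proof.
move=> wa; rewrite p_rcons (bigD1 a)//=.
by apply: ltr_wpDr => //; exact: sumr_ge0.
Qed.

Lemma p_cons_gt0 w a : 0 < p (a :: w) -> 0 < p w.
Proof.
move=> wa; rewrite p_cons (bigD1 a)//=.
by apply: ltr_wpDr => //; exact: sumr_ge0.
Qed.

Lemma sum_p n : \sum_(w : n.-tuple A) p w = 1.
Proof.
elim: n => [|n IHn]; first by rewrite sum_tuple0.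
by rewrite sum_tuple_rcons -IHn; apply: eq_bigr => w _; rewrite -p_rcons.
Qed.

Lemma entropy_rateE n : entropy_rate n =
  - \sum_(w : n.-tuple A) \sum_a p (rcons w a) * (ln (p (rcons w a)) - ln (p w)).
Proof.
rewrite /entropy_rate /word_entropy opprK addrC (sum_tuple_rcons _ (fun w => p w * ln (p w))).
rewrite -sumrB -sumrN; apply: eq_bigr => w _.
rewrite {1}p_rcons mulr_suml -sumrB -sumrN; apply: eq_bigr => a _; ring.
Qed.

Lemma entropy_rate_ge0 n : 0 <= entropy_rate n.
Proof.
rewrite entropy_rateE oppr_ge0; apply: sumr_le0 => w _; apply: sumr_le0 => a _.
have := p0 (rcons w a); rewrite le_eqVlt => /predU1P[<-|wa]; first by rewrite mul0r.
apply: mulr_ge0_le0 => //; rewrite subr_le0 ler_ln ?posrE//; last exact: p_rcons_gt0 wa.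
by rewrite [leRHS]p_rcons (bigD1 a)//= lerDl sumr_ge0.
Qed.

(* Gibbs' inequality between p(bwa) and p(bw) p(wa) / p(w). *)
Lemma entropy_rate_decr n : entropy_rate n.+1 <= entropy_rate n.
Proof.
rewrite !entropy_rateE lerN2.
rewrite (sum_tuple_cons _ (fun w => \sum_a p (rcons w a) * (ln (p (rcons w a)) - ln (p w)))).
rewrite [leRHS]exchange_big/= -subr_ge0 -sumrB.
rewrite (eq_bigr (fun w : n.-tuple A => \sum_b \sum_a
    p (b :: rcons w a) * (ln (p (b :: rcons w a)) - ln (p (b :: w)) -
                          ln (p (rcons w a)) + ln (p w)))); last first.
  move=> w _; rewrite [X in _ - X](_ : _ = \sum_b \sum_a
    p (b :: rcons w a) * (ln (p (rcons w a)) - ln (p w))); last first.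
    rewrite exchange_big/=; apply: eq_bigr => a _.
    by rewrite {1}(p_cons (rcons w a)) mulr_suml.
  rewrite -sumrB; apply: eq_bigr => b _; rewrite -sumrB; apply: eq_bigr => a _; ring.
apply: (@le_trans _ _ (\sum_(w : n.-tuple A) \sum_b \sum_a
  (p (b :: rcons w a) - p (b :: w) * p (rcons w a) / p w))).
  rewrite [leRHS](_ : _ = \sum_(w : n.-tuple A) (p w - p w * p w / p w)).
    apply: sumr_ge0 => w _; rewrite subr_ge0.
    have [->|w0] := eqVneq (p w) 0; first by rewrite !mul0r.
    by rewrite mulfK.
  apply: eq_bigr => w _.
  under eq_bigr do rewrite sumrB -mulr_suml -mulr_sumr -p_rcons -(p_rcons (_ :: w)).
  by rewrite sumrB -p_cons -!mulr_suml -p_cons.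
apply: ler_sum => w _; apply: ler_sum => b _; apply: ler_sum => a _.
have := p0 (b :: rcons w a); rewrite le_eqVlt => /predU1P[<-|bwa].
  by rewrite mul0r sub0r oppr_le0; apply: divr_ge0 => //; apply: mulr_ge0.
have wa0 := p_cons_gt0 bwa.
have bw0 : 0 < p (b :: w) by apply: (@p_rcons_gt0 (b :: w) a).
have w0 := p_rcons_gt0 wa0.
have -> : ln (p (b :: rcons w a)) - ln (p (b :: w)) - ln (p (rcons w a)) + ln (p w)
  = ln (p (b :: rcons w a)) - ln (p (b :: w) * p (rcons w a) / p w).
  by rewrite ln_div ?posrE ?mulr_gt0// lnM ?posrE//; ring.
apply: xlnx_sub_ge => // [|_]; last by rewrite divr_gt0// mulr_gt0.
by rewrite ltW// divr_gt0// mulr_gt0.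
Qed.

(** The quotient is the Cesàro mean of the rates, which decrease and are nonnegative. Since
    [entropy] is a bare [limn], nothing can be said about its value before this convergence is
    known. *)
Lemma word_entropy_cvg :
  word_entropy n / n%:R @[n --> \oo] --> limn entropy_rate.
Proof.
have cD : entropy_rate n @[n --> \oo] --> limn entropy_rate.
  apply/cvg_ex; exists (inf (range entropy_rate)); apply: nonincreasing_cvgn.
    by apply/nonincreasing_seqP => n; exact: entropy_rate_decr.
  by exists 0 => _ [n _ <-]; exact: entropy_rate_ge0.
have /cesaro := cD; rewrite -(@cvg_shiftS _ (fun n => word_entropy n / n%:R)).
rewrite /arithmetic_mean; apply: cvg_trans.
have -> // : (fun n => word_entropy n.+1 / n.+1%:R) =
  (fun n => n.+1%:R^-1 * series entropy_rate n.+1).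
apply/funext => n; rewrite mulrC; congr (_ * _).
rewrite /series /= /entropy_rate telescope_sumr//.
rewrite [X in _ - X](_ : _ = 0) ?subr0// /word_entropy.
by rewrite (sum_tuple0 (fun w => p w * ln (p w))) pnil ln1 mulr0 oppr0.
Qed.

Lemma lim_entropy_rate_le n : limn entropy_rate <= entropy_rate n.
Proof.
apply: nonincreasing_cvgn_ge.
  by apply/nonincreasing_seqP => k; exact: entropy_rate_decr.
apply/cvg_ex; exists (inf (range entropy_rate)); apply: nonincreasing_cvgn.
  by apply/nonincreasing_seqP => k; exact: entropy_rate_decr.
by exists 0 => _ [k _ <-]; exact: entropy_rate_ge0.
Qed.

End word_entropy.

(** * The Parry measure of S^1 *)

(* The subshift [S1] is read by a deterministic automaton: state 0 is free,
   state k in [1, 170] requires k more letters 0, state 171 follows a letter L. *)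
Definition delta (s : nat) (a : letter) : option nat :=
  if s is k.+1 then
    if s == 171%N then (if a is lE _ then Some 170 else None)
    else (if a is l0 then Some k else None)
  else match a with
    | l0 => Some 0
    | lE e => if e == ord0 then None else Some 170
    | lL => Some 171
    | lR => None
    end.

Fixpoint run (s : nat) (w : seq letter) : option nat :=
  if w is a :: w' then (if delta s a is Some u then run u w' else None) else Some s.

Lemma run_cat s w w' :
  run s (w ++ w') = if run s w is Some u then run u w' else None.
Proof. by elim: w s => [|a w IHw] s //=; case: (delta s a). Qed.

Lemma run_rcons s w a :
  run s (rcons w a) = if run s w is Some u then delta u a else None.
Proof.
by rewrite -cats1 run_cat; case: (run s w) => //= u; case: (delta u a).
Qed.

Lemma delta_lt s a u : (s < 172)%N -> delta s a = Some u -> (u < 172)%N.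
Proof.
case: s => [|s] slt /=.
  by case: a => [e|||] //=; [case: ifP => // _ [<-]|move=> [<-]|move=> [<-]].
case: ifP => _; first by case: a => // e [<-].
by case: a => // -[<-]; exact: ltnW.
Qed.

Lemma run_lt s w u : (s < 172)%N -> run s w = Some u -> (u < 172)%N.
Proof.
elim: w s => [|a w IHw] s slt /=; first by move=> [<-].
by case E: (delta s a) => [v|] //; apply: IHw; exact: delta_lt E.
Qed.

Lemma run_zeros s n : (s < 171)%N -> run s (zeros n) = Some (s - n)%N.
Proof.
elim: n s => [|n IHn] s slt; first by rewrite subn0.
rewrite /zeros /=; case: s slt => [|s] slt /=; first by rewrite IHn.
by rewrite ifF ?IHn//; lia.
Qed.

Lemma delta_sync s a u : delta s a = Some u -> a != l0 ->
  u = if a is lE _ then 170%N else 171%N.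
Proof.
case: s => [|s] /=; first by case: a => [e|||] //=; [case: ifP => // _ [<-]|rewrite eqxx|move=> [<-]].
case: ifP => _; first by case: a => // e [<-].
by case: a => // _; rewrite eqxx.
Qed.

(** As long as two readings are in different states, only zeros can have been read, since a nonzero
    letter determines the state after it; and 170 zeros take every state that can read them to state
    0. So the last 170 letters determine the state. *)
Lemma run_sync s s' w u u' : (s < 172)%N -> (s' < 172)%N ->
  (170 <= size w)%N -> run s w = Some u -> run s' w = Some u' -> u = u'.
Proof.
move=> slt slt' wsz; have [//|neq] := eqVneq u u'.
have wz v v' w' : run s w' = Some v -> run s' w' = Some v' -> v != v' ->
    w' = zeros (size w').
  elim/last_ind: w' v v' => [//|w' a IHw] v v'.
  rewrite !run_rcons; case E: (run s w') => [x|] //; case E': (run s' w') => [x'|] //.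
  have [->|xx'] := eqVneq x x'; first by move=> -> [->]; rewrite eqxx.
  have ltx := run_lt slt E; have ltx' := run_lt slt' E'.
  have {}IHw := IHw _ _ E E' xx'.
  suff : delta x a = Some v -> delta x' a = Some v' -> v != v' -> a = l0.
    move=> H dx dx' vv'; rewrite (H dx dx' vv') size_rcons {1}IHw.
    by rewrite /zeros -cats1 -(nseqD _ 1) addn1.
  have [//|an0] := eqVneq a l0.
  by move=> /delta_sync-> // /delta_sync-> //; rewrite eqxx.
move=> E E'; move: (wz _ _ _ E E' neq) => wE.
rewrite wE in E E'.
have small s0 v : (s0 < 172)%N -> run s0 (zeros (size w)) = Some v -> v = 0%N.
  move=> s0lt; have [s0l|] := ltnP s0 171.
    by rewrite run_zeros// => -[<-]; lia.
  move=> s0g; have -> : s0 = 171%N by lia.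
  by case: (size w) wsz.
by rewrite (small _ _ slt E) (small _ _ slt' E') eqxx in neq.
Qed.

Definition readable (w : seq letter) : bool := has (fun s => run s w) (iota 0 172).
(** From length 170 on all readings of [w] end in the same state, so the first one may be taken; 0
    is a default for unreadable words. *)
Definition endst (w : seq letter) : nat := head 0%N (pmap (fun s => run s w) (iota 0 172)).

Lemma readableP w : reflect (exists2 s, (s < 172)%N & run s w) (readable w).
Proof.
apply: (iffP hasP) => -[s]; first by rewrite mem_iota => slt ws; exists s.
by move=> slt ws; exists s => //; rewrite mem_iota.
Qed.

Lemma endstE s w u : (s < 172)%N -> (170 <= size w)%N -> run s w = Some u ->
  endst w = u.
Proof.
move=> slt wsz E; rewrite /endst.
have : u \in pmap (fun s => run s w) (iota 0 172).
  by rewrite mem_pmap; apply/mapP; exists s; rewrite ?mem_iota.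
case F: (pmap _ _) => [//|v r] _ /=.
have : v \in pmap (fun s => run s w) (iota 0 172) by rewrite F mem_head.
rewrite mem_pmap => /mapP[s']; rewrite mem_iota => slt' /esym E'.
exact: (run_sync slt' slt wsz E' E).
Qed.

Lemma sum_letter (V : nmodType) (F : letter -> V) :
  \sum_a F a = \sum_(e < 4) F (lE e) + (F l0 + (F lL + F lR)).
Proof.
rewrite (reindex letter_decode) /=; last first.
  exists letter_code => [c _|a _]; last exact: letter_codeK.
  case: c => [e|e] //=; case: e => -[|[|[|//]]] elt //=; congr inr; apply: val_inj;
  by rewrite /= inordK.
by rewrite big_sumType /=; congr (_ + _); rewrite !big_ord_recl big_ord0 /= addr0.
Qed.

Section eigenvectors.
Variables (R : realType) (t : R).
Hypothesis t0 : 0 < t.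
Hypothesis t1 : t < 1.
Hypothesis tE : t + 3 * t ^+ 171 + 4 * t ^+ 172 = 1.

(* Perron eigenvectors of the automaton for the eigenvalue 1/t. *)
Definition reig (s : nat) : R := if s == 171%N then 4 * t ^+ 171 else t ^+ s.
Definition leig (s : nat) : R :=
  if s == 0%N then 1 else if s == 171%N then t else t ^+ (170 - s) * (t * (3 + 4 * t)).

Definition oval (f : nat -> R) (o : option nat) : R := if o is Some u then f u else 0.

Lemma reig_gt0 s : 0 < reig s.
Proof. by rewrite /reig; case: ifP => _; rewrite ?mulr_gt0 ?exprn_gt0. Qed.

Lemma leig_gt0 s : 0 < leig s.
Proof.
rewrite /leig; case: ifP => // _; case: ifP => // _.
by rewrite mulr_gt0 ?exprn_gt0// mulr_gt0// addr_gt0 ?mulr_gt0.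
Qed.

Lemma reig_le s : reig s <= 4.
Proof.
have tn n : t ^+ n <= 1 by rewrite exprn_ile1// ltW.
rewrite /reig; case: ifP => _; last by apply: le_trans (tn _) _; rewrite ler1n.
by rewrite -[leRHS]mulr1 ler_wpM2l.
Qed.

Lemma right_eigen s : (s < 172)%N -> \sum_a oval reig (delta s a) = reig s / t.
Proof.
move=> slt; apply: (canRL (mulfK (lt0r_neq0 t0))).
rewrite sum_letter !big_ord_recl big_ord0 /=; case: s slt => [|s] slt.
  by rewrite /= /reig /= !expr0 -[RHS]tE; ring.
rewrite /=; have [->|s171] := eqVneq s.+1 171%N; rewrite /=.
  rewrite /reig /=; ring.
rewrite /reig ifF; last by apply/negbTE; lia.
by rewrite (negbTE s171) exprS; ring.
Qed.

(** The left eigenvector equation tested against an arbitrary [f], which avoids listing the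
    predecessors of each state. *)
Lemma left_eigen (f : nat -> R) :
  \sum_(s < 172) leig s * \sum_a oval f (delta s a) =
  t^-1 * \sum_(s < 172) leig s * f s.
Proof.
pose G s := \sum_a oval f (delta s a).
rewrite -[LHS]/(\sum_(s < 172) leig s * G s).
pose B := t * (3 + 4 * t); have tN0 : t != 0 by rewrite gt_eqF.
rewrite (big_ord_recl 171) (big_ord_recr 170) /= (big_ord_recl 171) (big_ord_recr 170) /=.
have d0 : G 0%N = f 0%N + 3 * f 170%N + f 171%N.
  by rewrite /G sum_letter !big_ord_recl big_ord0 /=; ring.
have d171 : G (bump 0 170) = 4 * f 170%N.
  by rewrite /G sum_letter !big_ord_recl big_ord0 /=; ring.
have dk (i : 'I_170) : leig (bump 0 i) * G (bump 0 i) =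
    t ^+ (169 - i) * B * f i.
  have i171 : (i.+1 == 171%N) = false by have := ltn_ord i; lia.
  rewrite /G sum_letter !big_ord_recl big_ord0 /= /bump /= add1n /leig i171 /=.
  by rewrite subSS /B; ring.
have lk (i : 'I_170) : leig (bump 0 i) * f (bump 0 i) = t ^+ (169 - i) * B * f i.+1.
  have i171 : (i.+1 == 171%N) = false by have := ltn_ord i; lia.
  by rewrite /bump add1n /leig i171 /= subSS.
under eq_bigr do rewrite dk; under [in RHS]eq_bigr do rewrite lk.
rewrite d0 d171 (big_ord_recl 169) [in RHS](big_ord_recr 169) /=.
have -> : \sum_(i < 169) t ^+ (169 - i) * B * f i.+1 =
    t * \sum_(i < 169) t ^+ (169 - bump 0 i) * B * f (bump 0 i).
  rewrite mulr_sumr; apply: eq_bigr => i _; have -> : bump 0 i = i.+1 by [].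
  have -> : (169 - i = (169 - i.+1).+1)%N by have := ltn_ord i; lia.
  by rewrite exprS; ring.
set S := \sum_(i < 169) _; rewrite /bump /leig /= subnn expr0 subn0.
(* This is the equation of [t] divided by [t]. *)
have tV : t^-1 = 1 + t ^+ 169 * B.
  by apply: (mulfI tN0); rewrite mulfV// -[LHS]tE /B; ring.
have BE : t^-1 * B = 3 + 4 * t by rewrite /B; field.
have -> : t^-1 * (1 * f 0%N + (t * S + 1 * B * f 170%N + t * f 171%N)) =
  t^-1 * f 0%N + (t^-1 * t) * S + (t^-1 * B) * f 170%N + (t^-1 * t) * f 171%N by ring.
by rewrite BE mulVf// tV; ring.
Qed.

End eigenvectors.

Section parry_words.
Variables (R : realType) (t : R).
Hypothesis t0 : 0 < t.
Hypothesis t1 : t < 1.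
Hypothesis tE : t + 3 * t ^+ 171 + 4 * t ^+ 172 = 1.
Let r := reig t.
Let l := leig t.

Definition parry_norm : R := \sum_(s < 172) l s * r s.
(** Parry's formula l_s t^n r_u / <l, r>, summed over the initial state s because a word need not
    determine the state in which its reading starts. *)
Definition parry_word (w : seq letter) : R :=
  parry_norm^-1 * t ^+ size w * \sum_(s < 172) l s * oval r (run s w).

Lemma parry_norm_gt0 : 0 < parry_norm.
Proof.
rewrite /parry_norm big_ord_recl /=; apply: ltr_wpDr.
  by apply: sumr_ge0 => i _; rewrite ltW// mulr_gt0// ?leig_gt0 ?reig_gt0.
by rewrite mulr_gt0// ?leig_gt0 ?reig_gt0.
Qed.

Lemma oval_ge0 o : 0 <= oval r o.
Proof. by case: o => //= s; rewrite ltW// reig_gt0. Qed.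

Lemma parry_word_ge0 w : 0 <= parry_word w.
Proof.
rewrite mulr_ge0//; first by rewrite mulr_ge0 ?invr_ge0 ?exprn_ge0 ?ltW ?parry_norm_gt0.
by apply: sumr_ge0 => i _; rewrite mulr_ge0 ?oval_ge0// ltW ?leig_gt0.
Qed.

Lemma parry_word_nil : parry_word [::] = 1.
Proof. by rewrite /parry_word expr0 mulr1 /= mulVf// gt_eqF ?parry_norm_gt0. Qed.

Lemma parry_word_rcons w : parry_word w = \sum_a parry_word (rcons w a).
Proof.
under eq_bigr do rewrite /parry_word size_rcons.
rewrite -mulr_sumr exchange_big /= /parry_word exprSr -!mulrA; congr (_ * (_ * _)).
rewrite mulr_sumr; apply: eq_bigr => s _; rewrite -mulr_sumr mulrCA; congr (_ * _).
under eq_bigr do rewrite run_rcons.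
case E: (run s w) => [u|] /=; last by rewrite big1// mulr0.
rewrite (right_eigen t0 t1 tE); first by rewrite mulrC divfK// gt_eqF.
exact: run_lt E.
Qed.

(** Consistency on the left comes from the left eigenvector, as consistency on the right does from
    the right one. Together they allow a two-sided measure whose cylinder masses do not depend on
    position. *)
Lemma parry_word_cons w : parry_word w = \sum_a parry_word (a :: w).
Proof.
rewrite /parry_word /= -mulr_sumr exchange_big /=.
under [in RHS]eq_bigr do rewrite -mulr_sumr.
have E (s : nat) : \sum_a oval r (if delta s a is Some u then run u w else None) =
   \sum_a oval (fun u => oval r (run u w)) (delta s a).
  by apply: eq_bigr => a _; case: (delta s a).
under [in RHS]eq_bigr do rewrite E.
rewrite (left_eigen t0 t1 tE (fun u => oval r (run u w))) exprS.
by rewrite !mulrA; congr (_ * _); field; rewrite ?gt_eqF// parry_norm_gt0.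
Qed.

Lemma parry_word_readable w : 0 < parry_word w -> readable w.
Proof.
move=> w0; apply: contraTT isT => nw.
suff : parry_word w = 0 by move=> w00; rewrite w00 ltxx in w0.
rewrite /parry_word big1 ?mulr0// => s _.
case E: (run s w) => [u|] /=; last by rewrite mulr0.
by move/readableP : nw; case; exists s => //; rewrite E.
Qed.

(** This uniform bound is all that the lower bound -ln t on the entropy requires. *)
Lemma parry_word_le : exists2 K : R, 0 < K & forall w, parry_word w <= K * t ^+ size w.
Proof.
exists (parry_norm^-1 * \sum_(s < 172) l s * 4).
  rewrite mulr_gt0 ?invr_gt0 ?parry_norm_gt0// big_ord_recl ltr_wpDr//.
    by apply: sumr_ge0 => i _; rewrite ltW// mulr_gt0// leig_gt0.
  by rewrite mulr_gt0// leig_gt0.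
move=> w; rewrite [leRHS]mulrAC; apply: ler_wpM2l.
  by rewrite mulr_ge0 ?invr_ge0 ?exprn_ge0 ?ltW ?parry_norm_gt0.
apply: ler_sum => s _; apply: ler_wpM2l; first by rewrite ltW ?leig_gt0.
by case: (run s w) => //= u; exact: reig_le.
Qed.

End parry_words.

(** The words that bring the free state back to itself for the first time are 0, the three words E_s
    0^170 with s nonzero, and the four words L E_s 0^170. The equation says that their weights
    t^length add up to 1. *)
Lemma parry_root (R : realType) : exists t : R,
  [/\ 0 < t, t < 1 & t + 3 * t ^+ 171 + 4 * t ^+ 172 = 1].
Proof.
suff H n m : (0 < n)%N -> (0 < m)%N ->
    exists t : R, [/\ 0 < t, t < 1 & t + 3 * t ^+ n + 4 * t ^+ m = 1] by exact: H.
move=> n0 m0; pose f : {poly R} := 'X + 3%:P * 'X^n + 4%:P * 'X^m - 1%:P.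
have fE x : f.[x] = x + 3 * x ^+ n + 4 * x ^+ m - 1 by rewrite /f !hornerE.
have [||x /andP[x0 x1] /rootP] := @poly_ivt R f 0 1; first exact: ler01.
  by rewrite !fE !expr1n !expr0n !gtn_eqF//=; apply/andP; split; lra.
rewrite fE => /subr0_eq xE; exists x; split => //.
  rewrite lt_def x0 andbT; apply/eqP => xz; move: xE.
  by rewrite xz !expr0n !gtn_eqF//= !mulr0 !addr0 => /eqP; rewrite eq_sym oner_eq0.
rewrite lt_def x1 andbT; apply/eqP => x1'; move: xE.
by rewrite -x1' !expr1n; lra.
Qed.

(** * Words read in a configuration, and their cylinders *)

Section occurs_theory.
Implicit Types (x : config letter) (a : int) (w : seq letter).

Definition word x a (n : nat) : seq letter := [seq x (a + l%:Z) | l <- iota 0 n].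

Lemma size_word x a n : size (word x a n) = n.
Proof. by rewrite size_map size_iota. Qed.

Lemma nth_word x a n k : (k < n)%N -> nth l0 (word x a n) k = x (a + k%:Z).
Proof. by move=> kn; rewrite (nth_map 0%N) ?size_iota// nth_iota. Qed.

Lemma occursE x a w : occurs x a w = (word x a (size w) == w).
Proof. by []. Qed.

Lemma word_occurs x a n : occurs x a (word x a n).
Proof. by rewrite occursE size_word. Qed.

Lemma occursP x a w :
  reflect (forall k : nat, (k < size w)%N -> x (a + k%:Z) = nth l0 w k) (occurs x a w).
Proof.
apply: (iffP eqP) => [wE k kw|wE]; first by rewrite -wE (nth_word x a kw).
apply: (@eq_from_nth _ l0); first by rewrite size_word.
by move=> k; rewrite size_word => kw; rewrite nth_word// wE.
Qed.

Lemma word_cat x a n m : word x a (n + m) = word x a n ++ word x (a + n%:Z) m.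
Proof.
rewrite /word iotaD map_cat; congr cat; rewrite add0n -[X in iota X m]addn0 iotaDl -map_comp.
by apply: eq_map => k /=; congr x; lia.
Qed.

Lemma occurs_cat x a w w' :
  occurs x a (w ++ w') = occurs x a w && occurs x (a + (size w)%:Z) w'.
Proof. by rewrite !occursE size_cat word_cat eqseq_cat// size_word. Qed.

Lemma occurs_cons x a c w : occurs x a (c :: w) = (x a == c) && occurs x (a + 1) w.
Proof.
rewrite -cat1s occurs_cat; congr andb; rewrite occursE /= eqseq_cons andbT.
by congr (x _ == _); lia.
Qed.

Lemma occurs_rcons x a w c :
  occurs x a (rcons w c) = occurs x a w && (x (a + (size w)%:Z) == c).
Proof. by rewrite -cats1 occurs_cat [X in _ && X]occurs_cons /= occursE andbT. Qed.

Lemma occurs_shift x a w : occurs (shift_map x) a w = occurs x (a + 1) w.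
Proof.
rewrite !occursE; congr (_ == w); apply: eq_map => k; rewrite /shift_map; congr x; lia.
Qed.

End occurs_theory.

Definition cyl (a : int) (w : seq letter) : set (config letter) :=
  [set x | occurs x a w].

Definition llocal (n : nat) (V : set (config letter)) :=
  forall x y, window n x y -> V x -> V y.

Lemma llocalE n V : llocal n V -> V = @lcode n @^-1` (@lcode n @` V).
Proof.
move=> lV; rewrite eqEsubset; split=> [x Vx|y [x Vx /wcodeP xy]]; first by exists x.
exact: lV Vx.
Qed.

Lemma llocal_measurable n V : llocal n V -> measurable V.
Proof.
by move=> /llocalE ->; apply: measurable_code; exact: measurable_lcode.
Qed.

Lemma cyl_llocal a w : exists n, llocal n (cyl a w).
Proof.
exists (absz a + size w)%N => x y xy; rewrite /cyl /= (@eq_occurs x y)// => k kw.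
by rewrite xy//; lia.
Qed.

Lemma measurable_cyl a w : measurable (cyl a w).
Proof. by have [n /llocal_measurable] := cyl_llocal a w. Qed.

Lemma window_cyl n x : window n x = cyl (- n%:Z) (word x (- n%:Z) n.*2.+1).
Proof.
rewrite eqEsubset; split => y.
  by move=> yx; apply/occursP => k; rewrite size_word => kn; rewrite nth_word// yx//; lia.
rewrite /cyl /= => /occursP yx j jn.
have := yx (absz (j + n%:Z)); rewrite size_word nth_word; last lia.
by have -> : - n%:Z + (absz (j + n%:Z))%:Z = j by [lia]; apply; lia.
Qed.

Lemma measurable_fun_llocal d (T : measurableType d) (f : T -> config letter) :
  (forall n V, llocal n V -> measurable (f @^-1` V)) -> measurable_fun setT f.
Proof.
move=> fV.
apply: (@measurability _ _ _ _ _ _ (@open (config letter)) erefl) => _ -[W oW <-].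
rewrite setTI; have -> : W = \bigcup_n [set y | window n y `<=` W].
  rewrite eqEsubset; split => [y Wy|y [n _]]; last exact.
  by have [n nW] := nbhs_window (open_nbhs_nbhs (conj oW Wy)); exists n.
rewrite preimage_bigcup; apply: bigcupT_measurable => n; apply: (fV n).
by move=> y z yz yW u zu; apply: yW => j jn; rewrite zu// yz.
Qed.

Section measures_of_cylinders.
Variables (R : realType).

Lemma measure_letter (mu : {measure set (config letter) -> \bar R}) B i : measurable B ->
  mu B = (\sum_a mu (B `&` [set x | x i = a]))%E.
Proof.
move=> mB; apply: (measure_code (code := fun x : config letter => x i)) => // k.
apply: (@llocal_measurable (absz i)) => x y xy /=.
by rewrite xy//; lia.
Qed.

Lemma measure_cyl_rcons (mu : {measure set (config letter) -> \bar R}) a w :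
  mu (cyl a w) = (\sum_c mu (cyl a (rcons w c)))%E.
Proof.
rewrite (measure_letter _ (a + (size w)%:Z)); last exact: measurable_cyl.
apply: eq_bigr => c _; congr (mu _); rewrite eqEsubset /cyl; split => x /=.
  by move=> [xw xc]; rewrite occurs_rcons xw xc eqxx.
by rewrite occurs_rcons => /andP[xw /eqP].
Qed.

Lemma measure_cyl_cons (mu : {measure set (config letter) -> \bar R}) a w :
  mu (cyl a w) = (\sum_c mu (cyl (a - 1) (c :: w)))%E.
Proof.
rewrite (measure_letter _ (a - 1)); last exact: measurable_cyl.
apply: eq_bigr => c _; congr (mu _); rewrite eqEsubset /cyl; split => x /=.
  by move=> [xw xc]; rewrite occurs_cons subrK xw xc eqxx.
by rewrite occurs_cons subrK => /andP[/eqP xc xw].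
Qed.

(** Large windows partition every local set, and local sets form a pi-system generating the
    sigma-algebra. Small windows are exempted so that, in applications, a given finite block of
    columns may be assumed to lie inside the window. *)
Lemma measure_eq_window (m1 m2 : {measure set (config letter) -> \bar R}) :
  (m1 setT < +oo)%E -> (exists N, forall n x, (N <= n)%N -> m1 (window n x) = m2 (window n x)) ->
  forall B, measurable B -> m1 B = m2 B.
Proof.
move=> m1T [N m12] B mB.
have m12l n V : llocal n V -> m1 V = m2 V.
  wlog Nn : n / (N <= n)%N => [wl lV|lV].
    apply: (wl (maxn n N)); first exact: leq_maxr.
    by move=> x y xy; apply: lV => j jn; apply: xy; lia.
  have mV := llocal_measurable lV.
  rewrite !(measure_code (@measurable_lcode n))//; apply: eq_bigr => k _.
  have [->|/set0P[x [Vx /= <-]]] := eqVneq (V `&` @lcode n @^-1` [set k]) set0.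
    by rewrite !measure0.
  rewrite (_ : _ `&` _ = window n x) ?m12// eqEsubset; split => y /=.
    by move=> [_ xy]; apply/wcodeP.
  by move=> xy; split; [exact: lV Vx|apply/esym/wcodeP].
pose G := [set V | exists n, llocal n V].
have GE : @measurable _ (config letter) = <<s G >>.
  rewrite eqEsubset; split.
    apply: smallest_sub; first exact: smallest_sigma_algebra.
    move=> W oW; have -> : W = \bigcup_n [set x | window n x `<=` W].
      rewrite eqEsubset; split => [x Wx|x [n _]]; last exact.
      by have [n nW] := nbhs_window (open_nbhs_nbhs (conj oW Wx)); exists n.
    apply: sigma_algebra_bigcup => n; apply: sub_gen_smallest; exists n => x y xy xW z yz.
    by apply: xW => j jn; rewrite yz// xy.
  apply: smallest_sub; first exact: sigma_algebra_measurable.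
  by move=> V [n /llocal_measurable].
apply: (@measure_unique _ _ _ G (fun=> setT) GE) => //.
- move=> V W [n lV] [k lW]; exists (maxn n k) => x y xy [Vx Wx]; split.
    by apply: lV Vx => j jn; apply: xy; lia.
  by apply: lW Wx => j jn; apply: xy; lia.
- by move=> _; exists 0%N.
- by rewrite bigcup_const.
- by move=> V [n]; exact: m12l.
Qed.

End measures_of_cylinders.

(** * A two-sided measure with prescribed word masses *)

Section tree_sampling.
Variables (R : realType) (A : finType) (q : seq A -> R).
Hypothesis q0 : forall w, 0 <= q w.
Hypothesis q_rcons : forall w, q w = \sum_a q (rcons w a).

(* The word [w] gets an interval of length [q w], cut into the intervals of its
   one-letter extensions; reading off nested intervals carries Lebesgue measure
   to a measure with prescribed masses of cylinders. *)
Definition cumul (w : seq A) (k : nat) : R := \sum_(b | (enum_rank b < k)%N) q (rcons w b).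

Fixpoint lower_from (pre w : seq A) : R :=
  if w is a :: w' then cumul pre (enum_rank a) + lower_from (rcons pre a) w' else 0.
Definition lower := lower_from [::].

Lemma lower_rcons w a : lower (rcons w a) = lower w + cumul w (enum_rank a).
Proof.
rewrite /lower -[in cumul w _](cat0s w).
elim: w [::] => [|b w IHw] pre /=; first by rewrite cats0 add0r addr0.
by rewrite IHw addrA cat_rcons.
Qed.

Lemma cumulS w (a : A) : cumul w (enum_rank a).+1 = cumul w (enum_rank a) + q (rcons w a).
Proof.
rewrite /cumul (bigD1 a)//= addrC; congr (_ + _); apply: eq_bigl => b.
rewrite ltnS [RHS]ltn_neqAle andbC; congr (_ && _); congr (~~ _).
by rewrite (inj_eq val_inj) (inj_eq enum_rank_inj).
Qed.

Lemma cumul_le w k k' : (k <= k')%N -> cumul w k <= cumul w k'.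
Proof.
move=> kk'; rewrite /cumul !(big_mkcond (fun b => (enum_rank b < _)%N))/=.
apply: ler_sum => b _; case: ifP => [bk|_]; last by case: ifP.
by rewrite (leq_trans bk kk').
Qed.

Definition tree_itv w : set R := [set x | lower w <= x < lower w + q w].

Lemma tree_itv_rcons w a x : tree_itv (rcons w a) x <->
  cumul w (enum_rank a) <= x - lower w < cumul w (enum_rank a).+1.
Proof. by rewrite /tree_itv /= lower_rcons cumulS -addrA lerBrDl ltrBlDl. Qed.

Lemma tree_itv_child w x : tree_itv w x -> exists a, tree_itv (rcons w a) x.
Proof.
move=> /andP[wx xw].
have ex : exists k, x - lower w < cumul w k.
  exists #|A|; rewrite ltrBlDl /cumul.
  by rewrite (eq_bigl xpredT) -?q_rcons// => b; rewrite ltn_ord.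
case: (ex_minnP ex) => k xk kmin.
case: k xk kmin => [|k] xk kmin.
  by move: xk; rewrite /cumul big_pred0// ltNge subr_ge0 wx.
have ck : cumul w k <= x - lower w by rewrite leNgt; apply/negP => /kmin; rewrite ltnn.
have [kA|Ak] := ltnP k #|A|.
  by exists (enum_val (Ordinal kA)); apply/tree_itv_rcons; rewrite enum_valK ck.
move: xk; rewrite ltNge (le_trans _ ck)// /cumul (eq_bigl (fun b : A => (enum_rank b < k)%N))//.
by move=> b; rewrite !(leq_trans (ltn_ord _))// leqW.
Qed.

Lemma tree_itv_uniq w a b x : tree_itv (rcons w a) x -> tree_itv (rcons w b) x -> a = b.
Proof.
move=> /tree_itv_rcons/andP[ax xa] /tree_itv_rcons/andP[bx xb].
apply: enum_rank_inj; apply: val_inj => /=.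
have aux k k' : cumul w k <= x - lower w -> x - lower w < cumul w k'.+1 -> (k <= k')%N.
  move=> kx xk; rewrite leqNgt; apply/negP => /(cumul_le w) kk.
  by have := le_lt_trans (le_trans kk kx) xk; rewrite ltxx.
by apply/eqP; rewrite eqn_leq !aux.
Qed.

Lemma tree_itv_parent w a x : tree_itv (rcons w a) x -> tree_itv w x.
Proof.
move=> /tree_itv_rcons/andP[ax xa]; apply/andP; split.
  rewrite -subr_ge0; apply: le_trans ax; apply: sumr_ge0 => *; exact: q0.
rewrite -ltrBlDl; apply: lt_le_trans xa _.
apply: (@le_trans _ _ (cumul w #|A|)); first by apply: cumul_le; exact: ltn_ord.
by rewrite /cumul (eq_bigl xpredT) -?q_rcons// => b; rewrite ltn_ord.
Qed.

Variable a0 : A.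

Fixpoint sample (n : nat) (x : R) : seq A :=
  if n is k.+1 then
    let h := sample k x in
    rcons h (xget a0 [set a | tree_itv (rcons h a) x])
  else [::].

Lemma size_sample n x : size (sample n x) = n.
Proof. by elim: n => //= n IHn; rewrite size_rcons IHn. Qed.

Lemma sample_itv n x : tree_itv [::] x -> tree_itv (sample n x) x.
Proof.
move=> x0; elim: n => //= n /tree_itv_child[a ax].
exact: (@xgetPex _ a0 [set b | tree_itv (rcons (sample n x) b) x] (ex_intro _ a ax)).
Qed.

Lemma sample_uniq w x : tree_itv w x -> sample (size w) x = w.
Proof.
elim/last_ind: w => //= w a IHw wax.
rewrite size_rcons /= IHw; last exact: tree_itv_parent wax.
congr rcons; apply: (@tree_itv_uniq w _ _ x) => //.
exact: (@xgetPex _ a0 [set b | tree_itv (rcons w b) x] (ex_intro _ a wax)).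
Qed.

Lemma sample_preimage w : tree_itv [::] `&` [set x | sample (size w) x = w] = tree_itv w.
Proof.
rewrite eqEsubset; split => [x [x0 /= xw]|x wx].
  by rewrite -xw; exact: sample_itv.
split; last exact: sample_uniq.
elim/last_ind: w wx => // w a IHw /tree_itv_parent; exact: IHw.
Qed.

End tree_sampling.

Section tree_measure.
Variables (R : realType) (A : finType) (q : seq A -> R) (a0 : A).
Hypothesis q0 : forall w, 0 <= q w.
Hypothesis q_rcons : forall w, q w = \sum_a q (rcons w a).
Hypothesis q_nil : q [::] = 1.

Lemma tree_itvE w : tree_itv q w = `[lower q w, lower q w + q w[%classic.
Proof. by rewrite set_itvco. Qed.

Lemma measurable_tree_itv w : measurable (tree_itv q w).
Proof. by rewrite tree_itvE; exact: measurable_itv. Qed.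

Lemma lebesgue_tree_itv w : lebesgue_measure (tree_itv q w) = (q w)%:E.
Proof.
rewrite tree_itvE lebesgue_measure_itv /= lte_fin ltrDl.
case: ltP => [_|qw]; first by rewrite -EFinB addrAC subrr add0r.
by congr EFin; apply/eqP; rewrite eq_le q0.
Qed.

(** Outside the root interval no child contains [x] and [xget] returns its default, so [sample] is
    explicit there and measurable on the whole line. *)
Lemma sample_outside n x : ~ tree_itv q [::] x -> sample q a0 n x = nseq n a0.
Proof.
move=> nx; have nxw w : ~ tree_itv q w x.
  by elim/last_ind: w => // w a IHw /(tree_itv_parent q0 q_rcons).
elim: n => //= n ->; rewrite xgetPN; last by move=> a; exact: nxw.
by rewrite -cats1 -(nseqD _ 1) addn1.
Qed.

Lemma measurable_sample n h : measurable [set x | sample q a0 n x = h].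
Proof.
have [hn|hn] := eqVneq (size h) n; last first.
  rewrite (_ : [set _ | _] = set0)// -subset0 => x /= xh.
  by rewrite -xh size_sample eqxx in hn.
have -> : [set x | sample q a0 n x = h] = tree_itv q h `|`
    (~` tree_itv q [::] `&` [set _ | nseq n a0 = h]).
  rewrite -(sample_preimage q0 q_rcons a0) hn eqEsubset; split=> x.
    have [x0|x0] := pselect (tree_itv q [::] x); first by left.
    by move=> /= xh; right; split => //=; rewrite -xh sample_outside.
  by move=> [[]//|[x0 /= <-]]; rewrite sample_outside.
apply: measurableU; first exact: measurable_tree_itv.
apply: measurableI; first by apply: measurableC; exact: measurable_tree_itv.
have [->|neq] := eqVneq (nseq n a0) h.
  by rewrite (_ : [set _ | _] = setT)// -subTset.
by rewrite (_ : [set _ | _] = set0)// -subset0 => x /= e; rewrite e eqxx in neq.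
Qed.
End tree_measure.

(* The letters of a history are the coordinates 0, -1, 1, -2, 2, ... in turn. *)
Definition spread (h : seq letter) : seq letter :=
  foldl (fun w a => if odd (size w) then a :: w else rcons w a) [::] h.

Lemma spread_rcons h a : spread (rcons h a) =
  if odd (size (spread h)) then a :: spread h else rcons (spread h) a.
Proof. by rewrite /spread foldl_rcons. Qed.

Lemma size_spread h : size (spread h) = size h.
Proof.
elim/last_ind: h => // h a IHh; rewrite spread_rcons size_rcons.
by case: ifP => _ /=; rewrite ?size_rcons IHh.
Qed.

Lemma spread_inj : injective spread.
Proof.
elim/last_ind => [|h a IHh] h' E; have := congr1 size E; rewrite !size_spread.
  by move=> /esym/size0nil.
elim/last_ind: h' E => [|h' a' _] E; first by rewrite size_rcons.
rewrite !size_rcons => -[hh']; move: E; rewrite !spread_rcons !size_spread hh'.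
by case: ifP => _ => [[-> /IHh->]|/rcons_inj[/IHh-> ->]].
Qed.

Lemma spread_surj w : exists h, spread h = w.
Proof.
elim: {w}(size w) {-2}w (erefl (size w)) => [|n IHn] w wn.
  by exists [::]; rewrite (size0nil wn).
have [no|ne] := boolP (odd n).
  case: w wn => // a w [/[dup] wn /IHn[h hw]]; exists (rcons h a).
  by rewrite spread_rcons hw wn no.
case/lastP: w wn => // w a; rewrite size_rcons => -[/[dup] wn /IHn[h hw]].
by exists (rcons h a); rewrite spread_rcons hw wn (negbTE ne).
Qed.

Section two_sided.
Variables (R : realType) (p : seq letter -> R).
Hypothesis p0 : forall w, 0 <= p w.
Hypothesis pnil : p [::] = 1.
Hypothesis p_rcons : forall w, p w = \sum_a p (rcons w a).
Hypothesis p_cons : forall w, p w = \sum_a p (a :: w).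

Let q h := p (spread h).
Let q0 h : 0 <= q h. Proof. exact: p0. Qed.
Let q_rcons h : q h = \sum_a q (rcons h a).
Proof.
rewrite /q; case E: (odd (size (spread h))); [rewrite p_cons|rewrite p_rcons];
by apply: eq_bigr => a _; rewrite spread_rcons E.
Qed.

Definition history n x := sample q l0 n x.
Definition central n x : seq letter := spread (history n.*2 x).
(** Coordinate [i] is read in a central word long enough to contain it; longer ones give the same
    letter by [nth_central]. *)
Definition sample_config (x : R) : config letter :=
  fun i => nth l0 (central (absz i).+1 x) (absz (i + (absz i).+1%:Z)).

Lemma size_central n x : size (central n x) = n.*2.
Proof. by rewrite size_spread size_sample. Qed.

Lemma centralS n x : exists a b, central n.+1 x = b :: rcons (central n x) a.
Proof.
rewrite /central doubleS /history /=.
set h := sample _ _ _ _; eexists _, _; rewrite !spread_rcons size_spread.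
have -> : odd (size h) = false by rewrite size_sample odd_double.
rewrite size_rcons size_spread /=.
have -> : odd (size h) = false by rewrite size_sample odd_double.
by [].
Qed.

Lemma nth_central n k x i : - n%:Z <= i < n%:Z ->
  nth l0 (central (n + k) x) (absz (i + (n + k)%N%:Z)) =
  nth l0 (central n x) (absz (i + n%:Z)).
Proof.
move=> ni; elim: k => [|k IHk]; first by rewrite addn0.
rewrite -IHk addnS; have [a [b ->]] := centralS (n + k) x.
have -> : absz (i + (n + k).+1%:Z) = (absz (i + (n + k)%N%:Z)).+1 by lia.
rewrite /= nth_rcons size_central ifT//; lia.
Qed.

Lemma word_sample_config n x : word (sample_config x) (- n%:Z) n.*2 = central n x.
Proof.
apply: (@eq_from_nth _ l0); first by rewrite size_word size_central.
move=> k; rewrite size_word => kn; rewrite nth_word// /sample_config.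
set i := - n%:Z + k%:Z.
have [ni|ni] := leqP (absz i).+1 n.
  have := @nth_central (absz i).+1 (n - (absz i).+1) x i.
  rewrite subnKC// => <-; last lia.
  by congr nth; rewrite /i; lia.
have -> : (absz i).+1 = (n + 1)%N by rewrite /i in ni *; lia.
rewrite nth_central; last by rewrite /i; lia.
by congr nth; rewrite /i; lia.
Qed.

Lemma measurable_sample_config : measurable_fun setT sample_config.
Proof.
apply: measurable_fun_llocal => n V lV.
pose code x := Tuple (introT eqP (size_sample q l0 n.+1.*2 x)).
have -> : sample_config @^-1` V = code @^-1` (code @` (sample_config @^-1` V)).
  rewrite eqEsubset; split => [x Vx|y [x Vx /(congr1 val) /= xy]]; first by exists x.
  apply: lV Vx => j jn.
  have cxy : central n.+1 x = central n.+1 y by congr spread; exact: xy.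
  have := word_sample_config n.+1 x; rewrite cxy -word_sample_config.
  move=> /(congr1 (fun w => nth l0 w (absz (j + n.+1%:Z)))).
  rewrite !nth_word; try lia.
  by have -> : - n.+1%:Z + (absz (j + n.+1%:Z))%:Z = j by [lia].
apply: measurable_code => k.
rewrite (_ : _ @^-1` _ = [set x | sample q l0 n.+1.*2 x = k]).
  exact: measurable_sample.
rewrite eqEsubset; split => x /=; first by move=> <-.
by move=> xk; apply: val_inj.
Qed.

Definition two_sided : set (config letter) -> \bar R :=
  pushforward (mrestr lebesgue_measure (measurable_tree_itv q [::])) sample_config.

HB.instance Definition _ := Measure.copy two_sided
  (measure_function_pushforward__canonical__measure_function_Measure
    (mrestr lebesgue_measure (measurable_tree_itv q [::])) measurable_sample_config).

Lemma two_sided_central n w : size w = n.*2 -> two_sided (cyl (- n%:Z) w) = (p w)%:E.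
Proof.
have [h <-] := spread_surj w; rewrite size_spread => hn.
rewrite /two_sided /pushforward /mrestr.
rewrite -[p _]/(q h) -(lebesgue_tree_itv q0) -(sample_preimage q0 q_rcons l0 h).
congr (lebesgue_measure _); rewrite eqEsubset.
split => x; rewrite /cyl /= occursE size_spread hn word_sample_config.
  by move=> [/eqP/spread_inj xh x0]; split=> //; rewrite hn.
by move=> [x0 xh]; split=> //; rewrite /central /history xh eqxx.
Qed.

(** Only words centred at the origin have the right mass by construction. Any other word is extended
    by one letter on a side that falls short, with induction on the number of missing letters. *)
Lemma two_sided_cyl a w : two_sided (cyl a w) = (p w)%:E.
Proof.
pose n := (absz a + size w)%N.
have : (a <= n%:Z - (size w)%:Z) && (- n%:Z <= a) by rewrite /n; lia.
move: n => n.
have : (exists j, j = n.*2 - size w)%N by eexists.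
case=> j; elim: j a w => [|j IHj] a w jn an.
  have -> : a = - n%:Z by lia.
  by apply: two_sided_central; lia.
have [a_n|a_n] := eqVneq a (- n%:Z).
  rewrite measure_cyl_rcons p_rcons -sumEFin; apply: eq_bigr => c _.
  by apply: IHj; rewrite size_rcons; lia.
rewrite measure_cyl_cons p_cons -sumEFin; apply: eq_bigr => c _.
by apply: IHj => /=; lia.
Qed.

Lemma two_sided_setT : two_sided setT = 1%E.
Proof.
rewrite (_ : setT = cyl 0 [::]) ?two_sided_cyl ?pnil//.
by rewrite eqEsubset; split.
Qed.

HB.instance Definition _ :=
  @Measure_isProbability.Build _ _ _ two_sided two_sided_setT.

Lemma exists_two_sided : exists nu : probability (config letter) R,
  forall a w, nu (cyl a w) = (p w)%:E.
Proof. by exists two_sided; exact: two_sided_cyl. Qed.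

End two_sided.

(** * The Markov form of a measure of maximal entropy *)

Lemma readable_rcons w a : readable (rcons w a) -> readable w.
Proof.
move=> /readableP[s slt]; rewrite run_rcons => sw; apply/readableP; exists s => //.
by case: (run s w) sw.
Qed.

Lemma readable_cons a w : readable (a :: w) -> readable w.
Proof.
move=> /readableP[s slt] /=; case E: (delta s a) => [u|] // uw.
by apply/readableP; exists u => //; exact: delta_lt E.
Qed.

Lemma endst_run w : readable w -> (170 <= size w)%N ->
  exists2 s, (s < 172)%N & run s w = Some (endst w).
Proof.
move=> /readableP[s slt]; case E: (run s w) => [u|] // _ wsz.
by exists s => //; rewrite (endstE slt wsz E).
Qed.

Lemma endst_lt w : readable w -> (170 <= size w)%N -> (endst w < 172)%N.
Proof. by move=> rw /(endst_run rw)[s slt /run_lt]; apply. Qed.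

Lemma endst_cons a w : readable (a :: w) -> (170 <= size w)%N -> endst (a :: w) = endst w.
Proof.
move=> raw wsz; have [|s slt /=] := endst_run raw; first by rewrite /= leqW.
case E: (delta s a) => [u|] // uw.
by apply/esym/(endstE _ wsz uw); exact: delta_lt E.
Qed.

Lemma endst_cat w w' : readable (w ++ w') -> (170 <= size w')%N ->
  endst (w ++ w') = endst w'.
Proof.
elim: w => //= a w IHw raw w'sz.
rewrite endst_cons//; last by rewrite size_cat; lia.
by apply: IHw => //; exact: readable_cons raw.
Qed.

Lemma delta_endst w a : readable w -> (170 <= size w)%N ->
  delta (endst w) a = if readable (rcons w a) then Some (endst (rcons w a)) else None.
Proof.
move=> rw wsz; case: ifPn => rwa.
  have [|s slt] := endst_run rwa; first by rewrite size_rcons leqW.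
  rewrite run_rcons; case E: (run s w) => [u|] // <-.
  by rewrite (endstE slt wsz E).
have [s slt E] := endst_run rw wsz.
case F: (delta _ _) => [u|] //; case/readableP: rwa; exists s => //.
by rewrite run_rcons E F.
Qed.

Section maximal_rate.
Variables (R : realType) (t : R) (p : seq letter -> R).
Hypothesis t0 : 0 < t.
Hypothesis t1 : t < 1.
Hypothesis tE : t + 3 * t ^+ 171 + 4 * t ^+ 172 = 1.
Hypothesis p0 : forall w, 0 <= p w.
Hypothesis pnil : p [::] = 1.
Hypothesis p_rcons : forall w, p w = \sum_a p (rcons w a).
Hypothesis p_cons : forall w, p w = \sum_a p (a :: w).
Hypothesis p_readable : forall w, 0 < p w -> readable w.
Hypothesis p_rate : forall n, - ln t <= entropy_rate p n.

Let g w := reig t (endst w).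
Let g0 w : 0 < g w. Proof. exact: reig_gt0. Qed.
Let K w a : R := if readable (rcons w a) then t * g (rcons w a) / g w else 0.

Lemma sum_kernel w : readable w -> (170 <= size w)%N -> \sum_a K w a = 1.
Proof.
move=> rw wsz.
have KE a : K w a = t / g w * oval (reig t) (delta (endst w) a).
  rewrite delta_endst// /K; case: ifP => _ /=; last by rewrite mulr0.
  by rewrite mulrAC -mulrA.
under eq_bigr do rewrite KE.
rewrite -mulr_sumr (right_eigen t0 t1 tE) ?endst_lt// -/(g w).
by field; rewrite !gt_eqF.
Qed.

Lemma kernel_ge0 w a : 0 <= K w a.
Proof. by rewrite /K; case: ifP => // _; rewrite ltW// divr_gt0// mulr_gt0. Qed.

(** Stationarity: removing the first letter changes neither the distribution nor, from length 170
    on, the end state. Hence the terms ln g cancel in the relative entropy. *)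
Lemma sum_ln_end n : (170 <= n)%N ->
  \sum_(w : n.-tuple letter) \sum_a p (rcons w a) * ln (g (rcons w a)) =
  \sum_(w : n.-tuple letter) p w * ln (g w).
Proof.
move=> n170; rewrite -(sum_tuple_rcons _ (fun w => p w * ln (g w))).
rewrite (sum_tuple_cons _ (fun w => p w * ln (g w))) exchange_big /=.
apply: eq_bigr => w _; rewrite [in RHS]p_cons mulr_suml; apply: eq_bigr => b _.
have := p0 (b :: w); rewrite le_eqVlt => /predU1P[<-|bw]; first by rewrite !mul0r.
by rewrite /g endst_cons ?size_tuple//; exact: p_readable.
Qed.

(* Equality case of Gibbs' inequality: the relative entropy of [p] with respect
   to the kernel [K] is [- ln t - entropy_rate p n <= 0]. *)
Lemma maximal_rate_kernel w a : (170 <= size w)%N -> p (rcons w a) = p w * K w a.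
Proof.
move=> wsz; pose n := size w.
pose term (u : seq letter) b :=
  p (rcons u b) * (ln (p (rcons u b)) - ln (p u * K u b)) - (p (rcons u b) - p u * K u b).
have K_gt0 u b : 0 < p (rcons u b) -> 0 < p u * K u b.
  move=> pub; rewrite mulr_gt0//; first exact: p_rcons_gt0 pub.
  by rewrite /K p_readable// divr_gt0// mulr_gt0.
have term_ge0 u b : 0 <= term u b.
  by rewrite subr_ge0 xlnx_sub_ge ?mulr_ge0 ?kernel_ge0//; exact: K_gt0.
have lnK u b : p (rcons u b) * (ln (p (rcons u b)) - ln (p u * K u b)) =
    p (rcons u b) * (ln (p (rcons u b)) - ln (p u)) -
    p (rcons u b) * ln t - p (rcons u b) * ln (g (rcons u b)) + p (rcons u b) * ln (g u).
  have := p0 (rcons u b); rewrite le_eqVlt => /predU1P[<-|pub]; first by rewrite !mul0r !subr0 add0r.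
  have pu := p_rcons_gt0 p0 p_rcons pub.
  rewrite /K p_readable// lnM ?posrE ?divr_gt0 ?mulr_gt0//.
  by rewrite ln_div ?posrE ?mulr_gt0// lnM ?posrE//; ring.
pose S (F : seq letter -> letter -> R) := \sum_(u : n.-tuple letter) \sum_b F u b.
have SB F G : S (fun u b => F u b - G u b) = S F - S G.
  by rewrite /S -sumrB; apply: eq_bigr => u _; rewrite sumrB.
have SD F G : S (fun u b => F u b + G u b) = S F + S G.
  by rewrite /S -big_split; apply: eq_bigr => u _; rewrite big_split.
have S1 : S (fun u b => p (rcons u b)) = 1.
  by rewrite -(sum_p pnil p_rcons n); apply: eq_bigr => u _; rewrite -p_rcons.
have Slnt : S (fun u b => p (rcons u b) * ln t) = ln t.
  rewrite -[RHS]mul1r -S1 mulr_suml; apply: eq_bigr => u _.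
  by rewrite mulr_suml.
have Sg : S (fun u b => p (rcons u b) * ln (g (rcons u b))) =
    S (fun u b => p (rcons u b) * ln (g u)).
  rewrite [LHS]sum_ln_end//; apply: eq_bigr => u _.
  by rewrite -mulr_suml -p_rcons.
have SK : S (fun u b => p u * K u b) = 1.
  rewrite -(sum_p pnil p_rcons n); apply: eq_bigr => u _; rewrite -mulr_sumr.
  have := p0 u; rewrite le_eqVlt => /predU1P[<-|pu]; first by rewrite mul0r.
  by rewrite sum_kernel ?mulr1 ?size_tuple//; exact: p_readable.
have sum_term : S term <= 0.
  rewrite /term SB; have -> : S (fun u b => p (rcons u b) * (ln (p (rcons u b)) - ln (p u * K u b)))
    = - entropy_rate p n - ln t.
    rewrite [LHS](_ : _ = S (fun u b => p (rcons u b) * (ln (p (rcons u b)) - ln (p u)) -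
      p (rcons u b) * ln t - p (rcons u b) * ln (g (rcons u b)) + p (rcons u b) * ln (g u))).
      rewrite SD !SB Slnt Sg subrK; congr (_ - _).
      by rewrite (entropy_rateE p_rcons) opprK.
    by apply: eq_bigr => u _; apply: eq_bigr => b _.
  by rewrite SB S1 SK subrr subr0 subr_le0 lerNl.
have term0 u b : size u = n -> term u b = 0.
  move=> un; have : S term == 0 by rewrite eq_le sum_term sumr_ge0// => v _; exact: sumr_ge0.
  rewrite psumr_eq0; last by move=> v _; exact: sumr_ge0.
  move=> /allP/(_ (Tuple (introT eqP un)) (mem_index_enum _)) /=.
  rewrite psumr_eq0// => /allP/(_ b (mem_index_enum _)) /=.
  by move/eqP.
have := term0 w a erefl; rewrite /term => /eqP; rewrite subr_eq0 => /eqP E.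
have := p0 (rcons w a); rewrite le_eqVlt => /predU1P[pwa|pwa].
  by move: E; rewrite -pwa mul0r sub0r => /eqP; rewrite eq_sym oppr_eq0 => /eqP.
apply/eqP/negPn/negP => neq.
by have := xlnx_sub_gt pwa (K_gt0 _ _ pwa) neq; rewrite E ltxx.
Qed.

End maximal_rate.

Section exchange.
Variables (R : realType) (t : R) (p : seq letter -> R).
Hypothesis t0 : 0 < t.
Hypothesis t1 : t < 1.
Hypothesis tE : t + 3 * t ^+ 171 + 4 * t ^+ 172 = 1.
Hypothesis p0 : forall w, 0 <= p w.
Hypothesis pnil : p [::] = 1.
Hypothesis p_rcons : forall w, p w = \sum_a p (rcons w a).
Hypothesis p_cons : forall w, p w = \sum_a p (a :: w).
Hypothesis p_readable : forall w, 0 < p w -> readable w.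
Hypothesis p_rate : forall n, - ln t <= entropy_rate p n.

(** The kernel telescopes along [u]: only its length and the end states before and after it
    remain. *)
Lemma gibbs_cat v u : (170 <= size v)%N -> readable (v ++ u) ->
  p (v ++ u) = p v * t ^+ size u * reig t (endst (v ++ u)) / reig t (endst v).
Proof.
move=> vsz; elim/last_ind: u => [|u a IHu].
  by rewrite cats0 expr0 mulr1 mulfK// gt_eqF// reig_gt0.
rewrite -rcons_cat => rvua.
rewrite (maximal_rate_kernel t0 t1 tE)//; last by rewrite size_cat; lia.
rewrite rvua IHu; last exact: readable_rcons rvua.
rewrite size_rcons exprS; field.
by rewrite !gt_eqF ?reig_gt0.
Qed.

(** The margin [s] alone determines the final state, so [gibbs_cat] sees of the middle word nothing
    but its length. *)
Lemma exchange_word v a b s : (170 <= size v)%N -> (170 <= size s)%N ->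
  size a = size b -> readable (v ++ a ++ s) -> readable (v ++ b ++ s) ->
  p (v ++ a ++ s) = p (v ++ b ++ s).
Proof.
move=> vsz ssz ab ra rb; rewrite !gibbs_cat// !size_cat ab.
rewrite !(catA v) !endst_cat//; by rewrite -catA.
Qed.

Lemma endst_zeros n : (170 <= n)%N -> endst (zeros n) = 0%N.
Proof.
by move=> n170; apply: (@endstE 0); rewrite ?size_nseq// run_zeros.
Qed.

(** After 170 zeros the state is 0, where each further zero costs exactly a factor [t]. *)
Lemma prob_zeros k : p (zeros (170 + k)) <= t ^+ k.
Proof.
have -> : zeros (170 + k) = zeros 170 ++ zeros k by rewrite /zeros -nseqD.
rewrite gibbs_cat ?size_nseq//; last first.
  rewrite -nseqD; apply/readableP; exists 0%N => //.
  by rewrite (@run_zeros 0 (170 + k)).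
rewrite -nseqD !(endst_zeros, @endst_zeros (170 + k)) ?leq_addr// mulfK ?gt_eqF ?reig_gt0//.
apply: ler_piMl; first by rewrite exprn_ge0 ?ltW.
rewrite -[leRHS](sum_p pnil p_rcons 170) (bigD1 (nseq_tuple 170 l0))//= lerDl.
exact: sumr_ge0.
Qed.
End exchange.

Lemma find_iotaP (P : nat -> bool) n k :
  (k <= n)%N -> (forall j, (j < k)%N -> ~~ P j) -> ((k < n)%N -> P k) ->
  find P (iota 0 n) = k.
Proof.
move=> kn Pj Pk; apply/eqP; rewrite eqn_leq; apply/andP; split.
  rewrite leqNgt; apply/negP => kf; have kn' : (k < n)%N.
    by apply: leq_trans kf _; rewrite -[leqRHS](size_iota 0 n) find_size.
  by have := before_find 0%N kf; rewrite nth_iota// add0n Pk.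
rewrite leqNgt; apply/negP => fk.
have fn : (find P (iota 0 n) < n)%N by exact: leq_trans kn.
have : has P (iota 0 n) by rewrite has_find size_iota.
by move=> /(nth_find 0%N); rewrite nth_iota// add0n; apply/negP/Pj.
Qed.

Lemma find_iota_spec (P : nat -> bool) n : let k := find P (iota 0 n) in
  [/\ (k <= n)%N, forall j, (j < k)%N -> ~~ P j & (k < n)%N -> P k].
Proof.
move=> k; have kn : (k <= n)%N by rewrite -[leqRHS](size_iota 0 n) find_size.
split => // [j jk|klt].
  by have := before_find 0%N jk; rewrite nth_iota ?(leq_trans jk)// add0n => ->.
have : has P (iota 0 n) by rewrite has_find size_iota.
by move=> /(nth_find 0%N); rewrite nth_iota.
Qed.

(** * Membership in S^1 as readability of all words *)

Section S1_readable.
Implicit Types (x : config letter) (i : int).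

Definition last_hat x i : nat :=
  find (fun k : nat => is_hat (x (i - k%:Z))) (iota 0 170).
Arguments last_hat : simpl never.

(** The state before [x i] is read. When none of the 170 preceding letters is a hat, [last_hat] is
    170 and the state is the free one. *)
Definition state x i : nat :=
  if x (i - 1) == lL then 171 else subn 170 (last_hat x (i - 1)).

Lemma S1_zeros x i (j : nat) : S1 x -> is_hat (x i) -> (j < 170)%N ->
  x (i + 1 + j%:Z) = l0.
Proof.
move=> /(_ i)[_ + _ _ _] => /[apply] /occursP/(_ j).
by rewrite size_nseq nth_nseq => + j170; rewrite j170; apply.
Qed.

Lemma state_delta x i : S1 x -> delta (state x i) (x i) = Some (state x (i + 1)).
Proof.
move=> xS; rewrite /state addrK.
have hat0 : is_hat (x i) -> last_hat x i = 0%N.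
  by move=> xi; apply: find_iotaP => // _; rewrite subr0.
have [xL|xL] := eqVneq (x (i - 1)) lL.
  have [_ _ + _ _] := xS (i - 1); rewrite subrK => /(_ xL) xi.
  by rewrite hat0//; case: (x i) xi.
have [kn kj kk] := find_iota_spec (fun k : nat => is_hat (x (i - 1 - k%:Z))) 170.
rewrite -/(last_hat x (i - 1)) in kn kj kk *; set k := last_hat x (i - 1) in kn kj kk *.
have [k170|k170] := ltnP k 170.
  have xi : x i = l0.
    have := S1_zeros xS (kk k170) k170.
    by have -> : i - 1 - k%:Z + 1 + k%:Z = i by lia.
  have -> : last_hat x i = k.+1.
    apply: find_iotaP => // [[|j] jk|_]; first by rewrite subr0 xi.
      by have := kj j; rewrite (_ : i - 1 - j%:Z = i - j.+1%:Z); [apply|lia].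
    by have := kk k170; rewrite (_ : i - 1 - k%:Z = i - k.+1%:Z)//; lia.
  have l0L : (l0 == lL) = false by apply/eqP.
  rewrite xi l0L (_ : (170 - k = (169 - k).+1)%N); last lia.
  by rewrite /= ifF ?subSS//; lia.
have -> : k = 170%N by lia.
rewrite subnn; have [xR _ _ xE0 xE] := xS i.
case xi: (x i) xR xE0 xE => [e|||] //= xR xE0 xE.
- rewrite hat0 ?xi// ifF//; apply/eqP => e0; move: xL; rewrite xE0 ?eqxx//.
  by rewrite e0.
- have -> : last_hat x i = 170%N.
    apply: find_iotaP => // -[|j] j170; first by rewrite subr0 xi.
    by have := kj j; rewrite (_ : i - 1 - j%:Z = i - j.+1%:Z); [apply; lia|lia].
  by rewrite (_ : (l0 == lL) = false)//; apply/eqP.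
- by rewrite eqxx.
- by rewrite eqxx in xR.
Qed.

Lemma state_lt x i : (state x i < 172)%N.
Proof. by rewrite /state; case: ifP => // _; lia. Qed.

Lemma wordS x i n : word x i n.+1 = x i :: word x (i + 1) n.
Proof.
rewrite -[n.+1]add1n word_cat (_ : word x i 1 = [:: x i])//.
by rewrite /word /= (_ : i + 0%N%:Z = i)//; lia.
Qed.

Lemma S1_run x i n : S1 x -> run (state x i) (word x i n) = Some (state x (i + n%:Z)).
Proof.
move=> xS; elim: n i => [|n IHn] i.
  by rewrite /= (_ : i + 0%N%:Z = i)//; lia.
rewrite wordS /=; rewrite (state_delta i xS) IHn; congr (Some (state x _)); lia.
Qed.

Lemma S1_word_readable x i n : S1 x -> readable (word x i n).
Proof.
move=> xS; apply/readableP; exists (state x i); first exact: state_lt.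
by rewrite S1_run.
Qed.

Lemma run_countdown k w v : (k <= 170)%N -> run k w = Some v ->
  forall j, (j < k)%N -> (j < size w)%N -> nth l0 w j = l0.
Proof.
elim: w k => [|a w IHw] [|k] k170 //=; rewrite ifF; last lia.
case: a => // rw [|j] //= jk jw.
by apply: (IHw k) => //; lia.
Qed.

Lemma delta_eq171 s a : (s < 172)%N -> delta s a = Some 171 -> a = lL.
Proof.
case: a => [e||//|] slt; [by move=> /delta_sync H; have := H isT| |].
  by case: s slt => //= s slt; case: ifP => // _ [sE]; rewrite sE in slt.
by case: s slt => //= s _; case: ifP.
Qed.

Lemma readable_cons2 a b w : readable (a :: b :: w) -> exists s u v z,
  [/\ (s < 172)%N, delta s a = Some u, delta u b = Some v & run v w = Some z].
Proof.
move=> /readableP[s slt] /=.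
case E1: (delta s _) => [u|] //; case E2: (delta u _) => [v|] //.
by case E3: (run v w) => [z|] // _; exists s, u, v, z.
Qed.

(** The conditions of [S1] at [i] concern the letter before [i], the letter at [i] and 170 letters
    after it: 172 in all. *)
Lemma readable_S1 x : (forall i, readable (word x i 172)) -> S1 x.
Proof.
move=> xr i.
have [s [u [v [z [slt E1 E2 E3]]]]] : exists s u v z, [/\ (s < 172)%N,
    delta s (x (i - 1)) = Some u, delta u (x i) = Some v &
    run v (word x (i + 1) 170) = Some z].
  have := xr (i - 1); rewrite (wordS _ _ 171) (wordS _ _ 170) subrK.
  exact: readable_cons2.
have ult := delta_lt slt E1; have vlt := delta_lt ult E2.
have hat170 : is_hat (x i) -> v = 170%N.
  by case xi: (x i) E2 => [e|||] // /delta_sync->.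
split.
- by apply/eqP => xi; move: E2; rewrite xi; case: (u) => //= ?; case: ifP.
- move=> /hat170 v170; apply/(@occursP _ _ (zeros 170)) => k k170'.
  have k170 : (k < 170)%N := k170'.
  rewrite (_ : nth l0 (zeros 170) k = l0); last by rewrite nth_nseq k170.
  rewrite -(nth_word x (i + 1) k170).
  by rewrite v170 in E3; apply: (run_countdown _ E3) => //; rewrite size_word.
- move=> xi; move: E2; rewrite xi; case: (u) => [|k] /=; last by case: (k.+1 == 171%N).
  move=> [uv]; move: E3; rewrite -uv (wordS x (i + 1) 169).
  by case: (x (i + 1)).
- move=> xi; move: E2; rewrite xi; case: (u) E1 => [|u'] //= E1; case: eqP => // uE _.
  by apply: (delta_eq171 slt); rewrite E1 uE.
- move=> xh xE; case x1: (x (i - 1)) E1 => [e|||] // E1; try by [right|left].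
    have u170 := delta_sync E1 isT; move: E2; rewrite u170 /=.
    by case: (x i) xh.
  by move: E1; case: (s) => //= ?; case: ifP.
Qed.

End S1_readable.

Lemma cylinder_cyl n (w : n.-tuple letter) : cylinder w = cyl 0 w.
Proof.
rewrite eqEsubset; split => x.
  move=> xw; apply/occursP => k kw; rewrite add0r.
  have kn : (k < n)%N by rewrite size_tuple in kw.
  by rewrite (xw (Ordinal kn)) (tnth_nth l0).
move=> /occursP xw i; rewrite (tnth_nth l0) -xw ?add0r//.
by rewrite size_tuple.
Qed.

Lemma measurable_readable i n : measurable [set x | readable (word x i n)].
Proof.
apply: (@llocal_measurable (absz i + n)) => x y xy /=.
suff -> : word x i n = word y i n by [].
by apply/eq_in_map => k; rewrite mem_iota => kl; rewrite xy//; lia.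
Qed.

Lemma S1_bigcap : S1 = \bigcap_(n in [set: nat]) ([set x | readable (word x n%:Z 172)] `&`
  [set x | readable (word x (- n%:Z) 172)]).
Proof.
rewrite eqEsubset; split => x.
  by move=> xS i _; split; exact: S1_word_readable.
move=> xr; apply: readable_S1 => i; have [/= xi mxi] := xr (absz i) I.
have [i0|i0] := lerP 0 i; first by rewrite (_ : i = absz i)//; lia.
by rewrite (_ : i = - (absz i)%:Z)//; lia.
Qed.

Lemma measurable_S1 : measurable S1.
Proof.
by rewrite S1_bigcap; apply: bigcapT_measurable => n; apply: measurableI;
   exact: measurable_readable.
Qed.

Section invariant_words.
Variables (R : realType) (mu : probability (config letter) R).
Hypothesis mu_inv : shift_invariant mu.

Definition word_prob (w : seq letter) : R := fine (mu (cyl 0 w)).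

Lemma cyl_fin_num a w : mu (cyl a w) \is a fin_num.
Proof. by apply: fin_num_measure; exact: measurable_cyl. Qed.

Lemma mu_cyl_shift a w : mu (cyl (a + 1) w) = mu (cyl a w).
Proof.
rewrite -(mu_inv (measurable_cyl a w)); congr (mu _).
by rewrite eqEsubset /cyl; split => x /=; rewrite occurs_shift.
Qed.

Lemma mu_cyl a w : mu (cyl a w) = (word_prob w)%:E.
Proof.
rewrite /word_prob fineK ?cyl_fin_num//.
case: a => n; elim: n => [|n IHn] //.
- by rewrite -IHn -[RHS]mu_cyl_shift; congr (mu (cyl _ _)); lia.
- by rewrite -[LHS]mu_cyl_shift; congr (mu (cyl _ _)).
- by rewrite -IHn -[LHS]mu_cyl_shift; congr (mu (cyl _ _)); lia.
Qed.

Lemma word_prob_ge0 w : 0 <= word_prob w.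
Proof. by rewrite fine_ge0. Qed.

Lemma word_prob_nil : word_prob [::] = 1.
Proof.
rewrite /word_prob (_ : cyl 0 [::] = setT) ?probability_setT//.
by rewrite eqEsubset; split.
Qed.

Lemma word_prob_rcons w : word_prob w = \sum_a word_prob (rcons w a).
Proof.
apply: EFin_inj; rewrite -(mu_cyl 0) measure_cyl_rcons -sumEFin.
apply: eq_bigr => a _; exact: mu_cyl.
Qed.

Lemma word_prob_cons w : word_prob w = \sum_a word_prob (a :: w).
Proof.
apply: EFin_inj; rewrite -(mu_cyl 0) measure_cyl_cons -sumEFin.
apply: eq_bigr => a _; exact: mu_cyl.
Qed.

Lemma entropyE : entropy mu = limn (entropy_rate word_prob).
Proof.
rewrite /entropy; apply: cvg_lim => //.
have := word_entropy_cvg word_prob_ge0 word_prob_nil word_prob_rcons word_prob_cons.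
apply: cvg_trans; apply: near_eq_cvg; apply: nearW => n.
congr (_ / _); rewrite /block_entropy /word_entropy; congr (- _).
by apply: eq_bigr => w _; rewrite cylinder_cyl.
Qed.

Lemma word_prob_readable w : mu S1 = 1%E -> 0 < word_prob w -> readable w.
Proof.
move=> muS w0; have mC := measurable_cyl 0 w.
apply: contrapT => nr; suff : word_prob w = 0 by move=> w00; rewrite w00 ltxx in w0.
apply: EFin_inj; rewrite -(mu_cyl 0); apply: (@subset_measure0 _ _ _ _ _ (~` S1)) => //.
- by apply: measurableC; exact: measurable_S1.
- move=> x /eqP xw xS; apply: nr; rewrite -[w]xw; exact: S1_word_readable.
- by apply: (etrans (probability_setC mu measurable_S1)); rewrite muS subee.
Qed.

End invariant_words.

(** For a word of length n the bound gives -ln p(w) >= -ln K - n ln t; average over words, divide by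
    n and let n grow. *)
Lemma entropy_ge (R : realType) (mu : probability (config letter) R) (K t : R) :
  shift_invariant mu -> 0 < K -> 0 < t ->
  (forall w, word_prob mu w <= K * t ^+ size w) -> - ln t <= entropy mu.
Proof.
move=> mu_inv K0 t0 wK; rewrite (entropyE mu_inv).
have wp0 := word_prob_ge0 mu; have wpn := word_prob_nil mu.
have wpr := word_prob_rcons mu_inv; have wpc := word_prob_cons mu_inv.
have Hc := word_entropy_cvg wp0 wpn wpr wpc.
have Hge n : - ln K - n%:R * ln t <= word_entropy (word_prob mu) n.
  have -> : - ln K - n%:R * ln t = - (\sum_(w : n.-tuple letter) word_prob mu w * (ln K + n%:R * ln t)).
    by rewrite -mulr_suml (sum_p wpn wpr) mul1r opprD.
  rewrite lerN2; apply: ler_sum => w _.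
  have := wp0 w; rewrite le_eqVlt => /predU1P[<-|w0]; first by rewrite !mul0r.
  apply: ler_wpM2l => //.
  rewrite mulr_natl -lnXn// -lnM ?posrE ?exprn_gt0// ler_ln ?posrE ?mulr_gt0 ?exprn_gt0//.
  by have := wK w; rewrite size_tuple.
have cc : (- ln K * harmonic n - ln t : R) @[n --> \oo] --> - ln t.
  rewrite -[X in _ --> X]add0r; apply: cvgB; last exact: cvg_cst.
  rewrite -(mulr0 (- ln K)); apply: cvgM; first exact: cvg_cst.
  exact: cvg_harmonic.
rewrite -(@cvg_shiftS _ (fun n => word_entropy _ n / n%:R)) in Hc.
apply: (ler_cvg_to cc Hc); apply: nearW => n /=.
rewrite ler_pdivlMr ?ltr0n// mulrBl divfK ?pnatr_eq0//.
by rewrite [X in _ - X]mulrC.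
Qed.

Lemma measurable_shift : measurable_fun setT (@shift_map letter).
Proof.
apply: measurable_fun_llocal => n V lV; apply: (@llocal_measurable n.+1) => x y xy.
by apply: lV => j jn; rewrite /shift_map xy//; lia.
Qed.

Lemma shift_invariant_cyl (R : realType) (mu : probability (config letter) R) :
  (forall a w, mu (cyl (a + 1) w) = mu (cyl a w)) -> shift_invariant mu.
Proof.
move=> mu_cyl1 B mB.
pose push : {measure set (config letter) -> \bar R} := pushforward mu (@shift_map letter).
have := @measure_eq_window _ (push measurable_shift) mu _ _ B mB; apply => [|].
  by rewrite /push /= /pushforward preimage_setT probability_setT ltry.
exists 0%N => n x _.
rewrite window_cyl; apply: (etrans _ (mu_cyl1 _ _)).
rewrite /push /= /pushforward; congr (mu _).
by rewrite eqEsubset /cyl; split => y /=; rewrite occurs_shift.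
Qed.

Lemma probability_S1 (R : realType) (mu : probability (config letter) R) :
  (forall i w, ~ readable w -> mu (cyl i w) = 0%E) -> mu S1 = 1%E.
Proof.
move=> mu0; have mr i : mu [set x | ~ readable (word x i 172)] = 0%E.
  have mcode k : measurable ((fun x => Tuple (introT eqP (size_word x i 172))) @^-1` [set k]).
    rewrite (_ : _ @^-1` _ = cyl i k); first exact: measurable_cyl.
    rewrite eqEsubset /cyl; split => x /=; first by move=> <-; exact: word_occurs.
    by rewrite occursE size_tuple => /eqP xk; exact: val_inj.
  apply: (measure_code0 mcode).
    exact: (measurableC (measurable_readable i 172)).
  move=> x /(mu0 i) <-; congr (mu _).
  rewrite eqEsubset /cyl; split => y /=.
    by move=> /(congr1 val)/= <-; exact: word_occurs.
  by rewrite occursE size_word => /eqP xk; exact: val_inj.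
suff : mu (~` S1) = 0%E.
  move=> S0; rewrite -[S1]setCK; apply: (etrans (probability_setC mu _)).
    by apply: measurableC; exact: measurable_S1.
  by rewrite S0 sube0.
rewrite S1_bigcap setC_bigcap; apply/negligibleP.
  apply: bigcupT_measurable => n; apply: measurableC.
  by apply: measurableI; exact: measurable_readable.
apply: negligible_bigcup => n; rewrite setCI.
by apply: negligibleU; apply/(negligibleP _ (measurableC (measurable_readable _ _)));
  exact: mr.
Qed.

Section parry.
Variables (R : realType) (mu : probability (config letter) R).
Hypothesis mu_parry : parry_measure S1 mu.

(** The only place where maximality is used. It bounds the limit of the rates of [mu] below by the
    entropy of the explicit measure [nu]; as the rates decrease, each of them inherits the bound. *)
Lemma parry_markov : exists t : R, [/\ 0 < t, t < 1, t + 3 * t ^+ 171 + 4 * t ^+ 172 = 1 &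
  forall n, - ln t <= entropy_rate (word_prob mu) n].
Proof.
have [t [t0 t1 tE]] := parry_root R; exists t; split => //.
have [mu_inv muS mu_max] := mu_parry.
have [nu nuE] := exists_two_sided (parry_word_ge0 t0) (parry_word_nil t0)
  (parry_word_rcons t0 t1 tE) (parry_word_cons t0 t1 tE).
have nu_inv : shift_invariant nu.
  by apply: shift_invariant_cyl => a w; rewrite !nuE.
have nuS : nu S1 = 1%E.
  apply: probability_S1 => i w nw; rewrite nuE; congr EFin.
  apply/eqP; have := parry_word_ge0 t0 w; rewrite le_eqVlt eq_sym => /orP[//|].
  by move=> /parry_word_readable.
have wpE w : word_prob nu w = parry_word t w by rewrite /word_prob nuE.
have [K K0 wK] := parry_word_le t0 t1.
have ent : - ln t <= entropy nu.
  by apply: (entropy_ge nu_inv K0 t0) => w; rewrite wpE.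
move=> n; apply: le_trans ent _; apply: le_trans (mu_max _ nu_inv nuS) _.
rewrite (entropyE mu_inv); apply: lim_entropy_rate_le.
- exact: word_prob_ge0.
- exact: word_prob_rcons.
- exact: word_prob_cons.
Qed.

End parry.

(** * Exchange of words under the Parry measure *)

Lemma readable_cat w w' : readable (w ++ w') -> readable w /\ readable w'.
Proof.
move=> /readableP[s slt]; rewrite run_cat; case E: (run s w) => [u|] // uw'.
split; apply/readableP; first by exists s; rewrite ?E.
by exists u => //; exact: run_lt E.
Qed.

Lemma run_endst v w : readable (v ++ w) -> (170 <= size v)%N ->
  run (endst v) w = Some (endst (v ++ w)).
Proof.
move=> rvw vsz; have vwsz : (170 <= size (v ++ w))%N by rewrite size_cat; lia.
have [s slt] := endst_run rvw vwsz.
rewrite run_cat; case E: (run s v) => [u|] // <-.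
by rewrite (endstE slt vsz E).
Qed.

(** Both middles can be read from the state reached after [v], and [s] restores a common state
    before [S]. *)
Lemma readable_exchange P v a b s S : (170 <= size v)%N -> (170 <= size s)%N ->
  readable (v ++ a ++ s) -> readable (v ++ b ++ s) ->
  readable (P ++ v ++ a ++ s ++ S) -> readable (P ++ v ++ b ++ s ++ S).
Proof.
move=> vsz ssz ra rb rPS.
have [rP _] : readable ((P ++ v) ++ a ++ s ++ S) /\ True by rewrite -catA.
have Pvsz : (170 <= size (P ++ v))%N by rewrite size_cat; lia.
have [rPv _] := readable_cat rP.
have [k klt kE] := endst_run rPv Pvsz.
apply/readableP; exists k => //.
rewrite catA run_cat kE (endst_cat rPv vsz) catA run_cat (run_endst rb vsz).
have rPa : readable ((P ++ v ++ a ++ s) ++ S) by rewrite -!catA.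
have [rPas _] := readable_cat rPa.
have := run_endst rPa; rewrite size_cat !size_cat => /(_ ltac:(lia)).
rewrite (catA v b) (endst_cat _ ssz) -?catA// !(catA P) -!catA.
rewrite (catA v a) (catA P) (endst_cat _ ssz) -?catA// => ->.
by [].
Qed.

Definition overwrite (j : int) (a : seq letter) (z : config letter) : config letter :=
  fun k => if (j <= k) && (k < j + (size a)%:Z) then nth l0 a (absz (k - j)) else z k.

Lemma overwrite_in j a z k : j <= k < j + (size a)%:Z ->
  overwrite j a z k = nth l0 a (absz (k - j)).
Proof. by rewrite /overwrite => ->. Qed.

Lemma overwrite_out j a z k : (k < j) || (j + (size a)%:Z <= k) -> overwrite j a z k = z k.
Proof. by rewrite /overwrite => jk; rewrite ifF//; lia. Qed.

Lemma occurs_overwrite j a z : occurs (overwrite j a z) j a.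
Proof.
apply/occursP => k kw; rewrite overwrite_in; last lia.
by congr nth; lia.
Qed.

Lemma occurs_overwrite_out j a z i w :
  (i + (size w)%:Z <= j) || (j + (size a)%:Z <= i) ->
  occurs (overwrite j a z) i w = occurs z i w.
Proof. by move=> ij; apply: eq_occurs => k kw; rewrite overwrite_out//; lia. Qed.

Lemma measurable_overwrite j a : measurable_fun setT (overwrite j a).
Proof.
apply: measurable_fun_llocal => n V lV; apply: (@llocal_measurable n) => x y xy.
by apply: lV => k kn; rewrite /overwrite; case: ifP => // _; exact: xy.
Qed.

Section exchange_measure.
Variables (R : realType) (mu : probability (config letter) R).
Hypothesis mu_parry : parry_measure S1 mu.

Let mu_inv : shift_invariant mu. Proof. by case: mu_parry. Qed.
Let muS : mu S1 = 1%E. Proof. by case: mu_parry. Qed.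

Lemma mu_cyl_exchange i v a b s : (170 <= size v)%N -> (170 <= size s)%N ->
  size a = size b -> readable (v ++ a ++ s) -> readable (v ++ b ++ s) ->
  mu (cyl i (v ++ a ++ s)) = mu (cyl i (v ++ b ++ s)).
Proof.
move=> vsz ssz ab ra rb; rewrite !(mu_cyl mu_inv); congr EFin.
have [t [t0 t1 tE rate]] := parry_markov mu_parry.
apply: (exchange_word t0 t1 tE) => //.
- exact: word_prob_ge0.
- exact: word_prob_nil.
- exact: word_prob_rcons.
- exact: word_prob_cons.
- by move=> w; exact: word_prob_readable.
Qed.

Lemma mu_cyl_unreadable i w : ~~ readable w -> mu (cyl i w) = 0%E.
Proof.
move=> nw; rewrite (mu_cyl mu_inv); congr EFin; apply/eqP.
rewrite eq_le word_prob_ge0 andbT leNgt; apply/negP => /(word_prob_readable mu_inv muS).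
by apply/negP.
Qed.

Lemma mu_zeros : exists t : R, [/\ 0 < t, t < 1 &
  forall i k, (mu (cyl i (zeros (170 + k))) <= (t ^+ k)%:E)%E].
Proof.
have [t [t0 t1 tE rate]] := parry_markov mu_parry.
exists t; split => // i k; rewrite (mu_cyl mu_inv) lee_fin.
apply: (prob_zeros t0 t1 tE) => //.
- exact: word_prob_ge0.
- exact: word_prob_nil.
- exact: word_prob_rcons.
- exact: word_prob_cons.
- by move=> w; exact: word_prob_readable.
Qed.

(** Overwriting [b] by [a] carries [mu] restricted to one cylinder to [mu] restricted to the other.
    It is enough to compare windows containing the whole word, and there it is an exchange of words
    with longer margins. *)
Lemma swap_measure i v a b s B : (170 <= size v)%N -> (170 <= size s)%N ->
  size a = size b -> readable (v ++ a ++ s) -> readable (v ++ b ++ s) ->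
  measurable B ->
  mu (cyl i (v ++ b ++ s) `&` overwrite (i + (size v)%:Z) a @^-1` B) =
  mu (cyl i (v ++ a ++ s) `&` B).
Proof.
move=> vsz ssz ab ra rb mB.
set th := overwrite _ _.
have mth : measurable_fun setT th by exact: measurable_overwrite.
have mb := measurable_cyl i (v ++ b ++ s); have ma := measurable_cyl i (v ++ a ++ s).
pose m1 : {measure set (config letter) -> \bar R} :=
  pushforward (mrestr mu mb) (th : _ -> _).
pose m2 : {measure set (config letter) -> \bar R} := mrestr mu ma.
have th_vas z : occurs z i (v ++ b ++ s) -> occurs (th z) i (v ++ a ++ s).
  rewrite !occurs_cat -ab => /and3P[zv _ zs].
  rewrite /th occurs_overwrite !occurs_overwrite_out ?zv ?zs//; lia.
suff : m1 mth B = m2 B.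
  by rewrite /m1 /m2 /= /pushforward /mrestr [in LHS]setIC [in RHS]setIC.
apply: measure_eq_window mB; rewrite /m1 /m2 /= /pushforward /mrestr.
  by rewrite preimage_setT setTI ltey_eq fin_num_measure.
exists (absz i + size (v ++ a ++ s))%N => n x nN.
have eqi z : window n x z -> occurs z i (v ++ a ++ s) = occurs x i (v ++ a ++ s).
  by move=> xz; apply: eq_occurs => k kw; rewrite xz//; lia.
have [xw|xw] := boolP (occurs x i (v ++ a ++ s)); last first.
  rewrite (_ : _ `&` _ = set0) ?measure0; last first.
    rewrite -subset0 => z [xz /th_vas]; rewrite eqi//; exact/negP.
  rewrite (_ : _ `&` _ = set0) ?measure0//.
  by rewrite -subset0 => z [xz]; rewrite /cyl /= eqi//; exact/negP.
set N := size (v ++ a ++ s) in nN.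
pose P := word x (- n%:Z) (absz (i + n%:Z)).
pose S := word x (i + N%:Z) (absz (n%:Z + 1 - i - N%:Z)%R).
have PE : - n%:Z + (size P)%:Z = i by rewrite size_word; lia.
have SE : i + (size v)%:Z + (size a)%:Z + (size s)%:Z = i + N%:Z.
  by rewrite /N !size_cat; lia.
have winE : window n x = cyl (- n%:Z) (P ++ v ++ a ++ s ++ S).
  rewrite window_cyl; congr cyl; rewrite (_ : n.*2.+1 = absz (i + n%:Z)%R
    + (N + absz (n%:Z + 1 - i - N%:Z)%R))%N; last lia.
  rewrite word_cat -/P; congr cat; rewrite -(size_word x (- n%:Z) (absz (i + n%:Z))) -/P PE.
  have -> : word x i (N + absz (n%:Z + 1 - i - N%:Z)%R) = (v ++ a ++ s) ++ S.
    by rewrite word_cat; congr cat; apply/eqP.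
  by rewrite -!catA.
have -> : window n x `&` cyl i (v ++ a ++ s) = cyl (- n%:Z) (P ++ v ++ a ++ s ++ S).
  rewrite winE eqEsubset /cyl; split => z /=; first by case.
  by rewrite !occurs_cat PE => /and5P[-> -> -> -> ->].
have -> : th @^-1` window n x `&` cyl i (v ++ b ++ s) = cyl (- n%:Z) (P ++ v ++ b ++ s ++ S).
  rewrite winE eqEsubset /cyl; split => z /=; rewrite !occurs_cat !PE -?ab !SE.
    move=> [/and5P[zP zv _ zs zS] /and3P[-> -> ->]] /=.
    rewrite /th occurs_overwrite_out in zP; last lia.
    rewrite /th occurs_overwrite_out in zS; last lia.
    by rewrite zP zS.
  move=> /and5P[zP zv zb zs zS]; split; last by rewrite zv zb zs.
  rewrite occurs_overwrite /th !occurs_overwrite_out ?zP ?zv ?zs ?zS//; lia.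
(* Readability passes in both directions, so unreadable words are null on both sides. *)
have [r|nr] := boolP (readable (P ++ v ++ a ++ s ++ S)).
  have := @mu_cyl_exchange (- n%:Z) (P ++ v) a b (s ++ S).
  rewrite -!catA => -> //; rewrite ?size_cat; try lia.
  exact: readable_exchange r.
rewrite !mu_cyl_unreadable//; apply: contra nr; exact: readable_exchange.
Qed.

End exchange_measure.

#[local] Arguments zeros : simpl never.

Lemma occurs_zerosP (x : config letter) (a : int) n :
  reflect (forall b, a <= b < a + n%:Z -> x b = l0) (occurs x a (zeros n)).
Proof.
apply: (iffP (occursP _ _ _)); rewrite size_nseq => H.
  move=> b ab; have := H (absz (b - a)); rewrite nth_nseq.
  have -> : a + (absz (b - a))%:Z = b by [lia].
  by case: ltnP => [_|]; [apply|]; lia.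
by move=> k kn; rewrite nth_nseq kn; apply: H; lia.
Qed.

(** * Signals in the first coordinate *)

Section gap.
Variables (x : config letter) (l r a : int) (sig : letter).
Hypothesis hl : is_hat (x l).
Hypothesis hr : is_hat (x r).
Hypothesis lr : l + 41 < r.
Hypothesis la : l < a < r.
Hypothesis sigN : ~~ is_hat sig.
Hypothesis xgap : forall b, l < b < r -> x b = if b == a then sig else l0.

Lemma gap_nohat b : l < b < r -> ~~ is_hat (x b).
Proof. by move=> /xgap ->; case: ifP. Qed.

Lemma gap_l0 b : l < b < r -> b != a -> x b = l0.
Proof. by move=> /xgap -> /negbTE ->. Qed.

Lemma gap_hat b : l <= b <= r -> is_hat (x b) -> (b == l) || (b == r).
Proof.
move=> lbr; apply: contraTT; rewrite negb_or => /andP[bl br].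
by apply: gap_nohat; lia.
Qed.

Lemma hat_neq0 b : is_hat (x b) -> x b <> l0.
Proof. by move=> + xb; rewrite xb. Qed.

Lemma free_rightE k : l <= k < r -> free_right x k = minn 10 (absz (r - k - 1)%R).
Proof.
move=> lkr; apply: find_iotaP; first by lia.
  by move=> j jm; apply: gap_nohat; lia.
by move=> m10; rewrite (_ : k + _ = r)//; lia.
Qed.

Lemma free_leftE k : l < k <= r -> free_left x k = minn 10 (absz (k - l - 1)%R).
Proof.
move=> lkr; apply: find_iotaP; first by lia.
  by move=> j jm; apply: gap_nohat; lia.
by move=> m10; rewrite (_ : k - _ = l)//; lia.
Qed.

Lemma move_rightE k : l < k < r -> move_right x k = (sig == lR) && (k == a + 10).
Proof.
move=> lkr; rewrite /move_right free_rightE; last lia.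
rewrite occurs_cons.
have [kE|ka] := eqVneq k (a + 10); last first.
  rewrite andbF; apply/negbTE/negP => /andP[/eqP xR /occurs_zerosP z].
  have lk : l < k - 10.
    rewrite ltNge; apply/negP; rewrite le_eqVlt => /predU1P[kl|kl].
      by move: hl; rewrite -kl xR.
    by apply: (hat_neq0 hl); apply: z; lia.
  by move: xR; rewrite gap_l0//; lia.
rewrite kE in lkr *; rewrite addrK xgap// eqxx andbT; have [sE|//] := eqVneq sig lR; rewrite /=.
by apply/occurs_zerosP => b ab; apply: gap_l0; lia.
Qed.

Lemma move_leftE k : l < k < r -> move_left x k = (sig == lL) && (k == a - 10).
Proof.
move=> lkr; rewrite /move_left free_leftE; last lia.
rewrite cats1 occurs_rcons /zeros size_nseq -/(zeros _).
set m := minn _ _; have -> : k - m%:Z + (10 + m)%N%:Z = k + 10 by lia.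
have [kE|ka] := eqVneq k (a - 10); last first.
  rewrite andbF; apply/negbTE/negP => /andP[/occurs_zerosP z /eqP xL].
  have kr : k + 10 < r.
    rewrite ltNge; apply/negP; rewrite le_eqVlt => /predU1P[kr|kr].
      by move: hr; rewrite kr xL.
    by apply: (hat_neq0 hr); apply: z; lia.
  by move: xL; rewrite gap_l0//; lia.
rewrite kE subrK xgap// eqxx andbT andbC; have [sE|//] := eqVneq sig lL; rewrite /=.
by apply/occurs_zerosP => b ab; apply: gap_l0; lia.
Qed.

Lemma bounce_rightE k : l < k < r ->
  bounce_right x k = [&& sig == lL, a <= l + 10 & k == 2 * l + 11 - a].
Proof.
move=> lkr; apply/existsP/and3P.
  move=> [q /existsP[s /=]]; have := ltn_ord q => q10.
  rewrite occurs_cons occurs_cat occurs_cons /zeros size_nseq -/(zeros _) => /and4P[].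
  set e := k - _ - _ - _; have eE : e = k - 10 + q%:Z by rewrite /e; lia.
  move=> /eqP xe /occurs_zerosP z1 /eqP xL /occurs_zerosP z2.
  (* A hat read further left would place [l] on the signal or inside one of the two words of zeros;
     further right, only [r] is a hat, and it is out of reach. *)
  have el : e = l.
    have [el|el] : e < l \/ l <= e by lia.
      have [lL|lL] := eqVneq (e + 1 + q%:Z) l.
        by move: hl; rewrite -lL xL.
      have [lz|lz] : l < e + 1 + q%:Z \/ e + 1 + q%:Z < l by lia.
        by case: (hat_neq0 hl); apply: z1; lia.
      by case: (hat_neq0 hl); apply: z2; lia.
    have := @gap_hat e; rewrite xe => /(_ _ isT)/orP[]; lia.
  have La : e + 1 + q%:Z = a.
    by apply/eqP; apply: contraTT isT => ea; move: xL; rewrite gap_l0//; lia.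
  rewrite La xgap// eqxx in xL.
  by split; rewrite ?xL//; lia.
move=> [/eqP sL al /eqP kE].
have q10 : (absz (a - l - 1)%R < 10)%N by lia.
case xl: (x l) hl => [s|||] // _.
exists (Ordinal q10); apply/existsP; exists s => /=.
rewrite occurs_cons occurs_cat occurs_cons /zeros size_nseq -/(zeros _).
set e := k - _ - _ - _; have -> : e = l by rewrite /e; lia.
rewrite xl eqxx /=; apply/and3P; split.
- by apply/occurs_zerosP => b lb; apply: gap_l0; lia.
- by rewrite (_ : l + 1 + _ = a) ?xgap ?eqxx ?sL//; lia.
- by apply/occurs_zerosP => b lb; apply: gap_l0; lia.
Qed.

Lemma bounce_leftE k : l < k < r ->
  bounce_left x k = [&& sig == lR, r - 10 <= a & k == 2 * r - 11 - a].
Proof.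
move=> lkr; apply/existsP/and3P.
  move=> [q /existsP[s /=]]; have := ltn_ord q => q10.
  rewrite occurs_cat occurs_cons cats1 occurs_rcons /zeros !size_nseq -!/(zeros _) => /and4P[].
  set b := k - 10 + _; have bE : b = k + 9 - 2 * q%:Z by rewrite /b; lia.
  move=> /occurs_zerosP z1 /eqP xR /occurs_zerosP z2 /eqP xe.
  have er : b + 1 + q%:Z = r.
    have [er|er] : r < b + 1 + q%:Z \/ b + 1 + q%:Z <= r by lia.
      have [rb|rb] := eqVneq b r; first by move: hr; rewrite -rb xR.
      have [rz|rz] : b < r \/ r < b by lia.
        by case: (hat_neq0 hr); apply: z2; lia.
      by case: (hat_neq0 hr); apply: z1; lia.
    have := @gap_hat (b + 1 + q%:Z); rewrite xe => /(_ _ isT)/orP[]; lia.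
  have Ra : b = a.
    by apply/eqP; apply: contraTT isT => ea; move: xR; rewrite gap_l0//; lia.
  rewrite Ra xgap// eqxx in xR.
  by split; rewrite ?xR//; lia.
move=> [/eqP sR ar /eqP kE].
have q10 : (absz (r - a - 1)%R < 10)%N by lia.
case xr: (x r) hr => [s|||] // _.
exists (Ordinal q10); apply/existsP; exists s => /=.
rewrite occurs_cat occurs_cons cats1 occurs_rcons /zeros !size_nseq -!/(zeros _).
set b := k - 10 + _; have -> : b = a by rewrite /b; lia.
rewrite xgap// eqxx sR eqxx /=; apply/and3P; split.
- by apply/occurs_zerosP => c lc; apply: gap_l0; lia.
- by apply/occurs_zerosP => c lc; apply: gap_l0; lia.
- by rewrite (_ : a + 1 + _ = r) ?xr//; lia.
Qed.

Lemma hitE : hit x r = (sig == lR) && (r - 10 <= a).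
Proof.
apply/existsP/andP.
  move=> [q]; have := ltn_ord q => q10.
  rewrite occurs_cons cats1 occurs_rcons => /and3P[/eqP xR _ _].
  have Ra : r - q.+1%:Z = a.
    by apply/eqP; apply: contraTT isT => ea; move: xR; rewrite gap_l0//; lia.
  rewrite Ra xgap// eqxx in xR.
  by split; rewrite ?xR//; lia.
move=> [/eqP sR ar].
have q10 : (absz (r - a - 1)%R < 10)%N by lia.
exists (Ordinal q10); rewrite occurs_cons cats1 occurs_rcons /zeros size_nseq -/(zeros _) /=.
have -> : r - (absz (r - a - 1)%R).+1%:Z = a by [lia].
rewrite xgap// eqxx sR eqxx /=; apply/andP; split.
  by apply/occurs_zerosP => c lc; apply: gap_l0; lia.
by rewrite (_ : a + 1 + _ = r)//; lia.
Qed.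

End gap.

(** The number of hits on the right end by time [t]: a round trip covers 2g columns at speed 10,
    hence floor(10 t / 2g). *)
Definition bounces (g t : nat) : nat := ((5 * t) %/ g)%N.

(* The signal of a gap of length [g] moves by -10 on a circle of length [2 g]:
   the coordinate [y >= 1] stands for a letter L at [l + y] and [y <= 0] for a
   letter R at [l + 1 - y], where [l] is the left end of the gap. *)
Definition phase_coord (g t : nat) : int :=
  g%:Z - 10 * t%:Z + 2 * g%:Z * (bounces g t)%:Z.

Definition signal_letter (flag : bool) (g t : nat) : letter :=
  if flag then (if 1 <= phase_coord g t then lL else lR) else l0.

Definition signal_pos (l : int) (g t : nat) : int :=
  if 1 <= phase_coord g t then l + phase_coord g t else l + 1 - phase_coord g t.

Definition hat_letter (flag : bool) (g : nat) (c : letter) (t : nat) : letter :=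
  if c is lE s then (if flag then lE (iter (bounces g t) (@ordS 4) s) else c) else c.

Lemma bounces_bound g t : (0 < g)%N ->
  (g * bounces g t <= 5 * t < g * bounces g t + g)%N.
Proof.
move=> g0; rewrite /bounces; have := divn_eq (5 * t) g.
by have := ltn_pmod (5 * t) g0; rewrite mulnC; lia.
Qed.

Lemma phase_coord_bound g t : (0 < g)%N -> - g%:Z < phase_coord g t <= g%:Z.
Proof. by move=> /(bounces_bound t); rewrite /phase_coord; nia. Qed.

Lemma bouncesS g t : (170 <= g)%N ->
  bounces g t.+1 = (bounces g t + (phase_coord g t - 10 <= - g%:Z)%R)%N.
Proof.
move=> g170; have g0 : (0 < g)%N by lia.
have := bounces_bound t g0; have := bounces_bound t.+1 g0.
rewrite /phase_coord; set A := bounces g t.+1; set B := bounces g t.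
case: lerP => h /=; nia.
Qed.

Lemma phase_coordS g t : (170 <= g)%N -> phase_coord g t.+1 =
  if phase_coord g t - 10 <= - g%:Z then phase_coord g t - 10 + 2 * g%:Z
  else phase_coord g t - 10.
Proof.
move=> g170; rewrite {1}/phase_coord bouncesS// /phase_coord.
by case: lerP => _; lia.
Qed.

Definition consec (z : config letter) (l r : int) : Prop :=
  [/\ l < r, is_hat (z l), is_hat (z r) & forall k, l < k < r -> ~~ is_hat (z k)].

Definition orbit1 (t : nat) (z : config letter) : config letter := iter t F3_fst z.

Lemma orbit_phase1 t z : (orbit_phase t z).1 = orbit1 t z.
Proof. by elim: t => //= t <-. Qed.

Lemma is_hat_F3 x i : is_hat (F3_fst x i) = is_hat (x i).
Proof.
rewrite /F3_fst; case: (x i) => [s|||]; first by case: ifP.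
all: by case: ifP => // _; case: ifP.
Qed.

Lemma is_hat_orbit1 t z i : is_hat (orbit1 t z i) = is_hat (z i).
Proof. by elim: t => //= t <-; rewrite is_hat_F3. Qed.

Lemma consec_gap z l r : S1 z -> consec z l r -> l + 171 <= r.
Proof.
move=> zS [lr zl zr _]; rewrite leNgt; apply/negP => rl.
have := S1_zeros zS zl (j := absz (r - l - 1)%R).
rewrite (_ : l + 1 + _ = r); last lia.
by move=> /(_ ltac:(lia)) z0; rewrite z0 in zr.
Qed.

Lemma S1_gap z l r k : S1 z -> consec z l r -> l < k < r ->
  z k = if k == r - 1 then z (r - 1) else l0.
Proof.
move=> zS [lr zl zr nh] lkr; case: eqVneq => [->//|kr].
have := nh _ lkr; case zk: (z k) => [s|||] // _.
  have [_ _ + _ _] := zS k; move=> /(_ zk) h.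
  by have := nh (k + 1); rewrite h; lia.
by have [+ _ _ _ _] := zS k; rewrite zk eqxx.
Qed.

#[local] Lemma LR : (lL == lR) = false. Proof. exact/eqP. Qed.
#[local] Lemma RL : (lR == lL) = false. Proof. exact/eqP. Qed.
#[local] Lemma LL : (lL == lL) = true. Proof. exact/eqP. Qed.
#[local] Lemma RR : (lR == lR) = true. Proof. exact/eqP. Qed.

#[local] Lemma L0 : (l0 == lL) = false. Proof. exact/eqP. Qed.
#[local] Lemma R0 : (l0 == lR) = false. Proof. exact/eqP. Qed.

(** The four moving rules are a single rotation y -> y - 10 of the circle: bouncing on the left is
    the passage from y >= 1 to y <= 0, bouncing on the right is the wrap at -g. *)
Lemma gap_update (l g y b : int) : 170 <= g -> - g < y <= g -> l < b < l + 1 + g ->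
  let s := if 1 <= y then lL else lR in
  let a := if 1 <= y then l + y else l + 1 - y in
  let y' := if y - 10 <= - g then y - 10 + 2 * g else y - 10 in
  (if (s == lR) && (b == a + 10) || [&& s == lL, a <= l + 10 & b == 2 * l + 11 - a] then lR
   else if (s == lL) && (b == a - 10) ||
      [&& s == lR, l + 1 + g - 10 <= a & b == 2 * (l + 1 + g) - 11 - a] then lL
   else l0) =
  (if b == (if 1 <= y' then l + y' else l + 1 - y')
   then (if 1 <= y' then lL else lR) else l0).
Proof.
move=> g170 yb lb /=; have [y1|y1] := lerP 1 y; rewrite ?LR ?LL ?RL ?RR /=.
  have -> : (y - 10 <= - g) = false by lia.
  rewrite orbF; have [y2|y2] := lerP 1 (y - 10).
    have -> : (l + y <= l + 10) = false by lia.
    by rewrite /= addrA.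
  have -> : (l + y <= l + 10) = true by lia.
  have -> : (b == l + y - 10) = false by lia.
  by have -> : (b == l + 1 - (y - 10)) = (b == 2 * l + 11 - (l + y)) by lia.
rewrite orbF; have [yg|yg] := lerP (y - 10) (- g).
  have -> : (1 <= y - 10 + 2 * g) = true by lia.
  have -> : (b == l + 1 - y + 10) = false by lia.
  have -> : (l + 1 + g - 10 <= l + 1 - y) = true by lia.
  by have -> : (b == l + (y - 10 + 2 * g)) = (b == 2 * (l + 1 + g) - 11 - (l + 1 - y)) by lia.
have -> : (1 <= y - 10) = false by lia.
have -> : (l + 1 + g - 10 <= l + 1 - y) = false by lia.
by have -> : (b == l + 1 - (y - 10)) = (b == l + 1 - y + 10) by lia.
Qed.

Section trajectory.
Variables (z : config letter) (l r : int).
Hypothesis zS : S1 z.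
Hypothesis lr : consec z l r.
Let g := absz (r - l - 1)%R.
Let flag := z (r - 1) == lL.

Let lr171 : l + 171 <= r. Proof. exact: consec_gap lr. Qed.
Let rE : r = l + 1 + g%:Z. Proof. rewrite /g; lia. Qed.
Let g170 : (170 <= g)%N. Proof. rewrite /g; lia. Qed.
Let zl : is_hat (z l). Proof. by case: lr. Qed.
Let zr : is_hat (z r). Proof. by case: lr. Qed.

Lemma signal_pos_in t : l < signal_pos l g t < r.
Proof.
have g0 : (0 < g)%N by lia.
by have := phase_coord_bound t g0; rewrite rE /signal_pos; case: (lerP 1 (phase_coord g t)); lia.
Qed.

(** Hats never move, and a gap together with the hat at its right end evolves independently of
    everything else. In [S1] the signal, if any, starts as an L just left of that hat, that is at y
    = g. *)
Lemma orbit1_gap t : (forall b, l < b < r -> orbit1 t z b =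
    if b == signal_pos l g t then signal_letter flag g t else l0) /\
  orbit1 t z r = hat_letter flag g (z r) t.
Proof.
elim: t => [|t [IHb IHr]].
  have b0 : bounces g 0 = 0%N by rewrite /bounces muln0 div0n.
  have y0 : phase_coord g 0 = g%:Z by rewrite /phase_coord b0; lia.
  split=> [b lb|]; last by rewrite /hat_letter b0 /=; case: (z r) => // s; case: ifP.
  have y1 : 1 <= g%:Z by lia.
  rewrite /= (S1_gap zS lr lb) /signal_letter /signal_pos y0 y1.
  rewrite (_ : l + g%:Z = r - 1); last lia.
  case: eqP => // _; rewrite /flag; case: eqP => // zL.
  case zE: (z (r - 1)) zL => [s|||] //; last by have [+ _ _ _ _] := zS (r - 1); rewrite zE eqxx.
  by case: lr => _ _ _ /(_ (r - 1)); rewrite zE => /(_ ltac:(lia)).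
have hl : is_hat (orbit1 t z l) by rewrite is_hat_orbit1.
have hr : is_hat (orbit1 t z r) by rewrite is_hat_orbit1.
have lr41 : l + 41 < r by lia.
have la := signal_pos_in t.
have sN : ~~ is_hat (signal_letter flag g t).
  by rewrite /signal_letter; case: ifP => // _; case: ifP.
have nh := gap_nohat sN IHb.
have g0 : (0 < g)%N by lia.
have yb := phase_coord_bound t g0; have yS := @phase_coordS g t g170.
split=> [b lb|].
  rewrite /orbit1 iterS -/(orbit1 t z) /F3_fst.
  have gz : (170 <= g%:Z) by lia.
  have lbg : l < b < l + 1 + g%:Z by rewrite -rE.
  have gu := gap_update gz yb lbg.
  have FE : (if (signal_letter flag g t == lR) && (b == signal_pos l g t + 10) ||
      [&& signal_letter flag g t == lL, signal_pos l g t <= l + 10 &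
        b == 2 * l + 11 - signal_pos l g t] then lR
    else if (signal_letter flag g t == lL) && (b == signal_pos l g t - 10) ||
      [&& signal_letter flag g t == lR, r - 10 <= signal_pos l g t &
        b == 2 * r - 11 - signal_pos l g t] then lL else l0) =
    (if b == signal_pos l g t.+1 then signal_letter flag g t.+1 else l0).
    rewrite /signal_letter /signal_pos yS rE; case: (flag); first exact: gu.
    by rewrite !L0 !R0 if_same.
  rewrite (move_rightE hl hr lr41 la sN IHb lb) (move_leftE hl hr lr41 la sN IHb lb)
    (bounce_rightE hl hr lr41 la sN IHb lb) (bounce_leftE hl hr lr41 la sN IHb lb) FE.
  by have := nh b lb; case: (orbit1 t z b).
rewrite /orbit1 iterS -/(orbit1 t z) {1}/F3_fst IHr (hitE hl hr lr41 la sN IHb).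
rewrite /hat_letter bouncesS// /signal_letter /signal_pos.
case: (z r) zr => [s|||] // _; case: (flag).
set y := phase_coord g t in yb *.
have [y1|y1] := lerP 1 y; rewrite ?LR ?RR /=.
  by rewrite (_ : (y - 10 <= - g%:Z) = false) ?addn0//; lia.
have -> : (r - 10 <= l + 1 - y) = (y - 10 <= - g%:Z) by lia.
  by case: ifP => _; rewrite ?addn1 ?addn0.
by rewrite R0.
Qed.

End trajectory.

(** * Hot letters and their periods *)

Definition hot (z : config letter) (e : int) (t : nat) : bool :=
  orbit1 t z e == lE ord0.

Lemma hot_hat z e t : hot z e t -> is_hat (z e).
Proof. by move=> /eqP h; rewrite -(is_hat_orbit1 t) h. Qed.

Lemma val_iter_ordS n (s : 'I_4) : iter n (@ordS 4) s = ((s + n) %% 4)%N :> nat.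
Proof.
elim: n => [|n IHn]; first by rewrite addn0 modn_small.
by rewrite iterS /= IHn -addn1 modnDml addn1 addnS.
Qed.

Lemma bounces_period g t k : (0 < g)%N -> bounces g (t + g * k) = (bounces g t + 5 * k)%N.
Proof.
move=> g0; rewrite /bounces (_ : 5 * (t + g * k) = 5 * k * g + 5 * t)%N; last lia.
by rewrite divnMDl// addnC.
Qed.

Section hats.
Variables (z : config letter) (l e : int).
Hypothesis zS : S1 z.
Hypothesis le : consec z l e.
Let g := absz (e - l - 1)%R.
Let g170 : (170 <= g)%N. Proof. have := consec_gap zS le; rewrite /g; lia. Qed.
Let g0 : (0 < g)%N. Proof. lia. Qed.

(** Without an L before it, a hat is not E_0 initially by [S1], and no signal ever changes it. *)
Lemma hotE t : exists s : 'I_4, z e = lE s /\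
  hot z e t = (z (e - 1) == lL) && ((s + bounces g t) %% 4 == 0)%N.
Proof.
have [_ _ ze _] := le; case zeE: (z e) ze => [s|||] // _; exists s; split => //.
rewrite /hot; have [_ ->] := orbit1_gap zS le t; rewrite -/g zeE /hat_letter.
have [zL|zL] := eqVneq (z (e - 1)) lL.
  apply/eqP/eqP => [[/(congr1 val)]|h]; first by rewrite /= val_iter_ordS.
  by congr lE; apply: val_inj; rewrite /= val_iter_ordS.
apply/eqP => -[s0]; have [_ _ _ + _] := zS e; rewrite zeE s0 => /(_ erefl) zL'.
by rewrite zL' eqxx in zL.
Qed.

(** The delay is g/5 rounded up: it brings one or two hits, whereas a return to E_0 takes four. *)
Lemma hot_off t : hot z e t -> ~~ hot z e (t + (g + 4) %/ 5)%N.
Proof.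
have [s [zes ->]] := hotE t; have [s' [zes' ->]] := hotE (t + (g + 4) %/ 5).
move: zes'; rewrite zes => -[<-] /andP[-> /eqP h] /=.
have bt := bounces_bound t g0; have bT := bounces_bound (t + (g + 4) %/ 5) g0.
have gT : (g <= 5 * ((g + 4) %/ 5) <= g + 4)%N.
  by have := divn_eq (g + 4) 5; have := ltn_pmod (g + 4) (isT : (0 < 5)%N); lia.
have : (bounces g (t + (g + 4) %/ 5) = bounces g t + 1 \/
  bounces g (t + (g + 4) %/ 5) = bounces g t + 2)%N.
  by move: bt bT; move: (bounces g t) (bounces g _) => A B; nia.
by case=> ->; lia.
Qed.

Lemma orbit1_period P t b : (4 * g %| P)%N -> l < b <= e ->
  orbit1 (t + P) z b = orbit1 t z b.
Proof.
move=> /dvdnP[k ->] lbe.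
have bE : bounces g (t + k * (4 * g)) = (bounces g t + 20 * k)%N.
  by rewrite (_ : k * (4 * g) = g * (4 * k))%N ?bounces_period//; lia.
have yE : phase_coord g (t + k * (4 * g)) = phase_coord g t.
  by rewrite /phase_coord bE; nia.
have [Ab Ae] := orbit1_gap zS le (t + k * (4 * g)).
have [Bb Be] := orbit1_gap zS le t.
have [->|be] := eqVneq b e.
  rewrite Ae Be -/g /hat_letter; case: (z e) => // s; case: ifP => // _.
  by congr lE; apply: val_inj; rewrite /= !val_iter_ordS bE; lia.
rewrite Ab ?Bb; try lia.
by rewrite -/g /signal_pos /signal_letter yE.
Qed.

Lemma orbit1_same z' t b : S1 z' -> consec z' l e -> z' (e - 1) = z (e - 1) ->
  z' e = z e -> l < b <= e -> orbit1 t z' b = orbit1 t z b.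
Proof.
move=> z'S le' z1 ze lbe.
have [Ab Ae] := orbit1_gap zS le t; have [Bb Be] := orbit1_gap z'S le' t.
have [->|be] := eqVneq b e; first by rewrite Ae Be z1 ze.
by rewrite Ab ?Bb ?z1//; lia.
Qed.

Lemma hot_giant T t : z (e - 1) = lL -> z e = lE ord0 -> g = (5 * T)%N ->
  hot z e t = ((t %/ T) %% 4 == 0)%N.
Proof.
move=> zL ze gT; have [s [+ ->]] := hotE t; rewrite ze => -[<-].
rewrite zL eqxx add0n /bounces gT divnMl//.
Qed.

End hats.

(** * Ones in the second coordinate *)

Section second_coordinate.
Variable z : config letter.
Hypothesis zS : S1 z.

Definition alight (t : nat) (j : int) : bool := (orbit_phase t z).2 j.

Lemma alightS t j : alight t.+1 j =
  [&& alight t (j - 3), alight t (j - 2) & alight t (j - 1)] ||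
  [|| hot z j t, hot z (j - 1) t | hot z (j - 2) t].
Proof. by rewrite /alight /orbit_phase iterS F_e_snd /hot -!orbit_phase1. Qed.

(* Times are integers, with nothing alight at nonpositive times. *)
Definition lit (s j : int) : bool := (0 <= s) && alight (absz s) j.
Definition hotz (e s : int) : bool := (0 <= s) && hot z e (absz s).

Lemma lit_gt0 s j : lit s j -> 0 < s.
Proof.
by rewrite /lit; case: s => [[|n]|n].
Qed.

Lemma lit_back s j : lit s j ->
  (hotz j (s - 1) || hotz (j - 1) (s - 1) || hotz (j - 2) (s - 1)) \/
  [/\ lit (s - 1) (j - 1), lit (s - 1) (j - 2) & lit (s - 1) (j - 3)].
Proof.
move=> sj; have s0 := lit_gt0 sj; move: sj; rewrite /lit /hotz.
have -> : absz s = (absz (s - 1)%R).+1 by lia.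
have -> : 0 <= s by lia.
have -> : 0 <= s - 1 by lia.
by rewrite /= alightS => /orP[/and3P[-> -> ->]|]; [right|left; rewrite -orbA].
Qed.

Lemma hotz_hat e s : hotz e s -> is_hat (z e).
Proof. by move=> /andP[_ /hot_hat]. Qed.

Lemma lit_nohat s j : lit s j -> (forall e, j - 2 <= e <= j -> ~~ is_hat (z e)) ->
  [/\ lit (s - 1) (j - 1), lit (s - 1) (j - 2) & lit (s - 1) (j - 3)].
Proof.
move=> /lit_back[|//] h nh; exfalso; move: h => /orP[/orP[]|] /hotz_hat; apply/negP/nh; lia.
Qed.

(** Away from hats all three columns behind a one are alight one step earlier, so each backward step
    may be chosen freely in 1, 2, 3. *)
Lemma lit_travel (k : nat) s j (D : int) : lit s j ->
  (forall e, j - D - 1 <= e <= j -> ~~ is_hat (z e)) ->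
  D <= 3 * k%:Z -> k%:Z <= D -> lit (s - k%:Z) (j - D).
Proof.
elim: k s j D => [|k IHk] s j D sj nh Dk kD.
  have -> : s - 0%N%:Z = s by exact: subr0.
  by have -> : D = 0 by [lia]; rewrite subr0.
have [|l1 l2 l3] := lit_nohat sj; first by move=> e je; apply: nh; lia.
have step d : 1 <= d <= 3 -> lit (s - 1) (j - d) -> D - d <= 3 * k%:Z -> k%:Z <= D - d ->
    lit (s - k.+1%:Z) (j - D).
  move=> d13 ld Ddk kDd; have := IHk _ _ (D - d) ld.
  rewrite (_ : s - 1 - k%:Z = s - k.+1%:Z); last lia.
  rewrite (_ : j - d - (D - d) = j - D); last lia.
  by apply => // e je; apply: nh; lia.
have [D1|D1] := lerP D (3 * k%:Z + 1); first by apply: (step 1) => //; lia.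
have [D2|D2] := lerP D (3 * k%:Z + 2); first by apply: (step 2) => //; lia.
by apply: (step 3) => //; lia.
Qed.

(** Column [e + 3] is the first one that the hat does not light directly: a one there needs a one at
    [e], which, the hat not being hot, needs one at [e - 1]. All other hats are at least 171 columns
    away. *)
Lemma lit_cross e s : is_hat (z e) -> lit s (e + 3) -> ~~ hotz e (s - 2) ->
  lit (s - 2) (e - 1).
Proof.
move=> ze sl off.
have nh k : 0 < k <= 170 -> ~~ is_hat (z (e + k)).
  move=> k170; have := S1_zeros zS ze (j := absz (k - 1)%R).
  by rewrite (_ : e + 1 + _ = e + k); [move=> -> //; lia|lia].
have nh' k : 0 < k <= 170 -> ~~ is_hat (z (e - k)).
  move=> k170; apply/negP => zk; have := S1_zeros zS zk (j := absz (k - 1)%R).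
  by rewrite (_ : e - k + 1 + _ = e); [move=> ze0; rewrite ze0 ?ze0 in ze; [|lia]|lia].
have [|_ _ l3] := lit_nohat sl.
  by move=> d de; have := nh (d - e); rewrite (_ : e + (d - e) = d); [apply; lia|lia].
rewrite (_ : e + 3 - 3 = e) in l3; last lia.
have [h|[l1 _ _]] := lit_back l3; last by rewrite (_ : s - 2 = s - 1 - 1)//; lia.
exfalso; move: h off; rewrite (_ : s - 1 - 1 = s - 2); last lia.
case: hotz => //= /orP[] /hotz_hat zh _; move: zh; apply/negP; apply: nh'; lia.
Qed.

(* Crossing the gap costs [2 T <= 2 g / 5] of the duration of the run; the freedom
   to choose the speed between 1 and 3 gives back [2 g / 3]. *)
Lemma lit_pass e' e (T : nat) (al be : int) : consec z e' e ->
  let g := e - e' - 1 in let c := (absz (g - 1)%R %/ 3)%N in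
  (forall s, al <= s <= be -> lit s (e + 3)) ->
  al + T%:Z <= be -> (5 * T%:Z <= g + 4) ->
  (forall s, al <= s -> s + T%:Z <= be -> ~~ hotz e (s - 2) || ~~ hotz e (s + T%:Z - 2)) ->
  forall s, al + T%:Z - (g - 1) <= s <= be - T%:Z - 2 - c%:Z -> lit s (e' + 3).
Proof.
move=> ee' g c lite albe Tg offT s' s'b.
have [e'e ze' ze nh] := ee'; have g170 := consec_gap zS ee'.
have cE : g - 3 <= 3 * c%:Z /\ 3 * c%:Z <= g - 1.
  by rewrite /c; have := divn_eq (absz (g - 1)%R) 3;
    have := ltn_pmod (absz (g - 1)%R) (isT : (0 < 3)%N); rewrite /g; lia.
(* The times from which [s'] is reached at a speed between 1 and 3 span more than [T], so both [lo]
   and [lo + T] qualify, and the hat is off for one of them. *)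
have [s [sal [ss off]]] : exists s, al <= s <= be /\ s' + 2 + c%:Z <= s <= s' + g - 1 /\
    ~~ hotz e (s - 2).
  pose lo := Num.max al (s' + 2 + c%:Z).
  have lo1 : al <= lo by rewrite le_max lexx.
  have lo2 : s' + 2 + c%:Z <= lo by rewrite le_max lexx orbT.
  have lo3 : lo + T%:Z <= be /\ lo + T%:Z <= s' + g - 1.
    by rewrite /lo; case: (lerP al (s' + 2 + c%:Z)) => h; lia.
  have /orP[off|off] := offT lo lo1 lo3.1; first by exists lo; lia.
  by exists (lo + T%:Z); lia.
have lc := lit_cross ze (lite _ sal) off.
have := @lit_travel (absz (s - 2 - s')%R) _ _ (g - 3) lc.
rewrite (_ : e - 1 - (g - 3) = e' + 3); last by rewrite /g; lia.
rewrite (_ : s - 2 - (absz (s - 2 - s')%R)%:Z = s'); last lia.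
by apply; [move=> d ed; apply: nh; rewrite /g in ed; lia|lia|lia].
Qed.

Lemma hotz_off e' e s : consec z e' e ->
  ~~ hotz e s || ~~ hotz e (s + ((absz (e - e' - 1)%R + 4) %/ 5)%N%:Z).
Proof.
move=> ee'; case hs: (hotz e s) => //=; case/andP: hs => s0 hs.
have := hot_off zS ee' hs; apply: contra => /andP[_].
by set T := (_ %/ 5)%N; rewrite (_ : absz (s + T%:Z)%R = (absz s + T)%N)//; lia.
Qed.

Lemma hot_time_bound (g : int) : 0 <= g -> 5 * ((absz g + 4) %/ 5)%N%:Z <= g + 4.
Proof. by move=> g0; have := divn_eq (absz g + 4) 5; lia. Qed.

Hypothesis left_hat : forall j, exists2 e', e' <= j & is_hat (z e') /\
  forall k, e' < k <= j -> ~~ is_hat (z k).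

Lemma consec_left e : is_hat (z e) -> exists e', consec z e' e.
Proof.
move=> ze; have [e' e'e [ze' nh]] := left_hat (e - 1); exists e'; split => //; first lia.
by move=> k ke; apply: nh; lia.
Qed.

Section escape.
Variables (j0 t0 : int).
Hypothesis barrier_hat : is_hat (z (j0 + 1)).
Hypothesis shadow : forall e' e, consec z e' e -> e <= j0 ->
  9 * (e - e' - 1) <= 10 * (j0 - e) \/
  (forall s, t0 - (j0 - e) - 10 <= s <= t0 -> ~~ hotz e s).

(* Backwards in time, the lit intervals at successive hats last at least 0.235
   times the distance covered and move towards negative times. *)
Lemma escape_descent (N : nat) e' e (al be : int) : consec z e' e -> e <= j0 ->
  be < N%:Z -> al <= be -> be <= t0 -> t0 - (j0 - e) + 3 <= al ->
  235 * (j0 - e) <= 1000 * (be - al) -> 170 <= j0 - e ->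
  (forall s, al <= s <= be -> lit s (e + 3)) -> False.
Proof.
elim: N e' e al be => [|N IHN] e' e al be ee' ej beN albe bet al_t len j170 lite.
  by have := lit_gt0 (lite be ltac:(lia)); lia.
have be0 := lit_gt0 (lite be ltac:(lia)).
have [_ ze' _ _] := ee'; have [e'' ee''] := consec_left ze'.
have g170 := consec_gap zS ee'.
pose c := (absz (e - e' - 1 - 1)%R %/ 3)%N.
have cE : 3 * c%:Z <= e - e' - 2.
  by rewrite /c; have := divn_eq (absz (e - e' - 1 - 1)%R) 3; lia.
(* Crossing a gap g gains g - g/3 - 2g/5 = 4g/15 up to rounding; 0.235 lies below 4/15 by enough for
   g >= 170. The run is long enough to cross because g/5 is at most 2/9 of [j0 - e], and 2/9 <
   0.235. A hat that is off during all the relevant times costs nothing, whatever its gap, hence T =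
   0. *)
have [T [TT albT Tlen offT]] : exists T : nat, [/\ 5 * T%:Z <= e - e' - 1 + 4, al + T%:Z <= be,
   235 * (e - e') <= 1000 * (e - e' - 4 - c%:Z - 2 * T%:Z) &
   forall s, al <= s -> s + T%:Z <= be -> ~~ hotz e (s - 2) || ~~ hotz e (s + T%:Z - 2)].
  have [sh|off] := shadow ee' ej.
    exists ((absz (e - e' - 1)%R + 4) %/ 5)%N; set T := (_ %/ 5)%N.
    have TT := @hot_time_bound (e - e' - 1); rewrite -/T /= in TT.
    split; [lia|lia|lia|] => s _ _; have := hotz_off (s - 2) ee'; rewrite -/T.
    by have -> : s - 2 + T%:Z = s + T%:Z - 2 by lia.
  exists 0%N; split; [lia|lia|lia|] => s als sbe; rewrite off//; lia.
have lite' := lit_pass ee' lite albT TT offT.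
apply: (IHN e'' e' _ _ ee'' _ _ _ _ _ _ _ lite'); lia.
Qed.

(** The stretch just left of [j0] contains no hat for 169 columns or more, and the choice of speeds
    alone spreads the single one at [j0] into a run of about 2D/3 at the next hat, which starts the
    descent. *)
Lemma escape : ~~ lit t0 j0.
Proof.
apply/negP => l0.
have [e' eb] := consec_left barrier_hat; have [_ ze' _ nh] := eb.
have g170 := consec_gap zS eb; have [e'' ee''] := consec_left ze'.
pose D := j0 - e' - 3; pose c := (absz (D + 2)%R %/ 3)%N.
have cE : D <= 3 * c%:Z /\ 3 * c%:Z <= D + 2.
  by rewrite /c; have := divn_eq (absz (D + 2)%R) 3;
    have := ltn_pmod (absz (D + 2)%R) (isT : (0 < 3)%N); rewrite /D; lia.
apply: (@escape_descent (absz t0).+1 e'' e' (t0 - D) (t0 - c%:Z) ee''); rewrite /D in cE *; try lia.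
move=> s st; have := @lit_travel (absz (t0 - s)%R) _ _ D l0.
rewrite (_ : j0 - D = e' + 3); last by rewrite /D; lia.
rewrite (_ : t0 - (absz (t0 - s)%R)%:Z = s); last lia.
by apply; rewrite /D; [move=> k kj; apply: nh; lia|lia|lia].
Qed.
End escape.

Section no_run.
Variables (j0 : int) (T : nat).
Hypothesis barrier_hat : is_hat (z (j0 + 1)).
Hypothesis barrier : forall s, ~~ lit s j0.

(** Each crossing lengthens the run, so it stays long enough for all gaps down to the hat [j0 + 1],
    and crossing that one would light [j0]. *)
Lemma no_run_descent (N : nat) e (al be : int) : is_hat (z e) -> j0 < e ->
  e <= j0 + N%:Z -> al + T%:Z <= be ->
  (forall e' d, consec z e' d -> j0 < d <= e -> d - e' - 1 <= 5 * T%:Z) ->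
  (forall s, al <= s <= be -> lit s (e + 3)) -> False.
Proof.
elim: N e al be => [|N IHN] e al be ze je eN albe gT lite; first lia.
have [e' ee'] := consec_left ze; have [_ ze' _ _] := ee'.
have g170 := consec_gap zS ee'.
set T' := ((absz (e - e' - 1)%R + 4) %/ 5)%N.
have TT := @hot_time_bound (e - e' - 1); rewrite -/T' /= in TT.
have T'T : T'%:Z <= T%:Z by have := gT _ _ ee'; lia.
have [ej|ej] := eqVneq e (j0 + 1).
  have /orP[off|off] := hotz_off (al - 2) ee'.
    have := lit_cross ze (lite al ltac:(lia)) off.
    by rewrite ej (_ : j0 + 1 - 1 = j0) ?(negbTE (barrier _))//; lia.
  rewrite -/T' (_ : al - 2 + T'%:Z = al + T'%:Z - 2) in off; last lia.
  have := lit_cross ze (lite (al + T'%:Z) ltac:(lia)) off.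
  by rewrite ej (_ : j0 + 1 - 1 = j0) ?(negbTE (barrier _))//; lia.
pose c := (absz (e - e' - 1 - 1)%R %/ 3)%N.
have cE : 3 * c%:Z <= e - e' - 2.
  by rewrite /c; have := divn_eq (absz (e - e' - 1 - 1)%R) 3; lia.
have je' : j0 < e'.
  rewrite ltNge; apply/negP => e'j; have [_ _ _ nh] := ee'.
  by have := nh (j0 + 1); rewrite barrier_hat => /(_ ltac:(lia)).
have albT' : al + T'%:Z <= be by lia.
have offT s : al <= s -> s + T'%:Z <= be -> ~~ hotz e (s - 2) || ~~ hotz e (s + T'%:Z - 2).
  move=> _ _; have := hotz_off (s - 2) ee'; rewrite -/T'.
  by have -> : s - 2 + T'%:Z = s + T'%:Z - 2 by lia.
have lite' := lit_pass ee' lite albT' (TT ltac:(lia)) offT.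
apply: (IHN e' _ _ ze' _ _ _ _ lite'); [lia|lia|lia|].
by move=> d' d dd je''; apply: gT dd _; lia.
Qed.

Lemma no_run e j (al : int) : is_hat (z e) -> j0 < e -> e + 3 <= j ->
  (forall k, e < k <= j -> ~~ is_hat (z k)) ->
  (forall e' d, consec z e' d -> j0 < d <= e -> d - e' - 1 <= 5 * T%:Z) ->
  exists2 s, al <= s <= al + T%:Z & ~~ lit s j.
Proof.
move=> ze je ej nh gT; apply: contrapT => nolit.
have litj s : al <= s <= al + T%:Z -> lit s j.
  by move=> sa; apply: contrapT => /negP ns; apply: nolit; exists s.
pose D := j - e - 3.
apply: (@no_run_descent (absz (e - j0)%R) e (al - D) (al - D + T%:Z)) => //; try lia.
move=> s sa; have := @lit_travel (absz D) _ _ D (litj (s + D) _).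
rewrite (_ : j - D = e + 3); last by rewrite /D; lia.
rewrite (_ : s + D - (absz D)%:Z = s); last by rewrite /D in sa *; lia.
by apply; rewrite /D; [lia|move=> k kj; apply: nh; lia|lia|lia].
Qed.
End no_run.

End second_coordinate.

(** A column needs all three columns to its left: its lit period starts one step after that of the
    nearest and ends one step after that of the farthest. So the front moves at speed 1, the tail at
    speed 3. *)
Lemma alight_forward z e s0 s1 (q t : nat) :
  (forall s, (s0 <= s < s1)%N -> hot z e s) ->
  (s0 + q < t)%N -> (t <= s1 + q %/ 3)%N -> alight z t (e + q%:Z).
Proof.
move=> hots; elim/ltn_ind: q t => q IHq [|t] // tq qt.
rewrite alightS; have [q3|q3] := ltnP q 3.
  have ht : hot z e t by apply: hots; move: tq qt; rewrite (divn_small q3); lia.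
  apply/orP; right; case: q q3 {IHq tq qt} => [|[|[|//]]] _.
  - by rewrite (_ : e + 0%N%:Z = e) ?ht//; lia.
  - by rewrite (_ : e + 1%N%:Z - 1 = e) ?ht ?orbT//; lia.
  - by rewrite (_ : e + 2%N%:Z - 2 = e) ?ht ?orbT//; lia.
apply/orP; left.
have q1 := divn_eq q 3; have q2 := ltn_pmod q (isT : (0 < 3)%N).
have step d : (0 < d <= 3)%N -> alight z t (e + q%:Z - d%:Z).
  move=> d3; rewrite (_ : e + q%:Z - d%:Z = e + (q - d)%N%:Z); last lia.
  have q4 := divn_eq (q - d) 3; have q5 := ltn_pmod (q - d) (isT : (0 < 3)%N).
  by apply: IHq; lia.
by apply/and3P; split; [apply: (step 3)|apply: (step 2)|apply: (step 1)].
Qed.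

(** A dark column screens off everything to its left: a triple of columns reaching [j0] or beyond
    contains [j0] itself, and [j0] dark one step later means that the letters at [j0] and [j0 - 1]
    are not hot. *)
Lemma alight_flush z z' (t t' D : nat) j0 :
  (D <= t)%N -> (D <= t')%N ->
  (forall d, (d <= D)%N -> ~~ alight z (t - d) j0 /\ ~~ alight z' (t' - d) j0) ->
  (forall e d, j0 < e <= j0 + D%:Z -> (0 < d <= D)%N ->
    hot z e (t - d) = hot z' e (t' - d)) ->
  forall k d, (k + d <= D)%N -> alight z (t - d) (j0 + k%:Z) = alight z' (t' - d) (j0 + k%:Z).
Proof.
move=> Dt Dt' unlit same; elim/ltn_ind => k IHk d kD.
have [u u'] := unlit d ltac:(lia).
have [k0|k0] := posnP k.
  by rewrite k0 (_ : j0 + 0%N%:Z = j0) ?(negbTE u) ?(negbTE u')//; lia.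
have tE : (t - d)%N = (t - d.+1).+1 by lia.
have tE' : (t' - d)%N = (t' - d.+1).+1 by lia.
move: u u'; rewrite tE tE' !alightS => /norP[_ /norP[h0 /norP[h1 _]]].
move=> /norP[_ /norP[h0' /norP[h1' _]]].
have hE i : (i <= 2)%N ->
    hot z (j0 + k%:Z - i%:Z) (t - d.+1) = hot z' (j0 + k%:Z - i%:Z) (t' - d.+1).
  move=> i2; have [ki|ki] := ltnP i k; first by apply: same; lia.
  have [->|->] : j0 + k%:Z - i%:Z = j0 \/ j0 + k%:Z - i%:Z = j0 - 1 by lia.
    by rewrite (negbTE h0) (negbTE h0').
  by rewrite (negbTE h1) (negbTE h1').
have h2 := hE 0%N isT; rewrite (_ : j0 + k%:Z - 0%N%:Z = j0 + k%:Z) in h2; last lia.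
rewrite (hE 1%N isT) (hE 2%N isT) h2; congr (_ || _).
have oE i : (0 < i <= 3)%N -> (i <= k)%N ->
    alight z (t - d.+1) (j0 + k%:Z - i%:Z) = alight z' (t' - d.+1) (j0 + k%:Z - i%:Z).
  move=> i3 ik; rewrite (_ : j0 + k%:Z - i%:Z = j0 + (k - i)%N%:Z); last lia.
  by apply: IHk; lia.
have [k3|k3] := leqP k 3; last by rewrite (oE 3%N) ?(oE 2%N) ?(oE 1%N)//; lia.
have [v v'] := unlit d.+1 ltac:(lia).
move: k3 k0 {oE hE h2 IHk kD}; case: k => [|[|[|[|//]]]] // _ _.
- by rewrite (_ : j0 + 1%N%:Z - 1 = j0) ?(negbTE v) ?(negbTE v') ?andbF//; lia.
- by rewrite (_ : j0 + 2%N%:Z - 2 = j0) ?(negbTE v) ?(negbTE v') ?andbF//; lia.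
- by rewrite (_ : j0 + 3%N%:Z - 3 = j0) ?(negbTE v) ?(negbTE v') ?andbF//; lia.
Qed.

(** * Barriers and giant gaps *)

(** Far to the left a gap is then at most about 1/40 of its distance to 0; the search for a barrier
    needs a ratio below 1/9. *)
Definition hat_dense (r : nat) (z : config letter) : Prop := forall i : nat, (r <= i)%N ->
  (exists2 e, - 41 * i%:Z <= e < - 40 * i%:Z & is_hat (z e)) /\
  (exists2 e, 40 * i%:Z < e <= 41 * i%:Z & is_hat (z e)).

Lemma nearest_left (z : config letter) j a : a <= j -> is_hat (z a) ->
  exists e, [/\ a <= e, e <= j, is_hat (z e) & forall k, e < k <= j -> ~~ is_hat (z k)].
Proof.
move=> aj za; have [n] : exists n : nat, j = a + n%:Z by exists (absz (j - a)%R); lia.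
elim: n j aj => [|n IHn] j aj jE.
  by exists a; split; rewrite ?jE//; [lia|move=> k; lia].
have [zj|zj] := boolP (is_hat (z j)).
  by exists j; split => //; move=> k; lia.
have [||e [ae ej ze nh]] := IHn (j - 1); [lia|lia|].
exists e; split => //; first lia.
move=> k ke; have [->//|kj] := eqVneq k j; apply: nh; lia.
Qed.

Lemma nearest_right (z : config letter) j a : j <= a -> is_hat (z a) ->
  exists e, [/\ j <= e, e <= a, is_hat (z e) & forall k, j <= k < e -> ~~ is_hat (z k)].
Proof.
move=> ja za; have [n] : exists n : nat, j = a - n%:Z by exists (absz (a - j)%R); lia.
elim: n j ja => [|n IHn] j ja jE.
  by exists a; split; rewrite ?jE//; [lia|move=> k; lia].
have [zj|zj] := boolP (is_hat (z j)).
  by exists j; split => //; move=> k; lia.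
have [||e [je ea ze nh]] := IHn (j + 1); [lia|lia|].
exists e; split => //; first lia.
move=> k ke; have [->//|kj] := eqVneq k j; apply: nh; lia.
Qed.

Section dense_hats.
Variables (r : nat) (z : config letter).
Hypothesis zD : hat_dense r z.

Lemma dense_left_hat j :
  exists2 e', e' <= j & is_hat (z e') /\ forall k, e' < k <= j -> ~~ is_hat (z k).
Proof.
have [|[h hi zh] _] := zD (i := r + (absz j).+1); first by rewrite leq_addr.
have [|e [_ ej ze nh]] := @nearest_left z j h _ zh; first lia.
by exists e.
Qed.

Lemma dense_prev (n : nat) e' e : (r <= n)%N -> - 40 * n%:Z <= e -> consec z e' e ->
  - 41 * n%:Z <= e'.
Proof.
move=> rn ne [e'e ze' _ nh]; have [[h hi zh] _] := zD rn.
rewrite leNgt; apply/negP => e'h.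
by have := nh h; rewrite zh => /(_ ltac:(lia)).
Qed.

Lemma dense_gap e' e : consec z e' e -> e <= - 40 * r%:Z -> 40 * (e - e') <= 1599 - e.
Proof.
move=> ee' er; pose n := (absz (e - 39)%R %/ 40)%N.
have nE : 40 * n%:Z <= 39 - e /\ - e <= 40 * n%:Z.
  by have := divn_eq (absz (e - 39)%R) 40; have := ltn_pmod (absz (e - 39)%R) (isT : (0 < 40)%N);
    rewrite -/n; lia.
have rn : (r <= n)%N by lia.
by have := dense_prev rn _ ee'; lia.
Qed.

(** The condition under which [escape] applies to [j0 = b - 1]. With the ratio 10/9, the hot phase
    g/5 is at most 2/9 of the distance, below the run length 0.235 kept by the descent. *)
Definition barrier_at b := is_hat (z b) /\
  forall e' e, consec z e' e -> e < b -> 9 * (e - e' - 1) <= 10 * (b - 1 - e).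

(* If [b] is not a barrier because of the hat [c], replace [b] by [c]: each new
   gap outweighs the whole distance covered so far, so by density this stops. *)
Lemma barrier_exists (X : nat) : (r <= X)%N -> (0 < X)%N ->
  exists2 b, - (82 * X%:Z + 465) <= b < - 40 * X%:Z & barrier_at b.
Proof.
move=> rX X0; have [[e0 e0X ze0] _] := zD rX.
(* The invariant, [dense_gap] and e0 >= -41 X give -31 e <= 14391 + 1640 X, and 14391/31 < 465. *)
have descent : forall (n : nat) e e', consec z e' e -> e <= e0 ->
    e0 - e <= 9 * (e - e') -> e + 82 * X%:Z + 465 <= n%:Z ->
    exists2 b, - (82 * X%:Z + 465) <= b < - 40 * X%:Z & barrier_at b.
  elim=> [|n IHn] e e' ee' ee0 inv en; have gap := dense_gap ee'.
    exists e; first lia; split; first by case: ee'.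
    move=> c' c cc' ce; exfalso; lia.
  have [|nb] := pselect (barrier_at e); first by exists e => //; lia.
  have [c' [c [cc' ce viol]]] : exists c' c, [/\ consec z c' c, c < e &
      10 * (e - 1 - c) < 9 * (c - c' - 1)].
    apply: contrapT => nc; apply: nb; split; first by case: ee'.
    move=> c' c cc' ce; rewrite leNgt; apply/negP => viol.
    by apply: nc; exists c', c.
  have ce' : c <= e'.
    rewrite leNgt; apply/negP => e'c; have [_ _ _ nh] := ee'.
    by have [_ _ zc _] := cc'; have := nh c; rewrite zc => /(_ ltac:(lia)).
  (* The invariant persists: e0 - c <= 9 (e - e') + (e - c) <= 10 (e - c) <= 9 (c - c'). *)
  by apply: (IHn c c' cc'); lia.
have [e' e'e [ze' nh]] := dense_left_hat (e0 - 1).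
have e0e' : consec z e' e0 by split => //; [lia|move=> k ke; apply: nh; lia].
by apply: (descent (absz (e0 + 82 * X%:Z + 465)%R) e0 e' e0e'); lia.
Qed.

End dense_hats.

(** * Sparse configurations have small measure *)

Definition sparse (i : nat) (z : config letter) : Prop :=
  (forall k, - 41 * i%:Z <= k < - 40 * i%:Z -> ~~ is_hat (z k)) \/
  (forall k, 40 * i%:Z < k <= 41 * i%:Z -> ~~ is_hat (z k)).

Lemma not_denseP r z : ~ hat_dense r z -> exists2 i, (r <= i)%N & sparse i z.
Proof.
move=> nd; apply: contrapT => ns; apply: nd => i ri.
have {}ns : ~ sparse i z by move=> si; apply: ns; exists i.
split; apply: contrapT => nh; apply: ns; [left|right] => k ki; apply/negP => zk;
  by apply: nh; exists k.
Qed.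

Lemma sparse_dense r i z : (r <= i)%N -> sparse i z -> ~ hat_dense r z.
Proof.
move=> ri [nh|nh] zD; have [[h hi zh] [h' h'i zh']] := zD i ri.
  by have := nh _ hi; rewrite zh.
by have := nh _ h'i; rewrite zh'.
Qed.

Lemma sparse_measurable i : measurable [set z | sparse i z].
Proof.
apply: (@llocal_measurable (41 * i)) => x y xy [nh|nh]; [left|right] => k ki;
  by rewrite xy ?nh//; lia.
Qed.

Lemma denseE r : [set z | hat_dense r z] = ~` \bigcup_(n in ~` `I_r) [set z | sparse n z].
Proof.
rewrite eqEsubset; split => z /=.
  by move=> zD [i /negP]; rewrite -leqNgt => ri /(sparse_dense ri).
move=> ns; apply: contrapT => /not_denseP[i ri si]; apply: ns.
by exists i => //=; apply/negP; rewrite -leqNgt.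
Qed.

Lemma hat_dense_measurable r : measurable [set z | hat_dense r z].
Proof.
rewrite denseE; apply: measurableC; apply: bigcup_measurable => n _; exact: sparse_measurable.
Qed.

(** The extra hatless column [a + n] excludes an L in the last place, since an L is followed by a
    hat. *)
Lemma S1_nohat z a (n : nat) : S1 z -> (forall k, a <= k <= a + n%:Z -> ~~ is_hat (z k)) ->
  cyl a (zeros n) z.
Proof.
move=> zS nh; apply/occursP => k; rewrite size_nseq => kn; rewrite nth_nseq kn.
have [nR _ L _ _] := zS (a + k%:Z); have := nh (a + k%:Z) ltac:(lia).
case: (z (a + k%:Z)) nR L => [s|||]; rewrite ?eqxx// => _ /(_ erefl) h _.
by have := nh (a + k%:Z + 1); rewrite h => /(_ ltac:(lia)).
Qed.

Section dense_measure.
Variables (R : realType) (mu : probability (config letter) R).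
Hypothesis mu_parry : parry_measure S1 mu.

Let mu_S1C : mu (~` S1) = 0%E.
Proof.
have [_ muS _] := mu_parry.
by rewrite (probability_setC mu measurable_S1) muS subee.
Qed.

Lemma mu_sparse : exists t : R, [/\ 0 < t, t < 1 & forall n,
  (mu (~` S1 `|` [set z | sparse (171 + n) z]) <= (2 * t ^+ n)%:E)%E].
Proof.
have [t [t0 t1 mut]] := mu_zeros mu_parry; exists t; split => // n.
pose i := (171 + n)%N.
pose A := cyl (- 41 * i%:Z) (zeros (170 + n)); pose B := cyl (40 * i%:Z + 1) (zeros (170 + n)).
have mS : measurable (~` S1) by apply: measurableC; exact: measurable_S1.
have [mA mB] : measurable A /\ measurable B by split; exact: measurable_cyl.
apply: (@le_trans _ _ (mu (~` S1 `|` (A `|` B)))).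
  apply: le_measure; rewrite ?inE.
  - by apply: measurableU => //; exact: sparse_measurable.
  - by apply: measurableU => //; exact: measurableU.
  move=> z [|sz]; first by left.
  have [zS|] := pselect (S1 z); last by left.
  by right; case: sz => nh; [left|right]; apply: S1_nohat => // k ki; apply: nh; lia.
apply: (le_trans (measureU2 _ mS (measurableU _ _ mA mB))).
have mu0 : (mu (~` S1) <= 0)%E by rewrite mu_S1C.
apply: (le_trans (leeD mu0 (le_trans (measureU2 _ mA mB) (leeD (mut _ _) (mut _ _))))).
by rewrite add0e -EFinD lee_fin mulr2n mulrDl mul1r.
Qed.

(** Borel-Cantelli: the masses of the sparse sets are summable. The complement of [S1] is joined to
    each of them so that one tail covers both failures. *)
Lemma mu_not_dense (e : \bar R) : (0 < e)%E ->
  exists2 r, (0 < r)%N & (mu (~` (S1 `&` [set z | hat_dense r z])) < e)%E.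
Proof.
move=> e0; have [t [t0 t1 mut]] := mu_sparse.
pose F n := ~` S1 `|` [set z | sparse (171 + n) z].
have mF n : measurable (F n).
  apply: measurableU; last exact: sparse_measurable.
  by apply: measurableC; exact: measurable_S1.
have partial n : (\sum_(0 <= i < n) mu (F i) <= (2 / (1 - t) * (1 - t ^+ n))%:E)%E.
  elim: n => [|n IHn]; first by rewrite big_nil expr0 subrr mulr0.
  rewrite big_nat_recr//=; apply: (le_trans (leeD IHn (mut n))).
  rewrite -EFinD lee_fin le_eqVlt; apply/orP; left; apply/eqP; rewrite exprS; field.
  by rewrite subr_eq0 gt_eqF.
have finite : (\sum_(0 <= i <oo) mu (F i) < +oo)%E.
  apply: (@le_lt_trans _ _ (2 / (1 - t))%:E); last exact: ltry.
  apply: lime_le; first by apply: is_cvg_nneseries.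
  apply: nearW => n; apply: (le_trans (partial n)); rewrite lee_fin ler_piMr//.
    by rewrite divr_ge0// subr_ge0 ltW.
  by rewrite gerBl exprn_ge0// ltW.
have tail0 := nneseries_tail_cvg finite (fun _ _ => measure_ge0 _ _).
have [r _ /(_ r (leqnn r)) /= tail] := tail0 _ (open_ereal_lt' e0).
exists (171 + r)%N => //.
apply: le_lt_trans tail; apply: measure_sigma_subadditive_tail => //.
  by apply: measurableC; apply: measurableI; [exact: measurable_S1|exact: hat_dense_measurable].
rewrite setCI denseE setCK => z [nS|[i /= /negP]]; first by exists r => /=; [rewrite ltnn|left].
rewrite -leqNgt => ri si; exists (i - 171)%N => /=; last by right; rewrite /= subnKC; [|lia].
by apply/negP; rewrite -leqNgt; lia.
Qed.

End dense_measure.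

(** * Planting a giant gap *)

Section plant.
Variables (Y T : nat).
Hypothesis T35 : (35 <= T)%N.

(** The slot ends where the gaps relevant near 0 begin ([near_gap]). The margins 173 and 172 leave
    room for the 170 zeros due after a hat and for the end letters. *)
Definition slot_end : int := - 41 * Y%:Z.
Definition giant : int := slot_end - 173.
Definition source : int := giant - 1 - 5 * T%:Z.
Definition slot_start : int := source - 172.

(* The slot is filled with zeros and an E_0 preceded by the hat [source] at
   distance 5T, so that it stays alight during [T] steps out of [4T]; the two
   end letters are chosen so as not to leave [S1]. *)
Definition plant (z : config letter) : config letter := fun k =>
  if (k < slot_start) || (slot_end <= k) then z k
  else if k == slot_start then (if z (slot_start - 1) == lL then z k else l0)
  else if k == slot_end - 1 then (if is_hat (z slot_end) then z k else l0)
  else if k == source then lE ord_max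
  else if k == giant - 1 then lL
  else if k == giant then lE ord0
  else l0.

Variable z : config letter.
Hypothesis zS : S1 z.

Lemma slot_order : [/\ slot_start + 172 = source, source + 175 < giant & giant + 173 = slot_end].
Proof. by rewrite /slot_start /source; split; rewrite /giant; lia. Qed.

Lemma plant_out k : (k < slot_start) || (slot_end <= k) -> plant z k = z k.
Proof. by rewrite /plant => ->. Qed.

Lemma plant_start : z (slot_start - 1) = lL -> plant z slot_start = z slot_start.
Proof.
have [h1 h2 h3] := slot_order.
move=> zL; rewrite /plant zL !eqxx; case: ifP => //.
Qed.

Lemma plant_start0 : z (slot_start - 1) <> lL -> plant z slot_start = l0.
Proof.
have [h1 h2 h3] := slot_order => /eqP/negbTE zL; rewrite /plant zL eqxx.
by rewrite ifF//; lia.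
Qed.

Lemma plant_end : is_hat (z slot_end) -> plant z (slot_end - 1) = z (slot_end - 1).
Proof.
have [h1 h2 h3] := slot_order; move=> ze; rewrite /plant ze eqxx.
by case: ifP => // _; rewrite ifF//; lia.
Qed.

Lemma plant_end0 : ~~ is_hat (z slot_end) -> plant z (slot_end - 1) = l0.
Proof.
have [h1 h2 h3] := slot_order; move=> /negbTE ze; rewrite /plant ze eqxx.
by rewrite ifF ?[in LHS]ifF//; lia.
Qed.

Lemma plant_source : plant z source = lE ord_max.
Proof.
have [h1 h2 h3] := slot_order; rewrite /plant eqxx.
by rewrite ifF 1?ifF 1?ifF//; lia.
Qed.

Lemma plant_giant1 : plant z (giant - 1) = lL.
Proof.
have [h1 h2 h3] := slot_order; rewrite /plant eqxx.
by rewrite ifF 1?ifF 1?ifF 1?ifF//; lia.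
Qed.

Lemma plant_giant : plant z giant = lE ord0.
Proof.
have [h1 h2 h3] := slot_order; rewrite /plant eqxx.
by rewrite ifF 1?ifF 1?ifF 1?ifF 1?ifF//; lia.
Qed.

Lemma plant_in k : slot_start < k < slot_end - 1 -> k <> source ->
  k <> giant - 1 -> k <> giant -> plant z k = l0.
Proof.
move=> ks /eqP/negbTE k1 /eqP/negbTE k2 /eqP/negbTE k3; rewrite /plant k1 k2 k3.
by rewrite ifF 1?ifF 1?ifF//; lia.
Qed.

Variant plant_spec k : letter -> Type :=
| PlantOut of (k < slot_start) || (slot_end <= k) : plant_spec k (z k)
| PlantStart of k = slot_start & z (k - 1) = lL : plant_spec k (z k)
| PlantEnd of k = slot_end - 1 & is_hat (z (k + 1)) : plant_spec k (z k)
| PlantSource of k = source : plant_spec k (lE ord_max)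
| PlantGiant1 of k = giant - 1 : plant_spec k lL
| PlantGiant of k = giant : plant_spec k (lE ord0)
| PlantZero of slot_start <= k < slot_end & k <> source & k <> giant - 1 & k <> giant &
    (k = slot_start -> z (k - 1) <> lL) &
    (k = slot_end - 1 -> ~~ is_hat (z (k + 1))) : plant_spec k l0.

Lemma plantP k : plant_spec k (plant z k).
Proof.
have [h1 h2 h3] := slot_order.
have [ko|ks] := boolP ((k < slot_start) || (slot_end <= k)).
  by rewrite plant_out//; exact: PlantOut.
have [->|k1] := eqVneq k slot_start.
  have [zL|zL] := eqVneq (z (slot_start - 1)) lL.
    by rewrite plant_start//; exact: PlantStart.
  by rewrite plant_start0; [apply: PlantZero => //; [lia|lia|lia|lia|move=> _; exact/eqP|lia]|exact/eqP].
have [->|k2] := eqVneq k (slot_end - 1).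
  have [ze|ze] := boolP (is_hat (z slot_end)).
    by rewrite plant_end//; apply: PlantEnd; rewrite ?subrK.
  by rewrite plant_end0//; apply: PlantZero => //; rewrite ?subrK//; lia.
have [->|k3] := eqVneq k source; first by rewrite plant_source; exact: PlantSource.
have [->|k4] := eqVneq k (giant - 1); first by rewrite plant_giant1; exact: PlantGiant1.
have [->|k5] := eqVneq k giant; first by rewrite plant_giant; exact: PlantGiant.
by rewrite plant_in; [apply: PlantZero|..]; lia.
Qed.

Lemma plant_hat k : is_hat (plant z k) ->
  k = source \/ k = giant \/ [/\ (k <= slot_start) || (slot_end <= k), plant z k = z k &
    is_hat (z k)].
Proof.
have [h1 h2 h3] := slot_order.
case: plantP => //.
- by move=> ko zk; right; right; split => //; lia.
- by move=> ks _ zk; right; right; split => //; lia.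
- move=> ke ze zk; exfalso; have h : z (k + 1) = l0.
    by have := S1_zeros zS zk (j := 0); rewrite addr0; apply.
  by rewrite h in ze.
- by left.
- by right; left.
Qed.

Lemma plant_S1 : S1 (plant z).
Proof.
have [h1 h2 h3] := slot_order => i; split.
- have [zR _ _ _ _] := zS i; move/eqP: zR => zR.
  by apply/eqP; case: plantP => [_|_ _|_ _|_|_|_|_ _ _ _ _ _].
- move=> zi; apply/occursP => j; rewrite size_nseq => j170; rewrite nth_nseq j170.
  have zj : is_hat (z i) -> z (i + 1 + j%:Z) = l0 by move=> ?; exact: S1_zeros.
  have [si|[ig|[io _ zi']]] := plant_hat zi; last (have {}zj := zj zi').
  + case: plantP => //; lia.
  + case: plantP => //; lia.
  + case: plantP => //; lia.
- case: plantP => //.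
  + move=> io ziL; have [_ _ /(_ ziL) h _ _] := zS i.
    have [si|si] := eqVneq (i + 1) slot_start.
      by rewrite si plant_start -?si ?addrK.
    by rewrite plant_out//; lia.
  + by move=> si zL ziL; have [_ _ /(_ zL)] := zS (i - 1); rewrite subrK ziL.
  + move=> ie ze _; rewrite ie subrK plant_out ?lexx ?orbT//.
    by rewrite ie subrK in ze.
  + by move=> ->; rewrite subrK plant_giant.
- move=> zi; have [si|[->|[io ziE zh]]] := @plant_hat i ltac:(by rewrite zi).
  + by move: zi; rewrite si plant_source.
  + exact: plant_giant1.
  + rewrite ziE in zi; have [_ _ _ /(_ zi) zL _] := zS i.
    have [si|si] := eqVneq i slot_end; last by rewrite plant_out//; lia.
    by rewrite si plant_end -?si.
- move=> zi z0; have [si|[ig|[io ziE zh]]] := plant_hat zi.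
  + by right; rewrite plant_in//; lia.
  + by left; rewrite ig plant_giant1.
  + rewrite ziE in zi z0; have [_ _ _ _ /(_ zi z0) zL] := zS i.
    have [si|si] := eqVneq i slot_end; first by rewrite si plant_end -?si.
    by rewrite plant_out//; lia.
Qed.

Lemma consec_plant e' e : (e <= slot_start) || (slot_end <= e') ->
  consec (plant z) e' e -> consec z e' e.
Proof.
have [h1 h2 h3] := slot_order.
move=> ee' [e'e ze' ze nh]; split => //.
- by have [?|[?|[_ _]]] := plant_hat ze' => //; lia.
- by have [?|[?|[_ _]]] := plant_hat ze => //; lia.
- by move=> k ke; have := nh k ke; rewrite plant_out//; lia.
Qed.

Lemma plant_consec e' e : slot_end <= e' -> consec z e' e -> consec (plant z) e' e.
Proof.
move=> ee' [e'e ze' ze nh]; split => //; try by rewrite plant_out//; lia.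
by move=> k ke; rewrite plant_out ?nh//; lia.
Qed.

Lemma plant_source_giant : consec (plant z) source giant.
Proof.
have [h1 h2 h3] := slot_order; split; rewrite ?plant_source ?plant_giant//; first lia.
move=> k ks; have [->|kg] := eqVneq k (giant - 1); first by rewrite plant_giant1.
by rewrite plant_in//; lia.
Qed.

Lemma plant_left_hat r j : hat_dense r z ->
  exists2 e', e' <= j & is_hat (plant z e') /\ forall k, e' < k <= j -> ~~ is_hat (plant z k).
Proof.
move=> zD; have [|[h hi zh] _] := zD (r + (absz j + absz slot_start).+1)%N.
  by rewrite leq_addr.
have [||e [_ ej ze nh]] := @nearest_left (plant z) j h; [lia| |by exists e].
by rewrite plant_out//; lia.
Qed.

(** The slot is about 40 Y columns away from [b]. Density supplies a hat just right of the slot and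
    one not far left of it, so the gaps adjoining the slot remain short for their distance; only the
    giant one need not. *)
Lemma plant_shadow r b e' e : hat_dense r z -> (r <= Y)%N -> (465 <= Y)%N ->
  - Y%:Z <= b -> barrier_at z b -> consec (plant z) e' e -> e < b ->
  9 * (e - e' - 1) <= 10 * (b - 1 - e) \/ e = giant.
Proof.
move=> zD rY Y465 Yb [zb bar] ee' eb; have [h1 h2 h3] := slot_order.
have [[h hY zh] _] := zD Y rY; have [e'e ze' ze nh] := ee'.
have sE : slot_end = - 41 * Y%:Z by [].
have [eo|es] := lerP slot_end e.
  left; have [e'o|e's] := lerP slot_end e'.
    by apply: bar => //; apply: consec_plant => //; rewrite e'o orbT.
  have eh : e <= h.
    rewrite leNgt; apply/negP => he; have := nh h ltac:(lia).
    by rewrite plant_out ?zh//; lia.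
  have ge' : giant <= e'.
    rewrite leNgt; apply/negP => e'g; have := nh giant ltac:(lia).
    by rewrite plant_giant.
  lia.
have [esrc|[->|[eo zE zeh]]] := plant_hat ze; last 2 first.
- by right.
- by left; apply: bar => //; apply: consec_plant => //; lia.
left; pose n := (absz (slot_start - 39)%R %/ 40)%N.
have nE : 40 * n%:Z <= 39 - slot_start /\ - slot_start <= 40 * n%:Z.
  by have := divn_eq (absz (slot_start - 39)%R) 40;
    have := ltn_pmod (absz (slot_start - 39)%R) (isT : (0 < 40)%N); rewrite -/n; lia.
have [|[c cn zc] _] := zD n; first lia.
have ce' : c <= e'.
  rewrite leNgt; apply/negP => e'c; have := nh c ltac:(lia).
  by rewrite plant_out ?zc//; lia.
lia.
Qed.

End plant.

(** * Return visits to a cylinder *)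

Lemma agree_flush z z' (t t' m : nat) b : b <= - m%:Z ->
  (absz (m%:Z - b + 1)%R <= t)%N -> (absz (m%:Z - b + 1)%R <= t')%N ->
  (forall d, (d <= absz (m%:Z - b + 1)%R)%N ->
     ~~ alight z (t - d) (b - 1) /\ ~~ alight z' (t' - d) (b - 1)) ->
  (forall k d, b <= k <= m%:Z -> (d <= absz (m%:Z - b + 1)%R)%N ->
     orbit1 (t - d) z k = orbit1 (t' - d) z' k) ->
  agree m (orbit_phase t z) (orbit_phase t' z').
Proof.
set D := absz _ => bm Dt Dt' unlit same k km; split.
  by rewrite !orbit_phase1; have := same k 0%N ltac:(lia) isT; rewrite !subn0.
have := @alight_flush z z' t t' D (b - 1) Dt Dt' unlit _ (absz (k - b + 1)%R) 0%N.
rewrite !subn0 addn0 (_ : b - 1 + (absz (k - b + 1)%R)%:Z = k); last lia.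
by rewrite /alight => -> //; [move=> e d be dD; rewrite /hot same//; lia|lia].
Qed.

Section visits.
Variables (r X m : nat).
Let Y := (82 * X + 465)%N.
Hypotheses (rX : (r <= X)%N) (X0 : (0 < X)%N) (mX : (m <= X)%N).
Variable P : nat.
Hypothesis P_period : forall g, (0 < g <= 42 * Y)%N -> (4 * g %| P)%N.
Variable z : config letter.
Hypotheses (zS : S1 z) (zD : hat_dense r z).
Variable b : int.
Hypotheses (bX : - Y%:Z <= b < - 40 * X%:Z) (bar : barrier_at z b).

(** Such gaps lie right of the slot, hence survive planting, and are short enough for [P] to be a
    common period. *)
Lemma near_gap e' e : consec z e' e -> - Y%:Z <= e <= 41 * X%:Z ->
  slot_end Y <= e' /\ e - e' <= 42 * Y%:Z.
Proof.
move=> ee' eY; have := dense_prev zD (n := Y) _ _ ee'.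
by rewrite /slot_end; lia.
Qed.

Lemma near_consec k : - Y%:Z <= k <= m%:Z ->
  exists l e, [/\ consec z l e, l < k <= e & - Y%:Z <= e <= 41 * X%:Z].
Proof.
move=> kY; have [_ [h hX zh]] := zD rX.
have [|e [ke eh ze nhe]] := @nearest_right z k h _ zh; first lia.
have [l lk [zl nhl]] := dense_left_hat zD (k - 1).
exists l, e; split; [|lia|lia]; split => //; first lia.
move=> i li; have [ik|ik] := lerP k i; first by apply: nhe; lia.
by apply: nhl; lia.
Qed.

Lemma near_period t n k : - Y%:Z <= k <= m%:Z -> orbit1 (t + P * n) z k = orbit1 t z k.
Proof.
move=> kY; have [l [e [le lke eY]]] := near_consec kY.
have g171 := consec_gap zS le; have [_ gY] := near_gap le eY.
apply: (orbit1_period zS le _ _ lke); apply/dvdn_mulr/P_period; lia.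
Qed.

Lemma barrier_dark s : ~~ alight z s (b - 1).
Proof.
have [zb shadow] := bar.
have := @escape z zS (dense_left_hat zD) (b - 1) s%:Z; rewrite subrK => /(_ zb); apply.
by move=> e' e ee' eb; left; apply: shadow => //; lia.
Qed.

Lemma revisit t n : (Y + m + 1 <= t)%N -> agree m (orbit_phase t z) (orbit_phase (t + P * n) z).
Proof.
move=> Yt; apply: (@agree_flush z z t (t + P * n) m b); try lia.
  by move=> d _; split; exact: barrier_dark.
move=> k d kb dD; rewrite (_ : (t + P * n - d = t - d + P * n)%N); last lia.
by rewrite near_period//; lia.
Qed.

(** The nearest hat [e <= 0] may be so close that [e + 3 > 0], and [no_run] speaks only of columns
    from [e + 3] on. This is why several columns, and the scale 3, are needed. *)
Lemma dark_column (al : nat) : exists s j,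
  [/\ (al <= s <= al + 42 * Y)%N, 0 <= j <= 3 & ~~ alight z s j].
Proof.
have [zb _] := bar.
have [e e0 [ze nh]] := dense_left_hat zD 0.
have be : b <= e.
  by rewrite leNgt; apply/negP => eb; have := nh b; rewrite zb => /(_ ltac:(lia)).
pose j := Num.max 0 (e + 3).
have jE : j = 0 /\ e + 3 <= 0 \/ j = e + 3 /\ 0 < e + 3.
  by rewrite /j; case: (lerP 0 (e + 3)) => h; [have [|] := eqVneq (e + 3) 0; lia|left; lia].
have dark s : ~~ lit z s (b - 1) by rewrite /lit negb_and barrier_dark orbT.
have := @no_run z zS (dense_left_hat zD) (b - 1) (42 * Y) _ dark e j al%:Z ze.
rewrite subrK => /(_ zb); case=> //; try lia.
- move=> k ke; have [k0|k0] := lerP k 0; first by apply: nh; lia.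
  have := S1_zeros zS ze (j := absz (k - e - 1)%R).
  rewrite (_ : e + 1 + _ = k); last lia.
  by move=> ->//; lia.
- move=> e' d ee' de; have [_ ?] := near_gap ee' ltac:(lia); lia.
move=> s sal dk; exists (absz s), j; split; [lia|lia|].
by move: dk; rewrite /lit; have -> : 0 <= s by lia.
Qed.

Section with_giant.
Variable T : nat.
Hypothesis T35 : (35 <= T)%N.
Let z' := plant Y T z.
Let zS' : S1 z' := @plant_S1 Y T T35 z zS.

Lemma plant_near t k : - Y%:Z <= k <= m%:Z -> orbit1 t z' k = orbit1 t z k.
Proof.
move=> kY; have [l [e [le lke eY]]] := near_consec kY.
have g171 := consec_gap zS le; have [sl _] := near_gap le eY.
apply: (orbit1_same zS le t zS' _ _ _ lke).
- exact: plant_consec.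
- by rewrite /z' plant_out//; lia.
- by rewrite /z' plant_out//; lia.
Qed.

Lemma hot_plant t : hot z' (giant Y) t = ((t %/ T) %% 4 == 0)%N.
Proof.
have sg := @plant_source_giant Y T T35 z.
apply: (hot_giant zS' sg); [exact: plant_giant1|exact: plant_giant|].
by rewrite /source; lia.
Qed.

(** The giant gap may break the barrier ratio, but then the other alternative of [escape] is
    available: its hat is off at all times from which it could influence column [b - 1] at time
    [t]. *)
Lemma plant_dark (t : nat) :
  (forall s, t%:Z - 42 * Y%:Z - 200 <= s <= t%:Z -> ~~ hotz z' (giant Y) s) ->
  ~~ alight z' t (b - 1).
Proof.
move=> off; have [zb _] := bar.
have := @escape z' zS' (fun j => plant_left_hat Y T35 j zD) (b - 1) t%:Z; rewrite subrK.
rewrite {1}/z' plant_out; last by rewrite /slot_end; lia.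
move=> /(_ zb); apply => e' e ee' eb.
have [||||sh|eg] := plant_shadow T35 zS zD _ _ _ bar ee'; [lia|lia|lia|lia|by left|].
by right; rewrite eg => s ss; apply: off; move: ss; rewrite /giant /slot_end; lia.
Qed.

Lemma plant_visit t n :
  (forall s, (t + P * n)%N%:Z - 45 * Y%:Z - 300 <= s <= (t + P * n)%N%:Z ->
     ~~ hotz z' (giant Y) s) ->
  (Y + m + 1 <= t)%N -> agree m (orbit_phase t z) (orbit_phase (t + P * n) z').
Proof.
move=> off Yt; apply: (@agree_flush z z' t (t + P * n) m b); try lia.
  move=> d dD; split; first exact: barrier_dark.
  apply: plant_dark => s st; apply: off; lia.
move=> k d kb dD; rewrite (_ : (t + P * n - d = t - d + P * n)%N); last lia.
by rewrite plant_near ?near_period//; lia.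
Qed.

Lemma plant_lit n s j : - 3 <= j <= 3 ->
  (4 * T * n)%N%:Z + 3 - giant Y < s%:Z -> s%:Z <= (4 * T * n + T)%N%:Z -> alight z' s j.
Proof.
move=> j3 ns sn; have gY : giant Y = - 41 * Y%:Z - 173 by [].
have := @alight_forward z' (giant Y) (4 * T * n)%N (4 * T * n + T)%N (absz (j - giant Y)%R) s.
rewrite (_ : giant Y + _ = j); last lia.
apply; [|lia|lia].
move=> u un; rewrite hot_plant (_ : u %/ T = 4 * n)%N ?modnMr//.
rewrite (_ : u = 4 * n * T + (u - 4 * T * n))%N; last lia.
rewrite divnMDl ?divn_small ?addn0//; lia.
Qed.

Lemma plant_off n s u : (4 * T * n + T <= u)%N -> u%:Z <= s -> s < (4 * T * n + 4 * T)%N%:Z ->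
  ~~ hotz z' (giant Y) s.
Proof.
move=> nu us sn; rewrite /hotz negb_and; apply/orP; right.
rewrite hot_plant; set v := absz s.
have [c [c0 cv]] : exists c, (0 < c < 4)%N /\ (v %/ T = n * 4 + c)%N.
  exists (v %/ T - n * 4)%N.
  have : (n * 4 + 1 <= v %/ T)%N by rewrite leq_divRL//; lia.
  have : (v %/ T < n * 4 + 4)%N by rewrite ltn_divLR//; lia.
  lia.
rewrite cv modnMDl modn_small; lia.
Qed.

End with_giant.
End visits.

Lemma local_part (R : realType) (mu : {measure set (config letter) -> \bar R}) W n :
  measurable W -> (0 < mu W)%E -> exists2 x, W x & (0 < mu (W `&` window n x))%E.
Proof.
move=> mW W0; apply: contrapT => nx; move: W0.
rewrite (measure_code (@measurable_lcode n) mu mW) big1 ?ltxx// => k _.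
have [->|/set0P[x [Wx /= <-]]] := eqVneq (W `&` @lcode n @^-1` [set k]) set0.
  by rewrite measure0.
have -> : @lcode n @^-1` [set lcode n x] = window n x.
  by rewrite eqEsubset; split => y /=; [move=> /esym/wcodeP|move=> xy; exact/esym/wcodeP].
apply: contrapT => /eqP W0; apply: nx; exists x => //.
by rewrite lt0e W0 measure_ge0.
Qed.

Lemma window_measurable n (x : config letter) : measurable (window n x).
Proof. by apply: open_config_measurable; exact: window_open. Qed.

(** On a window that fixes the slot and margins of length 170, [plant] replaces one word [old] by
    one word [new], so [swap_measure] applies. [W'] consists of the points reading [new] that fall
    into the chosen part of [W] when [old] is written back. *)
Lemma plant_measure (R : realType) (mu : probability (config letter) R) (Y T : nat) W :
  parry_measure S1 mu -> (35 <= T)%N -> measurable W -> W `<=` S1 -> (0 < mu W)%E ->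
  exists W', [/\ measurable W', (0 < mu W')%E &
    forall z', W' z' -> exists2 z, W z & z' = plant Y T z].
Proof.
move=> mu_parry T35 mW WS W0.
have [h1 h2 h3] := @slot_order Y T T35.
pose i := slot_start Y T - 170; pose N := absz (slot_end Y - slot_start Y T)%R.
pose n := (absz i + 170 + N + 170)%N.
have [z0 Wz0 W0z] := local_part n mW W0; have z0S := WS _ Wz0.
have mWn : measurable (W `&` window n z0).
  by apply: measurableI => //; exact: window_measurable.
pose v := word z0 i 170; pose s := word z0 (slot_end Y) 170.
pose old := word z0 (slot_start Y T) N; pose new := word (plant Y T z0) (slot_start Y T) N.
have wE z : word z i (170 + (N + 170)) =
    word z i 170 ++ word z (slot_start Y T) N ++ word z (slot_end Y) 170.
  rewrite !word_cat (_ : i + 170%N%:Z = slot_start Y T); last by rewrite /i; lia.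
  by rewrite (_ : slot_start Y T + N%:Z = slot_end Y)//; rewrite /N; lia.
have oldE : v ++ old ++ s = word z0 i (170 + (N + 170)) by rewrite wE.
have newE : v ++ new ++ s = word (plant Y T z0) i (170 + (N + 170)).
  rewrite wE; congr (_ ++ (_ ++ _)); apply: (@eq_from_nth _ l0); rewrite ?size_word// => k k170.
    by rewrite !nth_word// plant_out//; rewrite /i; lia.
  by rewrite !nth_word// plant_out//; lia.
have vS : i + (size v)%:Z = slot_start Y T by rewrite size_word /i; lia.
have rold : readable (v ++ old ++ s) by rewrite oldE; exact: S1_word_readable.
have rnew : readable (v ++ new ++ s).
  by rewrite newE; apply: S1_word_readable; exact: plant_S1.
have := @swap_measure R mu mu_parry i v old new s _ _ _ _ rold rnew mWn.
rewrite !size_word vS => /(_ isT isT erefl) swap.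
exists (cyl i (v ++ new ++ s) `&` overwrite (slot_start Y T) old @^-1` (W `&` window n z0)).

split.
- apply: measurableI; first exact: measurable_cyl.
  rewrite -[X in measurable X]setTI; exact: measurable_overwrite.
- rewrite swap setIC.
  rewrite (_ : _ `&` cyl _ _ = W `&` window n z0)//.
  apply/setIidPl => z [_ zn]; rewrite oldE /cyl /= (@eq_occurs _ z0) ?word_occurs// => k.
  by rewrite size_word => kN; rewrite zn//; rewrite /n; lia.
- move=> z' [z'w [Wz zn]]; exists (overwrite (slot_start Y T) old z') => //.
  apply/funext => k; move: zn; set z := overwrite _ _ _ => zn.
  have zE j : slot_start Y T - 1 <= j <= slot_end Y -> z j = z0 j.
    by move=> js; apply: zn; rewrite /n /i /N; lia.
  have pE : slot_start Y T <= k < slot_end Y -> plant Y T z k = plant Y T z0 k.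
    by move=> ks; rewrite /plant !zE//; lia.
  have [ks|ks] := boolP (slot_start Y T <= k < slot_end Y); last first.
    rewrite plant_out; last lia.
    by rewrite /z overwrite_out// size_word /N; lia.
  have {}z'w : occurs z' i (v ++ new ++ s) := z'w.
  rewrite pE//; move: z'w; rewrite !occurs_cat vS => /and3P[_ /occursP + _].
  move=> /(_ (absz (k - slot_start Y T)%R)); rewrite size_word nth_word; last by rewrite /N; lia.
  rewrite (_ : slot_start Y T + _ = k); last lia.
  by apply; rewrite /N; lia.
Qed.

(** * Sensitivity *)

Definition lit_during (i1 i2 : nat) : set phase := [set y | forall (i : nat) (j : int),
  (i1 <= i <= i2)%N -> - 3 <= j <= 3 -> (iter i F_e y).2 j].

Lemma lit_during_local i1 i2 : local_set (3 + 10 * i2) (lit_during i1 i2).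
Proof.
move=> x y xy xL i j ii j3.
have xyi : agree (3 + 10 * i) x y by apply: agree_le xy; lia.
have j3' : - 3%N%:Z <= j <= 3%N%:Z by lia.
by have [_ ->] := iter_F_e_agree xyi j3'; exact: xL.
Qed.

Lemma C_local m x : local_set m (C_ m x).
Proof. by move=> y y' yy' xy j jm; have [-> ->] := yy' j jm; exact: xy. Qed.

Theorem proposition8 (R : realType)
    (mu1 : probability (config letter) R)
    (mu_c : probability (config letter * config bool)%type R) :
  parry_measure S1 mu1 ->
  weak_star_limit (cesaro_mean (mu_I mu1) F_e) mu_c ->
  sensitive F_e (topological_support mu_c).
Proof.
move=> mu_parry mu_lim [x [Sx /(_ 3%N isT)[m [_ CB]]]].
have lU := @C_local m x; set U := C_ m x in lU CB.
have U0 : (0 < mu_c U)%E by exact: support_C.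
have [r r0 sparse_lt] := mu_not_dense mu_parry U0.
set G := S1 `&` _ in sparse_lt.
have mG : measurable G by apply: measurableI; [exact: measurable_S1|exact: hat_dense_measurable].
have [X [rX X0 mX]] : exists X, [/\ (r <= X)%N, (0 < X)%N & (m <= X)%N].
  by exists (r + m)%N; split; lia.
pose Y := (82 * X + 465)%N; have YE : (Y = 82 * X + 465)%N by [].
(* By time [Y + m + 1] the columns between the barrier and [m] have forgotten their initial values,
   as [revisit] needs. *)
have [t1 Yt1 W0] := late_visit mu_lim (Y + m + 1) lU mG sparse_lt.
set W := G `&` _ in W0.
have mW : measurable W.
  by apply: measurableI => //; apply: measurable_orbit_phase; exact: local_measurable lU.
have [P [P0 P_period]] : exists P, (0 < P)%N /\
    forall g, (0 < g <= 42 * Y)%N -> (4 * g %| P)%N.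
  exists (4 * (42 * Y)`!)%N; split; first by rewrite muln_gt0 fact_gt0.
  by move=> g gY; rewrite dvdn_mul// dvdn_fact.
(* [K] makes [T] exceed all delays below; as a multiple of [P], the time [T] keeps the letters near
   0 in phase. *)
have [K KE] : exists K, K = (t1 + 100 * Y + 1000)%N by eexists.
have [T TE] : exists T, T = (P * K)%N by eexists.
have KT : (K <= T)%N by rewrite TE leq_pmull.
have PT : (P <= T)%N by rewrite TE leq_pmulr//; lia.
have T35 : (35 <= T)%N by lia.
have [W' [mW' W'0 W'W]] := plant_measure Y mu_parry T35 mW (fun z Wz => Wz.1.1) W0.
have t1P := divn_eq t1 P; have t1mod := ltn_pmod t1 P0.
(* A time congruent to [t1] modulo [P] in the last quarter of the cycle 4T, when the giant hat has
   long been off. *)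
have [tau tauT] : exists tau, tau = (3 * T + t1 %% P)%N by eexists.
have tauE k : (tau + 4 * T * k = t1 + P * (3 * K - t1 %/ P + 4 * K * k))%N.
  have t1K : (t1 %/ P <= 3 * K)%N by have := leq_div t1 P; lia.
  have := leq_mul (leqnn P) t1K; rewrite {2}t1P tauT TE mulnDr mulnBr; nia.
(* The next hot phase starts at 4T and has lit column 3 from time 4T + 3 - giant + 1 on, and -giant
   = 41 Y + 173. *)
have [i1 i1E] : exists i1, i1 = (4 * T + 177 + 41 * Y - tau)%N by eexists.
(* The window has the length within which [dark_column] finds a dark place. *)
have [i2 i2E] : exists i2, i2 = (i1 + 42 * Y)%N by eexists.
(* Planted points visit [U] once in every cycle 4T, each time shortly before the columns near 0 are
   lit. *)
have [y1 [U1 L1] S1y] : exists2 y, (U `&` lit_during i1 i2) y & topological_support mu_c y.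
  apply: (local_support (local_setI lU (@lit_during_local i1 i2))).
  apply: (positive_frequency mu_lim (local_setI lU (@lit_during_local i1 i2)) mW' W'0
    (tau := tau) (p := 4 * T)); first lia.
  move=> k z' /W'W[z [[zS zD] zU] ->].
  have [b bX bar] := barrier_exists zD rX X0.
  have bY : - Y%:Z <= b < - 40 * X%:Z by rewrite YE; lia.
  split.
    rewrite tauE; apply: lU zU.
    apply: (plant_visit rX X0 mX P_period zS zD bY bar T35) => //.
    rewrite -tauE => s sk.
    have := plant_off rX X0 mX zS bY T35 (n := k) (s := s)
      (u := (tau + 4 * T * k - 45 * Y - 300)%N).
    by apply; lia.
  move=> i j ii j3; rewrite -orbit_phaseD.
  have := plant_lit rX X0 mX zS bY T35 (n := k.+1) (s := (i + (tau + 4 * T * k))%N) j3.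
  by rewrite /giant /slot_end; apply; lia.
(* The same points without the planted gap return to [U] with period [P] and never stay lit for so
   long. *)
have [y2 [U2 L2] S2y] : exists2 y, (U `&` ~` lit_during i1 i2) y & topological_support mu_c y.
  have lV := local_setI lU (local_setC (@lit_during_local i1 i2)).
  apply: (local_support lV).
  apply: (positive_frequency mu_lim lV mW W0 (tau := t1) (p := P)) => //.
  move=> k z [[zS zD] zU].
  have [b bX bar] := barrier_exists zD rX X0.
  have bY : - Y%:Z <= b < - 40 * X%:Z by rewrite YE; lia.
  split; first by apply: lU zU; exact: (revisit rX X0 mX P_period zS zD bY bar).
  move=> zL; have [s [j [sk j3]]] := dark_column rX X0 mX zS zD bY bar (t1 + P * k + i1).
  apply/negP; rewrite negbK.
  have := zL (s - (t1 + P * k))%N j; rewrite -orbit_phaseD subnK; last lia.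
  by apply; lia.
apply: L2 => i j ii j3.
have [_ ->] := CB _ (conj U2 S2y) i j ltac:(lia).
have [_ <-] := CB _ (conj U1 S1y) i j ltac:(lia).
exact: L1.
Qed.
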